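(* Let $F$ be a tract and $n\ge1$. There are natural bijections between the following three sets: (1) weak orthogonal $F$-matroids on $[n]\cup[n]^*$; (2) projective equivalence classes (under multiplication by elements of $F^\times$) of weak restricted Grassmann--Plücker functions (of type D) $\mathcal T_n\cup\mathcal A_n\to F$; (3) weak $F$-circuit sets of orthogonal matroids on $[n]\cup[n]^*$.
   Context: A tract is a multiplicative monoid $F=F^\times\sqcup\{0\}$ with $F^\times$ an abelian group and $0\cdot a=0$, together with a null set $N_F$ of formal finite sums of elements of $F$ (modulo $0+\sum a_i=\sum a_i$) such that $F\cap N_F=\{0\}$, there is a unique $-1\in F^\times$ with $1+(-1)\in N_F$, and $c\alpha\in N_F$ for $\alpha\in N_F$, $c\in F^\times$. Notation: $[n]^*=\{1^*,\dots,n^*\}$, $(i^* )^*=i$, $S^*=\{s^*:s\in S\}$; order $1<1^*<2<2^*<\dots<n<n^*$; $|X<i|$ = number of elements of $X$ smaller than $i$; $[P]\in\{0,1\}$ is the indicator of $P$. Skew pair: $\{i,i^*\}$. Transversal: $T$ with $|T\cap\{i,i^*\}|=1$ for all $i$; set $\mathcal T_n$; $\mathcal T_n^\sigma$ = transversals with $|T\cap[n]^*|\equiv\sigma \pmod 2$. Subtransversal: subset of a transversal. Almost-transversal: $n$-subset containing exactly one skew pair; set $\mathcal A_n$. Hyper-/hypo-transversal: transversal with one element added/removed. Orthogonal matroid: $([n]\cup[n]^*,\mathcal B)$, $\mathcal B\subseteq\mathcal T_n$, such that for $B_1,B_2\in\mathcal B$ and skew pair $\{i,i^*\}\subseteq B_1\triangle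 B_2$ there is a skew pair $\{j,j^*\}\subseteq(B_1\triangle B_2)\setminus\{i,i^*\}$ with $B_k\triangle\{i,i^*,j,j^*\}\in\mathcal B$ for $k=1,2$. Circuits: minimal subtransversals contained in no basis. For a basis $B$ and $e\in B^*$, the fundamental circuit $\mathrm{FC}(B,e)$ is the unique circuit contained in the transversal $B\triangle\{e,e^*\}$ (it equals $\{x\in B\triangle\{e,e^*\}: B\triangle\{e,e^*,x,x^*\}\in\mathcal B\}$). Circuits $C_1,\dots,C_k$ are modular if there are a basis $B$ and distinct $e_1,\dots,e_k\in B^*$ with $C_i=\mathrm{FC}(B,e_i)$; a modular tuple is of the first kind if all pairwise unions are subtransversals, of the second kind if no pairwise union is a subtransversal. Weak Wick function: $\psi:\mathcal T_n\to F$ whose support is the basis set of an orthogonal matroid and such that for all $T,T'\in\mathcal T_n$ with $|(T\triangle T')\cap[n]|=4$, $\sum_{i\in(T\triangle T')\cap[n]}(-1)^{|(T\triangle T')\cap[n]<i|}\psi(T\triangle\{i,i^*\})\psi(T'\triangle\{i,i^*\})\in N_F$. A weak orthogonal $F$-matroid is an equivalence class of weak Wick functions under multiplication by $F^\times$. Antisymmetric matroid: $([n]\cup[n]^*,\mathcal B)$ with $\emptyset\neq\mathcal B\subseteq\mathcal T_n\cup\mathcal A_n$ such that (a) for every hyper-transversal $S$ and hypo-transversal $S'$ there are either no or at least two $i\in S\setminus S'$ with $S\setminus\{i\}$ and $S'\cup\{i\}$ both in $\mathcal B$; (b) for every transversal $T$ and distinct $i,j\in[n]$, $(T\setminus\{i,i^*\})\cup\{j,j^*\}\in\mathcal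 B$ iff $(T\cup\{i,i^*\})\setminus\{j,j^*\}\in\mathcal B$. It is even if $\mathcal B\cap\mathcal T_n\subseteq\mathcal T_n^\sigma$ for some $\sigma\in\{0,1\}$. Weak restricted Grassmann--Plücker function: $\varphi:\mathcal T_n\cup\mathcal A_n\to F$ whose support is the basis set of an even antisymmetric matroid and such that: (rGP2$'$) for every hyper-transversal $S$ and hypo-transversal $S'$ with $|S\setminus S'|\le 4$, $\sum_{i\in S\setminus S'}(-1)^{|S\triangle S'<i|}\varphi(S\setminus\{i\})\varphi(S'\cup\{i\})\in N_F$; (rGP3) there is $\sigma\in\{0,1\}$ with $\varphi(B)=0$ for all $B\in\mathcal T_n^{1-\sigma}$; (rGP4) for all $B\in\mathcal T_n^\sigma$ and distinct $i,j\in[n]$, $\varphi((B\setminus\{i,i^*\})\cup\{j,j^*\})=(-1)^{[i\in B]+[j\in B]}\varphi((B\cup\{i,i^*\})\setminus\{j,j^*\})$. $F$-signature of an orthogonal matroid $M$: a set $\mathcal C$ of nonzero vectors in $F^E$, $E=[n]\cup[n]^*$, closed under multiplication by $F^\times$, whose supports $\underline X=\{e:X(e)\neq0\}$ are exactly the circuits of $M$. Write $\langle X,Y\rangle=\sum_{i\in E}X(i)Y(i^* )$. A weak $F$-circuit set of $M$ is an $F$-signature $\mathcal C$ of $M$ such that: (O$_2'$) $\langle X,Y\rangle\in N_F$ whenever $\underline X,\underline Y$ form a modular pair of the second kind; (L-i$'$) if $X_1,X_2\in\mathcal C$ with $\underline X_1,\underline X_2$ a modular pair of the first kind, $f\in\underline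 X_1\cap\underline X_2$ and $X_1(f)+X_2(f)\in N_F$, then there is $X_3\in\mathcal C$ with $X_3(f)=0$ and $X_1(g)+X_2(g)+X_3(g)\in N_F$ for all $g\in E$; (L-ii$'$) if $X_1,X_2,X_3\in\mathcal C$ with $\underline X_i=\mathrm{FC}(B,e_i)$ a modular triple of the second kind and $X_{i+1}(e_i^* )+X_{i+2}(e_i^* )\in N_F$ for each $i$ (indices mod 3), then there is $X_4\in\mathcal C$ with $X_4(e_i^* )=0$ for $i=1,2,3$ and $X_1(g)+X_2(g)+X_3(g)+X_4(g)\in N_F$ for all $g\in E$. *)

(* Defs.v *)
Set Warnings "-notation-overridden,-notation-incompatible-prefix".
From mathcomp Require Import classical_sets functions.
From mathcomp Require Import all_boot.

Set Implicit Arguments.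
Unset Strict Implicit.
Unset Printing Implicit Defensive.

(* A formal finite sum is the sequence of its summands.  [tnull_perm] and
   [tnull_cons0] make [tnull] a predicate on formal sums modulo 0 + s = s. *)
Record tract := Tract {
  tract_sort :> eqType;
  tzero : tract_sort;
  tone : tract_sort;
  tneg1 : tract_sort;
  tmul : tract_sort -> tract_sort -> tract_sort;
  tnull : seq tract_sort -> Prop;
  tmulA : associative tmul;
  tmulC : commutative tmul;
  tmul1 : left_id tone tmul;
  tmul0 : left_zero tzero tmul;
  tone_neq0 : tone != tzero;
  tmul_inv : forall a, a != tzero -> exists b, tmul b a = tone;
  tnull_perm : forall s t, perm_eq s t -> tnull s -> tnull t;
  tnull_cons0 : forall s, tnull (tzero :: s) <-> tnull s;
  tnull1 : forall a, tnull [:: a] <-> a = tzero;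
  tneg1_neq0 : tneg1 != tzero;
  tnull_neg1 : tnull [:: tone; tneg1];
  tneg1_unique : forall a, a != tzero -> tnull [:: tone; a] -> a = tneg1;
  tnull_scale : forall c s, c != tzero -> tnull s -> tnull [seq tmul c a | a <- s]
}.

Arguments tzero {_}.
Arguments tone {_}.
Arguments tneg1 {_}.
Arguments tmul {_}.
Arguments tnull {_}.

Declare Scope tract_scope.
Local Open Scope tract_scope.
Notation "a ⋅ b" := (tmul a b) (at level 40, left associativity) : tract_scope.

Definition sgn {F : tract} (k : nat) : F := iter k (tmul tneg1) tone.

Definition scale {F : tract} {I : Type} (c : F) (f : I -> F) : I -> F :=
  fun x => c ⋅ f x.

Definition proj_class {F : tract} {I : Type} (f : I -> F) : set (I -> F) :=
  [set scale c f | c in [set c : F | c != tzero]]%classic.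

(* (i, false) is the element i and (i, true) is i^*. *)
Definition ground (n : nat) : finType := ('I_n * bool)%type.

Definition star {n} (x : ground n) : ground n := (x.1, ~~ x.2).

(* The order 1 < 1^* < 2 < 2^* < ... *)
Definition ground_lt {n} (x y : ground n) : bool :=
  (x.1 < y.1) || ((x.1 == y.1) && (x.2 < y.2)).

Definition nlt {n} (X : {set ground n}) (x : ground n) : nat :=
  #|[set y in X | ground_lt y x]|.

Definition unstarred {n} : {set ground n} := [set x | ~~ x.2].
Definition starred {n} : {set ground n} := [set x | x.2].

Definition skew_pair {n} (i : 'I_n) : {set ground n} := [set (i, false); (i, true)].

Definition symdiff {T : finType} (A B : {set T}) : {set T} :=
  (A :\: B) :|: (B :\: A).

Definition transversals n : {set {set ground n}} :=
  [set T | [forall i, #|T :&: skew_pair i| == 1]].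

Definition transversals_par n (s : bool) : {set {set ground n}} :=
  [set T in transversals n | odd #|T :&: starred| == s].

Definition subtransversal {n} (S : {set ground n}) : bool :=
  [exists T in transversals n, S \subset T].

Definition almost_transversals n : {set {set ground n}} :=
  [set A : {set ground n} | (#|A| == n) && (#|[set i | skew_pair i \subset A]| == 1)].

Definition hyper_transversal {n} (S : {set ground n}) : bool :=
  [exists T in transversals n, exists x, (x \notin T) && (S == x |: T)].

Definition hypo_transversal {n} (S : {set ground n}) : bool :=
  [exists T in transversals n, exists x, (x \in T) && (S == T :\ x)].

Definition orthogonal_matroid {n} (Bs : {set {set ground n}}) : Prop :=
  [/\ Bs != set0, Bs \subset transversals n &
   forall B1 B2 (i : 'I_n), B1 \in Bs -> B2 \in Bs ->
     skew_pair i \subset symdiff B1 B2 ->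
     exists j : 'I_n,
       [/\ skew_pair j \subset symdiff B1 B2 :\: skew_pair i,
           symdiff B1 (skew_pair i :|: skew_pair j) \in Bs &
           symdiff B2 (skew_pair i :|: skew_pair j) \in Bs]].

Definition circuit {n} (Bs : {set {set ground n}}) (C : {set ground n}) : bool :=
  minset (fun D => subtransversal D && [forall B in Bs, ~~ (D \subset B)]) C.

(* [fundamental_circuit Bs B e C]: C = FC(B, e), for B a basis, e in B^*. *)
Definition fundamental_circuit {n} (Bs : {set {set ground n}})
    (B : {set ground n}) (e : ground n) (C : {set ground n}) : Prop :=
  [/\ B \in Bs, e \in star @: B, circuit Bs C
    & C \subset symdiff B [set e; star e]].

Definition modular_at {n k} (Bs : {set {set ground n}}) (B : {set ground n})
    (e : k.-tuple (ground n)) (C : k.-tuple {set ground n}) : Prop :=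
  uniq e /\ forall i, fundamental_circuit Bs B (tnth e i) (tnth C i).

Definition modular {n k} (Bs : {set {set ground n}})
    (C : k.-tuple {set ground n}) : Prop :=
  exists B e, B \in Bs /\ modular_at Bs B e C.

Definition first_kind {n} (C : seq {set ground n}) : bool :=
  pairwise (fun D D' => subtransversal (D :|: D')) C.

Definition second_kind {n} (C : seq {set ground n}) : bool :=
  pairwise (fun D D' => ~~ subtransversal (D :|: D')) C.

Definition domfun (F : tract) n (D : {set {set ground n}}) : Type :=
  {A : {set ground n} | A \in D} -> F.

(* The value of f at A.  The default value is never reached in the defining
   relations below, which only evaluate f on its domain. *)
Definition val_at {F : tract} {n} {D : {set {set ground n}}} (f : domfun F D)
    (A : {set ground n}) : F := oapp f tzero (insub A).

Definition fsupport {F : tract} {n} {D : {set {set ground n}}} (f : domfun F D)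
    : {set {set ground n}} := [set A in D | val_at f A != tzero].

Definition wickfun F n := domfun F (transversals n).

Definition weak_wick {F n} (psi : wickfun F n) : Prop :=
  orthogonal_matroid (fsupport psi) /\
  forall T T', T \in transversals n -> T' \in transversals n ->
    let D := symdiff T T' :&: unstarred in
    #|D| = 4 ->
    tnull [seq sgn (nlt D x) ⋅ (val_at psi (symdiff T [set x; star x])
                             ⋅ val_at psi (symdiff T' [set x; star x])) | x in D].

Definition weak_orthogonal_matroids F n : set (set (wickfun F n)) :=
  [set proj_class psi | psi in [set psi | weak_wick psi]]%classic.
Arguments weak_orthogonal_matroids : clear implicits.

Definition antisymmetric_matroid {n} (Bs : {set {set ground n}}) : Prop :=
  [/\ Bs != set0, Bs \subset transversals n :|: almost_transversals n,
   forall S S', hyper_transversal S -> hypo_transversal S' ->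
     #|[set x in S :\: S' | (S :\ x \in Bs) && (x |: S' \in Bs)]| <> 1 &
   forall T (i j : 'I_n), T \in transversals n -> i != j ->
     ((T :\: skew_pair i) :|: skew_pair j \in Bs) =
     ((T :|: skew_pair i) :\: skew_pair j \in Bs)].

Definition even_antisymmetric_matroid {n} (Bs : {set {set ground n}}) : Prop :=
  antisymmetric_matroid Bs /\
  exists s, Bs :&: transversals n \subset transversals_par n s.

Definition gpfun F n := domfun F (transversals n :|: almost_transversals n).

Definition weak_rGP {F n} (phi : gpfun F n) : Prop :=
  [/\ even_antisymmetric_matroid (fsupport phi),
   forall S S', hyper_transversal S -> hypo_transversal S' ->
     #|S :\: S'| <= 4 ->
     tnull [seq sgn (nlt (symdiff S S') x) ⋅ (val_at phi (S :\ x)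
                                           ⋅ val_at phi (x |: S')) | x in S :\: S'] &
   exists s : bool,
     (forall B, B \in transversals_par n (~~ s) -> val_at phi B = tzero) /\
     (forall B (i j : 'I_n), B \in transversals_par n s -> i != j ->
        val_at phi ((B :\: skew_pair i) :|: skew_pair j) =
        sgn (((i, false) \in B) + ((j, false) \in B))
          ⋅ val_at phi ((B :|: skew_pair i) :\: skew_pair j))].

Definition weak_rGP_classes F n : set (set (gpfun F n)) :=
  [set proj_class phi | phi in [set phi | weak_rGP phi]]%classic.
Arguments weak_rGP_classes : clear implicits.

Definition vect (F : tract) n : Type := ground n -> F.

Definition vsupport {F : tract} {n} (X : vect F n) : {set ground n} :=
  [set x | X x != tzero].

Definition signature {F : tract} {n} (Bs : {set {set ground n}})
    (C : set (vect F n)) : Prop :=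
  [/\ forall X, C X -> vsupport X != set0,
      forall c X, c != tzero -> C X -> C (scale c X) &
      forall D, circuit Bs D <-> exists2 X, C X & vsupport X = D].

Definition weak_circuit_set {F : tract} {n} (Bs : {set {set ground n}})
    (C : set (vect F n)) : Prop :=
  [/\ signature Bs C,
   forall X Y, C X -> C Y ->
     modular Bs [tuple vsupport X; vsupport Y] ->
     second_kind [:: vsupport X; vsupport Y] ->
     tnull [seq X x ⋅ Y (star x) | x : ground n],
   forall X1 X2 f, C X1 -> C X2 ->
     modular Bs [tuple vsupport X1; vsupport X2] ->
     first_kind [:: vsupport X1; vsupport X2] ->
     f \in vsupport X1 :&: vsupport X2 ->
     tnull [:: X1 f; X2 f] ->
     exists X3, [/\ C X3, X3 f = tzero & forall g, tnull [:: X1 g; X2 g; X3 g]] &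
   forall X1 X2 X3 B e1 e2 e3, C X1 -> C X2 -> C X3 ->
     modular_at Bs B [tuple e1; e2; e3] [tuple vsupport X1; vsupport X2; vsupport X3] ->
     second_kind [:: vsupport X1; vsupport X2; vsupport X3] ->
     tnull [:: X2 (star e1); X3 (star e1)] ->
     tnull [:: X3 (star e2); X1 (star e2)] ->
     tnull [:: X1 (star e3); X2 (star e3)] ->
     exists X4, [/\ C X4,
       [/\ X4 (star e1) = tzero, X4 (star e2) = tzero & X4 (star e3) = tzero] &
       forall g, tnull [:: X1 g; X2 g; X3 g; X4 g]]].

Definition weak_circuit_sets F n : set (set (vect F n)) :=
  [set C | exists2 Bs, orthogonal_matroid Bs & weak_circuit_set Bs C]%classic.
Arguments weak_circuit_sets : clear implicits.

(* In the representable case psi is the vector of Pfaffians of the principal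
   submatrices of a skew-symmetric matrix, and phi that of its principal and
   almost-principal minors, each of which is, up to sign, a product of two
   Pfaffians.  The parity s is needed because an almost-transversal arises from
   transversals B of both parities. *)
Definition rGP_of_wick {F n} (psi : wickfun F n) (phi : gpfun F n) : Prop :=
  exists s : bool,
    [/\ forall B, B \in transversals_par n (~~ s) -> val_at psi B = tzero,
        forall B, B \in transversals n ->
          val_at phi B = val_at psi B ⋅ val_at psi B &
        forall B (i j : 'I_n), B \in transversals_par n s -> i != j ->
          val_at phi ((B :\: skew_pair i) :|: skew_pair j) =
          sgn (((j, false) \in B) + nlt (B :&: starred) (i, false)
                                  + nlt (B :&: starred) (j, false))
            ⋅ (val_at psi B ⋅ val_at psi (symdiff B (skew_pair i :|: skew_pair j)))].

Definition wick_to_rGP {F n} (K : set (wickfun F n)) : set (gpfun F n) :=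
  [set phi | exists2 psi, K psi & exists2 phi0, rGP_of_wick psi phi0
                                  & proj_class phi0 phi]%classic.

(* The vectors (-1)^|T ∩ [n] < x| psi(T △ {x, x^*}) (x in T), T a transversal. *)
Definition wick_vector {F n} (psi : wickfun F n) (T : {set ground n}) : vect F n :=
  fun x => if x \in T then
    sgn (nlt (T :&: unstarred) x) ⋅ val_at psi (symdiff T [set x; star x])
  else tzero.

Definition wick_to_circuits {F n} (K : set (wickfun F n)) : set (vect F n) :=
  [set X | vsupport X != set0 /\
     exists psi T, [/\ K psi, T \in transversals n
                     & proj_class (wick_vector psi T) X]]%classic.

(* The vectors (-1)^|S < x| phi(S \ x) (x in S), S a hyper-transversal. *)
Definition rGP_vector {F n} (phi : gpfun F n) (S : {set ground n}) : vect F n :=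
  fun x => if x \in S then sgn (nlt S x) ⋅ val_at phi (S :\ x) else tzero.

Definition rGP_to_circuits {F n} (K : set (gpfun F n)) : set (vect F n) :=
  [set X | vsupport X != set0 /\
     exists phi S, [/\ K phi, hyper_transversal S
                     & proj_class (rGP_vector phi S) X]]%classic.

(* Main.v *)
Require Import Defs.
From mathcomp Require Import boolp classical_sets functions.
From mathcomp Require Import all_boot.

Set Implicit Arguments.
Unset Strict Implicit.
Unset Printing Implicit Defensive.

Local Open Scope tract_scope.

(* A transversal is the set A of its unstarred indices, and fl A i flips the
   index i.  The key step is that labels on the edges of the basis graph which
   are trivial around triangles, and around squares without a common neighbour,
   come from a potential (Lemma integrate).

   A Wick function psi gives phi by phi = psi(A) psi(A △ {i, j}).  For
   transversals T, T' of the parity on which psi vanishes, the Grassmann-Plücker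
   relation for T ∪ {p} and T' \ {q} is then psi(T △ p) psi(T' △ q) times the
   Wick relation for T and T'.  Conversely psi is the potential of the edge
   labels psi(A △ {i, j}) / psi(A) = phi(almost-transversal) / phi(A).

   For circuits, psi gives the vectors x |-> ± psi(T △ x).  Four of them, those of
   B △ b, B △ c, B △ d and B △ {b, c, d}, satisfy a linear relation whose
   coordinates are the four-term Wick relations, and the elimination axioms say
   no more than this.  Conversely psi is the potential of the ratios of the
   coordinates of the circuit vectors, well defined by orthogonality. *)

(** * Arithmetic in a tract *)

(** The null set need not be closed under addition, so relations cannot be combined or solved. A
    null sum yields an equation only when at most two of its terms are nonzero; longer sums are
    merely permuted, rescaled by units and stripped of zeros. The arguments therefore look for
    configurations in which two terms survive: relations at distance two give the triangle
    conditions, and around a square without a common neighbour the missing bases kill the other two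
    terms of a four-term relation. Units need not have square roots either. [phi] records products
    of [psi] over equal or adjacent bases, so [psi] is recovered from edge ratios, in which scalars
    cancel, and [phi] matches the function built from [psi] only up to a unit that may be no square.
    Representing hyper- and hypo-transversals by transversals of the parity where [psi] vanishes
    removes the summands outside the symmetric difference. At distance four, the bound on the number
    of summands then asks for two distinct indices [p] and [q] in that difference, and an exchange
    finds them with a nonzero factor. *)

Section TractArithmetic.
Variable F : tract.
Implicit Types (a b c d x y z : F) (s t : seq F) (p q : bool).

Lemma tmulCA : left_commutative (@tmul F).
Proof. by move=> a b c; rewrite !tmulA (tmulC a b). Qed.

Lemma tmulr1 : right_id tone (@tmul F).
Proof. by move=> a; rewrite tmulC tmul1. Qed.

Lemma tmulr0 : right_zero tzero (@tmul F).
Proof. by move=> a; rewrite tmulC tmul0. Qed.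

Lemma tinv_ex a : exists b, a != tzero -> b ⋅ a = tone.
Proof.
by have [/tmul_inv[b ab1]|_] := boolP (a != tzero); [exists b | exists a].
Qed.

Definition tinv a : F := sval (cid (tinv_ex a)).

Lemma tmulVl a : a != tzero -> tinv a ⋅ a = tone.
Proof. exact: svalP (cid (tinv_ex a)). Qed.

Lemma tmulVr a : a != tzero -> a ⋅ tinv a = tone.
Proof. by rewrite tmulC; apply: tmulVl. Qed.

Lemma tmulI c a b : c != tzero -> c ⋅ a = c ⋅ b -> a = b.
Proof.
move=> c0 /(congr1 (tmul (tinv c))).
by rewrite !tmulA tmulVl // !tmul1.
Qed.

Lemma tmul_eq0 a b : (a ⋅ b == tzero) = (a == tzero) || (b == tzero).
Proof.
apply/idP/idP => [/eqP ab0|/orP[]/eqP->]; last 2 first.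
- by rewrite tmul0.
- by rewrite tmulr0.
case: eqP => //= /eqP a0; apply/eqP/(tmulI a0).
by rewrite ab0 tmulr0.
Qed.

Lemma tmul_neq0 a b : (a ⋅ b != tzero) = (a != tzero) && (b != tzero).
Proof. by rewrite tmul_eq0 negb_or. Qed.

Lemma tinv_neq0 a : a != tzero -> tinv a != tzero.
Proof.
move=> a0; apply/eqP => e; have := tmulVl a0.
by rewrite e tmul0 => /esym/eqP; rewrite (negbTE (tone_neq0 F)).
Qed.

Lemma tdivK a b : b != tzero -> a ⋅ tinv b ⋅ b = a.
Proof. by move=> b0; rewrite -tmulA tmulVl // tmulr1. Qed.

Lemma tnull_nil : tnull (Nil F).
Proof. by apply/tnull_cons0/tnull1. Qed.

Lemma tnull_scaleE c s : c != tzero -> tnull [seq c ⋅ a | a <- s] <-> tnull s.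
Proof.
move=> c0; split=> [/(tnull_scale (tinv_neq0 c0))|]; last exact: tnull_scale.
rewrite -map_comp (eq_map (g := id)) ?map_id // => a /=.
by rewrite tmulA tmulVl // tmul1.
Qed.

Lemma tnull_perm_iff s t : perm_eq s t -> tnull s <-> tnull t.
Proof. by move=> st; split; apply: tnull_perm; rewrite // perm_sym. Qed.

Lemma tnull_nseq0 k s : tnull (nseq k tzero ++ s) <-> tnull s.
Proof. by elim: k => //= k IH; rewrite tnull_cons0. Qed.

Lemma tnull_catr0 k s : tnull (s ++ nseq k tzero) <-> tnull s.
Proof.
by apply: iff_trans (tnull_nseq0 k s); apply/tnull_perm_iff/permPl/perm_catC.
Qed.

Lemma tnull_swap a b : tnull [:: a; b] -> tnull [:: b; a].
Proof. by apply: tnull_perm; apply/permPl/(perm_catC [:: a] [:: b]). Qed.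

(** Scaling 1 + (-1) by the inverse of -1 makes this inverse a partner of 1 in a null sum, and such
    a partner is unique. *)
Lemma tnegM : tneg1 ⋅ tneg1 = tone :> F.
Proof.
suff e : tinv tneg1 = tneg1 :> F by rewrite -{1}e tmulVl // tneg1_neq0.
have n0 := tneg1_neq0 F.
apply: tneg1_unique; first exact: tinv_neq0.
have := tnull_scale (tinv_neq0 n0) (@tnull_neg1 F).
by rewrite /= tmulVl // tmulr1 => /tnull_swap.
Qed.

(** Dividing by [a] reduces to the uniqueness of -1. Two-term sums are where relations turn into
    equations. *)
Lemma tnull2 a b : tnull [:: a; b] <-> b = tneg1 ⋅ a.
Proof.
have n0 := tneg1_neq0 F.
have [->|a0] := eqVneq a tzero; first by rewrite tmulr0 tnull_cons0 tnull1.
split=> [ab|->].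
  have := tnull_scale (tinv_neq0 a0) ab; rewrite /= tmulVl //.
  have b0 : b != tzero.
    apply: contraTneq a0 => b0; rewrite b0 in ab; rewrite negbK.
    by apply/eqP/tnull1/tnull_cons0/tnull_swap.
  move/tneg1_unique; rewrite tmul_neq0 tinv_neq0 // b0 => /(_ isT) <-.
  by rewrite tmulC tmulA tmulVr // tmul1.
by have := tnull_scale a0 (tnull_neg1 F); rewrite /= tmulr1 tmulC.
Qed.

(** Only the parity of an exponent matters. With Boolean exponents a sign identity becomes an
    identity of exclusive disjunctions, decided by case analysis. *)
Definition sg p : F := if p then tneg1 else tone.

Lemma sgnE k : sgn k = sg (odd k).
Proof.
rewrite /sgn; elim: k => //= k ->.
by case: (odd k); rewrite /= ?tnegM ?tmulr1.
Qed.

Lemma sgM p q : sg p ⋅ sg q = sg (p (+) q).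
Proof. by case: p q => [] [] /=; rewrite ?tnegM ?tmul1 ?tmulr1. Qed.

Lemma sgMA p q a : sg p ⋅ (sg q ⋅ a) = sg (p (+) q) ⋅ a.
Proof. by rewrite tmulA sgM. Qed.

Lemma sg_neq0 p : sg p != tzero.
Proof. by case: p; rewrite ?tneg1_neq0 ?tone_neq0. Qed.

Lemma tneg1E : tneg1 = sg true. Proof. by []. Qed.

Lemma tnull_sg2 p q a b : p != q -> a = b -> tnull [:: sg p ⋅ a; sg q ⋅ b].
Proof. by move=> pq ->; apply/tnull2; rewrite tneg1E sgMA; case: p q pq => [] []. Qed.

Lemma tnull_sg2_inv p q a b :
  p != q -> tnull [:: sg p ⋅ a; sg q ⋅ b] -> a = b.
Proof.
move=> pq /tnull2; rewrite tneg1E sgMA (_ : true (+) p = q); last by case: p q pq => [] [].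
by move/(tmulI (sg_neq0 q)).
Qed.

Lemma tnull_zeros (I : finType) (P : {pred I}) (f : I -> F) (r : seq I) :
    uniq r -> {subset r <= P} ->
    (forall i, i \in P -> i \notin r -> f i = tzero) ->
  tnull [seq f i | i in P] <-> tnull [seq f i | i <- r].
Proof.
move=> ur rP f0.
have pe : perm_eq (enum P) ([seq i <- enum P | i \notin r] ++ r).
  apply: uniq_perm; first exact: enum_uniq.
    rewrite cat_uniq ur (filter_uniq _ (enum_uniq _)) andbT /=.
    by apply/hasPn => i ri; rewrite mem_filter ri.
  move=> i; rewrite mem_cat mem_filter mem_enum.
  by case: (boolP (i \in r)) => [/rP->|] /=; rewrite ?orbF.
rewrite /image_mem (tnull_perm_iff (perm_map f pe)) map_cat.
set u := [seq _ <- _ | _].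
have -> : [seq f i | i <- u] = nseq (size u) tzero; last exact: tnull_nseq0.
rewrite -(size_map f); apply/all_pred1P/allP => y /mapP[i].
by rewrite mem_filter mem_enum => /andP[? ?] ->; rewrite /= f0.
Qed.

Lemma tmul_cancel a b c : b = c -> a ⋅ b = a ⋅ c. Proof. by move->. Qed.
Lemma tmul_pull a b c d : c = a ⋅ d -> b ⋅ c = a ⋅ (b ⋅ d).
Proof. by move->; apply: tmulCA. Qed.

End TractArithmetic.

(* Equality of two monomials in the commutative monoid (F, ⋅). *)
Ltac tpull := first
  [reflexivity | exact: tmulC | refine (tmul_pull _ _); tpull].
Ltac tmonom :=
  rewrite -?tmulA ?tmul1 ?tmulr1;
  repeat first [reflexivity |
    refine (eq_trans (tmul_cancel _ _) (esym _)); [| tpull]].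

(** * Even delta-matroids and potentials on their basis graphs *)

Section Flips.
Variable n : nat.
Implicit Types (A B C : {set 'I_n}) (i j k l : 'I_n).

Definition fl A i : {set 'I_n} := [set k | (k \in A) (+) (k == i)].

Lemma in_fl A i k : (k \in fl A i) = (k \in A) (+) (k == i).
Proof. by rewrite inE. Qed.

Lemma flK A i : fl (fl A i) i = A.
Proof. by apply/setP => k; rewrite !in_fl addbK. Qed.

Lemma flC A i j : fl (fl A i) j = fl (fl A j) i.
Proof. by apply/setP => k; rewrite !in_fl addbAC. Qed.

Lemma flJ A i j : fl (fl (fl A i) j) i = fl A j.
Proof. by rewrite flC flK. Qed.

Definition dist A B := #|[set k | (k \in A) (+) (k \in B)]|.

Lemma dist_fl A B i : (i \in A) (+) (i \in B) -> dist A B = (dist (fl A i) B).+1.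
Proof.
move=> iAB; rewrite /dist (cardsD1 i) inE iAB add1n; congr _.+1.
apply: eq_card => k; rewrite !inE; case: eqP => [->|_] /=; last by rewrite addbF.
by rewrite addbT addNb iAB.
Qed.

Lemma dist_gt0 A B : A != B -> exists i, (i \in A) (+) (i \in B).
Proof.
move=> AB; apply/existsP; apply: contraNT AB; rewrite negb_exists => /forallP h.
by apply/eqP/setP => i; move: (h i); case: (i \in A); case: (i \in B).
Qed.

End Flips.

Ltac flips := apply/setP => ?; rewrite !in_fl; 
  repeat match goal with |- context[?k == ?i] => case: (k == i) end; by case: (_ \in _).

Ltac uniqs := rewrite /= ?inE ?negb_or ?andbT;
  repeat (apply/andP; split); first [assumption | rewrite eq_sym; assumption | done].

Section EvenDelta.
Variable n : nat.
Implicit Types (A B C : {set 'I_n}) (i j k l : 'I_n) (bs : pred {set 'I_n}).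

(** The exchange axiom for transversals, read on their unstarred indices. As the partner [j] differs
    from [i], exchanges flip two indices, which keeps all bases in one parity class. *)
Definition even_delta bs : Prop :=
  (exists A, bs A) /\
  forall A B i, bs A -> bs B -> (i \in A) (+) (i \in B) ->
    exists j, [/\ j != i, (j \in A) (+) (j \in B),
                  bs (fl (fl A i) j) & bs (fl (fl B i) j)].

(** Exchanging against [B0] gives a neighbour of [A] whose distance to [B0] is smaller by two, so
    the basis graph is connected by paths descending to any base point. *)
Lemma even_delta_ind bs B0 (P : {set 'I_n} -> Prop) :
    even_delta bs -> bs B0 -> P B0 ->
    (forall A i j, i != j -> bs A -> bs (fl (fl A i) j) ->
       (i \in A) (+) (i \in B0) -> (j \in A) (+) (j \in B0) ->
       P (fl (fl A i) j) -> P A) ->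
  forall A, bs A -> P A.
Proof.
move=> [_ ex] bB0 P0 PS A; have [m] := ubnP (dist A B0).
elim: m A => // m IH A dm bA; have [->//|/dist_gt0[i iA]] := eqVneq A B0.
have [j [ji jA bAij _]] := ex _ _ _ bA bB0 iA.
apply: (PS A i j); rewrite 1?eq_sym //; apply: IH => //.
rewrite (dist_fl iA) (@dist_fl _ (fl A i) B0 j) in dm; first exact: ltnW.
by rewrite in_fl (negbTE ji) addbF.
Qed.

Variables (bs : pred {set 'I_n}) (ed : even_delta bs).

(* The homotopy theorem for basis graphs of even Delta-matroids: edge labels
   that multiply to 1 around triangles and around squares without a common
   neighbour integrate to a potential.  The potential is built level by level
   from a base point.  Two lower neighbours of a basis are joined, by the
   exchange axiom, through triangles or one square, and an edge inside a level
   has a common lower neighbour. *)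
Section Potential.
Variables (F : tract) (g : {set 'I_n} -> 'I_n -> 'I_n -> F).
Hypothesis g_neq0 : forall A i j, i != j -> bs A -> bs (fl (fl A i) j) -> g A i j != tzero.
Hypothesis gC : forall A i j, i != j -> bs A -> bs (fl (fl A i) j) -> g A i j = g A j i.
Hypothesis gV : forall A i j, i != j -> bs A -> bs (fl (fl A i) j) ->
  g A i j ⋅ g (fl (fl A i) j) i j = tone.
Hypothesis g_triangle : forall A i j k, uniq [:: i; j; k] ->
  bs A -> bs (fl (fl A i) j) -> bs (fl (fl A i) k) ->
  g A i j ⋅ g (fl (fl A i) j) j k = g A i k.
Hypothesis g_square : forall A i j k l, uniq [:: i; j; k; l] ->
  bs A -> bs (fl (fl A i) j) -> bs (fl (fl A k) l) ->
  bs (fl (fl (fl (fl A i) j) k) l) ->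
  ~~ bs (fl (fl A i) k) -> ~~ bs (fl (fl A i) l) ->
  ~~ bs (fl (fl A j) k) -> ~~ bs (fl (fl A j) l) ->
  g A i j ⋅ g (fl (fl A i) j) k l = g A k l ⋅ g (fl (fl A k) l) i j.

Variables (B0 : {set 'I_n}) (bB0 : bs B0).

Let diff A i := (i \in A) (+) (i \in B0).

(** The edges that go down one level towards [B0]: both flips repair a disagreement with [B0]. *)
Let low A i j := [&& i != j, diff A i, diff A j & bs (fl (fl A i) j)].

Let lowC A i j : low A i j = low A j i.
Proof. by rewrite /low eq_sym flC; congr andb; rewrite andbCA. Qed.

Let diff_fl A i j : diff (fl A i) j = diff A j (+) (j == i).
Proof. by rewrite /diff in_fl addbAC. Qed.

Let low_dist A i j : low A i j -> dist A B0 = (dist (fl (fl A i) j) B0).+2.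
Proof.
case/and4P => ij di dj _; rewrite (dist_fl di) (@dist_fl _ (fl A i) _ j) //.
by rewrite -/(diff _ _) diff_fl dj eq_sym (negbTE ij).
Qed.

(** The fuel is the level, half the distance to [B0]. Started from a basis at its own level, the
    pick succeeds until [B0] is reached. The defaults are one, so that nonvanishing follows by
    induction on the fuel alone. *)
Fixpoint potential_rec m A : F :=
  if m is m'.+1 then
    if [pick t : 'I_n * 'I_n | low A t.1 t.2] is Some t
    then potential_rec m' (fl (fl A t.1) t.2) ⋅ g (fl (fl A t.1) t.2) t.1 t.2
    else tone
  else tone.

Definition potential A : F :=
  if bs A then potential_rec (dist A B0)./2 A else tzero.

Let psi := potential.

Let low_ex A : bs A -> A != B0 -> exists i j, low A i j.
Proof.
move=> bA /dist_gt0[i iA]; have [j [ji jA bAij _]] := ed.2 _ _ _ bA bB0 iA.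
by exists i, j; apply/and4P; rewrite eq_sym.
Qed.

Let psi_step A : bs A -> A != B0 ->
  exists i j, low A i j /\ psi A = psi (fl (fl A i) j) ⋅ g (fl (fl A i) j) i j.
Proof.
move=> bA AB0; have [i0 [j0 low0]] := low_ex bA AB0.
rewrite /psi /potential bA (low_dist low0) /=.
case: pickP => [[i j] /= lowij|]; last by move=> /(_ (i0, j0)) /=; rewrite low0.
exists i, j; split => //; have /and4P[_ _ _ ->] := lowij.
have := low_dist lowij; rewrite (low_dist low0) => -[->] //.
Qed.

Let gVr A i j : i != j -> bs A -> bs (fl (fl A i) j) ->
  g (fl (fl A i) j) i j ⋅ g A i j = tone.
Proof. by move=> *; rewrite tmulC gV. Qed.

Lemma potential_neq0 A : (psi A != tzero) = bs A.
Proof.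
rewrite /psi /potential; have [bA|_] := boolP (bs A); last by rewrite eqxx.
move: (_./2) => m; elim: m A bA => /= [|m IH] A bA; first exact: tone_neq0.
case: pickP => [[i j] /= /and4P[ij _ _ bij]|_]; last exact: tone_neq0.
by rewrite tmul_neq0 IH //= g_neq0 // flJ flK.
Qed.

Let edges m := forall A i j, i != j -> bs A -> bs (fl (fl A i) j) ->
  dist A B0 <= m -> dist (fl (fl A i) j) B0 <= m ->
  psi (fl (fl A i) j) = psi A ⋅ g A i j.

(** The value at [A] transported from its lower neighbour along [i] and [j]. The potential is
    consistent once this does not depend on the chosen edge. *)
Let Q A i j := psi (fl (fl A i) j) ⋅ g (fl (fl A i) j) i j.

Let QC A i j : bs A -> low A i j -> Q A i j = Q A j i.
Proof.
by move=> bA /and4P[ij _ _ bij]; rewrite /Q gC 1?(flC A i j) // -?(flC A i j) // flJ flK.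
Qed.

(** The two lower neighbours differ by the flips of [j] and [k], an edge inside the smaller ball,
    and close a triangle with [A]. *)
Let Q_share m A i j k : edges m -> bs A -> dist A B0 <= m.+1 ->
  low A i j -> low A i k -> Q A i j = Q A i k.
Proof.
move=> em bA dA lij lik; have [->//|jk] := eqVneq j k.
have [/and4P[ij _ _ bij] /and4P[ik _ _ bik]] := (lij, lik).
have e : fl (fl (fl (fl A i) j) j) k = fl (fl A i) k by rewrite flK.
have e' : fl (fl (fl (fl A i) j) j) i = A by rewrite flK flK.
rewrite /Q -e (em (fl (fl A i) j)) // ?e //; last 2 first.
- by apply: leq_trans (leqnSn _) _; rewrite (low_dist lij) in dA.
- by apply: leq_trans (leqnSn _) _; rewrite (low_dist lik) in dA.
rewrite -tmulA; congr (_ ⋅ _).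
have := @g_triangle (fl (fl A i) j) j k i; rewrite e e' => t.
rewrite (gC ik) ?flJ ?flK // (gC ij) ?flJ ?flK // t //.
by uniqs.
Qed.

(** If flipping one of [i], [j] and one of [k], [l] gives a basis, steps through shared indices
    suffice. Otherwise the two lower neighbours have a common neighbour [X] below them, and a square
    closes. *)
Let Q_const m A i j k l : edges m -> bs A -> dist A B0 <= m.+1 ->
  low A i j -> low A k l -> Q A i j = Q A k l.
Proof.
move=> em bA dA lij lkl.
have share := Q_share em bA dA.
have [ik|ik] := eqVneq i k; first by subst k; apply: share.
have [il|il] := eqVneq i l; first by subst l; rewrite (QC bA lkl); apply: share;
  rewrite // lowC.
have [jk|jk] := eqVneq j k.
  by subst k; rewrite (QC bA lij); apply: share; rewrite // lowC.
have [jl|jl] := eqVneq j l.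
  by subst l; rewrite (QC bA lij) (QC bA lkl); apply: share; rewrite // lowC.
have [/and4P[ij di dj bij] /and4P[kl dk dl bkl]] := (lij, lkl).
have via a b c d : low A a b -> low A c d -> a != c -> bs (fl (fl A a) c) -> Q A a b = Q
  A c d.
  move=> lab lcd ac bac; have lac : low A a c.
    by have [/and4P[_ ? _ _] /and4P[_ ? _ _]] := (lab, lcd); apply/and4P.
  by rewrite (share a b c) // QC //; apply: share; rewrite // lowC.
have [bik|nik] := boolP (bs (fl (fl A i) k)); first exact: via.
have [bil|nil] := boolP (bs (fl (fl A i) l)).
  by rewrite (QC bA lkl); apply: via; rewrite // lowC.
have [bjk|njk] := boolP (bs (fl (fl A j) k)).
  by rewrite (QC bA lij); apply: via; rewrite // lowC.
have [bjl|njl] := boolP (bs (fl (fl A j) l)).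
  by rewrite (QC bA lij) (QC bA lkl); apply: via; rewrite // lowC.
pose X := fl (fl (fl (fl A i) j) k) l.
have Xij : fl (fl X i) j = fl (fl A k) l by rewrite /X; flips.
have Xkl : fl (fl X k) l = fl (fl A i) j by rewrite /X; flips.
(* Exchange [i] between the two lower neighbours: a partner [k] or [l] would make one of the
   excluded mixed pairs a basis, so the partner is [j]. *)
have bX : bs X.
  have [] := ed.2 _ _ i bij bkl.
    by rewrite !in_fl eqxx (negbTE ij) (negbTE ik) (negbTE il); case: (i \in A).
  move=> x [xi]; rewrite !in_fl (negbTE xi).
  have [->|xj] := eqVneq x j.
    by move=> _ _; rewrite (_ : fl _ _ = X) // /X; flips.
  have [->|xk] := eqVneq x k.
    by move=> _; rewrite (_ : fl _ _ = fl (fl A j) k) ?(negbTE njk) //; flips.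
  have [->|xl] := eqVneq x l.
    by move=> _; rewrite (_ : fl _ _ = fl (fl A j) l) ?(negbTE njl) //; flips.
  by case: (x \in A).
have dX : dist X B0 <= m /\ dist (fl (fl A i) j) B0 <= m.
  have lX : low (fl (fl A i) j) k l.
    by rewrite /low kl bX !diff_fl dk dl !(eq_sym _ i) !(eq_sym _ j) (negbTE ik) (negbTE il)
         (negbTE jk) (negbTE jl).
  have := low_dist lX; rewrite (low_dist lij) in dA; rewrite -/X => e; split.
    by move: dA; rewrite e => /ltnW/ltnW/ltnW.
  by move: dA => /ltnW.
have dkl : dist (fl (fl A k) l) B0 <= m.
  by move: dA; rewrite (low_dist lkl) => /ltnW.
rewrite /Q -Xij -Xkl (em X) ?Xkl ?bkl // ?dX.1 ?dX.2 // (em X i j) ?Xij ?bij ?dX.1 //.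
rewrite -!tmulA -!Xij -!Xkl; congr (_ ⋅ _).
apply: g_square; rewrite ?Xij ?Xkl //.
- by uniqs.
- by rewrite (_ : fl _ _ = A) // /X; flips.
- by rewrite (_ : fl _ _ = fl (fl A j) l) // /X; flips.
- by rewrite (_ : fl _ _ = fl (fl A i) l) // /X; flips.
- by rewrite (_ : fl _ _ = fl (fl A j) k) // /X; flips.
- by rewrite (_ : fl _ _ = fl (fl A i) k) // /X; flips.
Qed.

Let edges_all m : edges m.
Proof.
elim: m => [|m em].
  move=> A i j ij _ _; rewrite !leqn0 !cards_eq0 => /eqP/setP hA /eqP/setP hB.
  have := hA i; have := hB i; rewrite !inE ?in_fl ?eqxx ?(negbTE ij).
  by case: (i \in A); case: (i \in B0).
have lowE A i j : bs A -> dist A B0 <= m.+1 -> low A i j -> psi A = Q A i j.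
  move=> bA dA lij; have AB0 : A != B0.
    apply: contraTneq lij => ->; rewrite /low /diff.
    by case: (i \in B0); rewrite /= ?andbF.
  by have [k [l [lkl ->]]] := psi_step bA AB0; apply: (Q_const em).
move=> A i j ij bA bij dA dij.
(* Up to swapping the indices, either [i] disagrees with [B0] and the edge goes down or stays in its
   level, or neither index does and it goes up. *)
wlog di : i j ij bij dij / diff A i \/ ~~ diff A i /\ ~~ diff A j.
  move=> wl; have [di|di] := boolP (diff A i); first by apply: wl => //; left.
  have [dj|dj] := boolP (diff A j); last by apply: wl => //; right.
  rewrite gC // flC wl // 1?eq_sym ?(flC _ j i) //; by left.
set B := fl (fl A i) j in bij dij *.
have BK : fl (fl B i) j = A by rewrite /B; flips.
case: di => [di|[di dj]]; last first.
  rewrite (lowE B i j) // /Q ?BK //.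
  by rewrite /low ij BK bA !diff_fl !eqxx (eq_sym j) (negbTE ij) !(negbTE di) (negbTE dj).
have [dj|dj] := boolP (diff A j).
  rewrite (lowE A i j) //; last by apply/and4P.
  by rewrite /Q -/B -tmulA gVr // tmulr1.
(* Only [i] disagrees with [B0], so [A] and [B] are on one level. The partner [x] of [i] in an
   exchange with [B0] leads from both of them to [C]. *)
have [x [xi dx bx _]] := ed.2 _ _ _ bA bB0 di.
have jx : j != x by apply: contraNneq dj => ->.
set C := fl (fl A i) x in bx *.
have CB : fl (fl B j) x = C by rewrite /C /B; flips.
have CA : fl (fl C x) i = A by rewrite /C; flips.
have CB' : fl (fl C x) j = B by rewrite /C /B; flips.
rewrite (lowE A i x) //; last by apply/and4P; rewrite eq_sym.
rewrite (lowE B j x) //; last first.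
  rewrite /low jx CB bx !diff_fl !eqxx (eq_sym j i) (eq_sym x j) (negbTE ij) (negbTE xi)
    (negbTE jx) .
  by rewrite (negbTE dj) [diff A x]dx.
rewrite /Q CB -/C -tmulA; congr (_ ⋅ _).
have e1 : g C j x = g C x j by apply: gC; rewrite // flC CB'.
have e2 : g C i x = g C x i by apply: gC; rewrite 1?eq_sym // flC CA.
have := @g_triangle C x i j; rewrite CA CB' e1 e2 => -> //; uniqs.
Qed.

Lemma potential_edge A i j : i != j -> bs A -> bs (fl (fl A i) j) ->
  psi (fl (fl A i) j) = psi A ⋅ g A i j.
Proof.
move=> ij bA bij; apply: (@edges_all (maxn (dist A B0) (dist (fl (fl A i) j) B0))) => //.
  exact: leq_maxl.
exact: leq_maxr.
Qed.

End Potential.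

Lemma integrate (F : tract) (g : {set 'I_n} -> 'I_n -> 'I_n -> F) :
    (forall A i j, i != j -> bs A -> bs (fl (fl A i) j) -> g A i j != tzero) ->
    (forall A i j, i != j -> bs A -> bs (fl (fl A i) j) -> g A i j = g A j i) ->
    (forall A i j, i != j -> bs A -> bs (fl (fl A i) j) ->
       g A i j ⋅ g (fl (fl A i) j) i j = tone) ->
    (forall A i j k, uniq [:: i; j; k] ->
       bs A -> bs (fl (fl A i) j) -> bs (fl (fl A i) k) ->
       g A i j ⋅ g (fl (fl A i) j) j k = g A i k) ->
    (forall A i j k l, uniq [:: i; j; k; l] ->
       bs A -> bs (fl (fl A i) j) -> bs (fl (fl A k) l) ->
       bs (fl (fl (fl (fl A i) j) k) l) ->
       ~~ bs (fl (fl A i) k) -> ~~ bs (fl (fl A i) l) ->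
       ~~ bs (fl (fl A j) k) -> ~~ bs (fl (fl A j) l) ->
       g A i j ⋅ g (fl (fl A i) j) k l = g A k l ⋅ g (fl (fl A k) l) i j) ->
  exists psi : {set 'I_n} -> F,
    (forall A, (psi A != tzero) = bs A) /\
    (forall A i j, i != j -> bs A -> bs (fl (fl A i) j) ->
       psi (fl (fl A i) j) = psi A ⋅ g A i j).
Proof.
move=> g0 gC gV gT gS; have [B0 bB0] := ed.1.
exists (potential g B0); split=> [A|]; first exact: potential_neq0.
exact: potential_edge.
Qed.

End EvenDelta.

(** * Transversals and Wick relations *)

Section XorSums.
Variable n : nat.
Implicit Types (f g : 'I_n -> bool) (A B : {set 'I_n}) (i j k : 'I_n).

Definition xsum f := \big[addb/false]_k f k.

Lemma eq_xsum f g : f =1 g -> xsum f = xsum g.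
Proof. by move=> fg; apply: eq_bigr. Qed.

Lemma xsumD f g : xsum f (+) xsum g = xsum (fun k => f k (+) g k).
Proof. by rewrite /xsum big_split. Qed.

Lemma xsum1 i f : xsum (fun k => (k == i) && f k) = f i.
Proof.
by rewrite /xsum (bigD1 i) //= eqxx big1 ?addbF // => k /negbTE ->.
Qed.

Lemma odd_sum (I : finType) (h : I -> nat) :
  odd (\sum_i h i) = \big[addb/false]_i odd (h i).
Proof. exact: (big_morph odd oddD). Qed.

Lemma odd_card_ground (X : {set ground n}) :
  odd #|X| = xsum (fun k => ((k, false) \in X) (+) ((k, true) \in X)).
Proof.
rewrite -sum1_card big_mkcond odd_sum /xsum.
rewrite (eq_bigr (fun x : ground n => (x.1, x.2) \in X)); last first.
  by case=> a b _ /=; case: ifP.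
rewrite -(pair_bigA _ (fun (k : 'I_n) b => (k, b) \in X)) /=.
by apply: eq_bigr => k _; rewrite big_bool addbC.
Qed.

(** The parity of the number of elements of [A] below [i], the building block of all signs. *)
Definition sigma A i := xsum (fun k => (k \in A) && (k < i)).

Lemma sigma_fl A j i : sigma (fl A j) i = sigma A i (+) (j < i).
Proof.
rewrite /sigma -(xsum1 j (fun k => k < i)) xsumD; apply: eq_xsum => k.
by rewrite in_fl; case: (k \in A); case: (k == j); case: (k < i).
Qed.

Lemma ltn_addb i j : i != j -> (j < i) = ~~ (i < j).
Proof. by rewrite -(inj_eq val_inj) -leqNgt ltn_neqAle eq_sym => ->. Qed.

End XorSums.

Section Transversals.
Variable n : nat.
Implicit Types (A B : {set 'I_n}) (i j k : 'I_n) (x y : ground n) (T : {set ground n}).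

(* The transversal whose unstarred part is A. *)
Definition tr A : {set ground n} := [set x | x.2 (+) (x.1 \in A)].

Definition el A i : ground n := (i, i \notin A).

Lemma in_tr A x : (x \in tr A) = x.2 (+) (x.1 \in A).
Proof. by rewrite inE. Qed.

Lemma el_tr A i : el A i \in tr A.
Proof. by rewrite in_tr /= addNb addbb. Qed.

Lemma trE A x : x \in tr A -> x = el A x.1.
Proof. by case: x => i b; rewrite in_tr /el /=; case: b; case: (i \in A). Qed.

Lemma in_trE A x : (x \in tr A) = (x == el A x.1).
Proof.
apply/idP/eqP => [|->]; first exact: trE.
exact: el_tr.
Qed.

Lemma star_tr A x : (star x \in tr A) = (x \notin tr A).
Proof. by rewrite !in_tr /= addNb. Qed.

Lemma star_el A i : star (el A i) = el (fl A i) i.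
Proof. by rewrite /star /el in_fl /= eqxx addbT. Qed.

Lemma starK x : star (star x) = x.
Proof. by case: x => i b; rewrite /star /= negbK. Qed.

Lemma el_fl A i j : i != j -> el (fl A i) j = el A j.
Proof. by move=> ij; rewrite /el in_fl eq_sym (negbTE ij) addbF. Qed.

Lemma tr_inj : injective tr.
Proof.
by move=> A B /setP AB; apply/setP => i; have := AB (i, false); rewrite !in_tr.
Qed.

Lemma in_skew i x : (x \in skew_pair i) = (x.1 == i).
Proof. by case: x => k b; rewrite !inE !xpair_eqE /=; case: b;
  rewrite ?andbT ?andbF ?orbF. Qed.

Lemma tr_transversal A : tr A \in transversals n.
Proof.
rewrite inE; apply/forallP => i.
rewrite (_ : _ :&: _ = [set el A i]) ?cards1 //.
apply/setP => x; rewrite in_setI in_set1 in_skew in_trE.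
by apply/andP/eqP => [[/eqP xe /eqP <-]|->]; rewrite ?eqxx.
Qed.

Lemma transversal_tr T : T \in transversals n -> exists A, T = tr A.
Proof.
rewrite inE => /forallP hT; exists [set i | (i, false) \in T].
apply/setP => -[i b]; rewrite in_tr /= inE; have /cards1P[x] := hT i.
move=> /setP e; have := e (i, true); have := e (i, false); have := e x.
rewrite !in_setI !in_set1 !in_skew /= !eqxx !andbT; case: x {e} => k c /= /andP[_ /eqP ->].
by rewrite !xpair_eqE eqxx /=; case: b; case: c => e1 e2; rewrite ?e1 ?e2.
Qed.

Lemma in_symdiff (X : finType) (S S' : {set X}) u :
  (u \in symdiff S S') = (u \in S) (+) (u \in S').
Proof. by rewrite !inE; case: (u \in S); case: (u \in S'). Qed.

Lemma symdiff_tr A x : symdiff (tr A) [set x; star x] = tr (fl A x.1).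
Proof.
apply/setP => y; rewrite in_symdiff !in_tr in_fl !inE addbA; congr (_ (+) _).
case: x y => i b [k c]; rewrite !xpair_eqE /= -andb_orr.
by case: (k == i) => //=; case: b; case: c.
Qed.

Lemma symdiff_tr2 A i j : i != j ->
  symdiff (tr A) (skew_pair i :|: skew_pair j) = tr (fl (fl A i) j).
Proof.
move=> ij; apply/setP => y; rewrite in_symdiff in_setU !in_skew !in_tr !in_fl !addbA.
rewrite -!addbA; do 2!congr (_ (+) _).
by case: (y.1 =P i) => // ->; rewrite (negbTE ij).
Qed.

Lemma skew_sub_symdiff A B i :
  (skew_pair i \subset symdiff (tr A) (tr B)) = (i \in A) (+) (i \in B).
Proof.
apply/subsetP/idP => [/(_ (i, false))|h x].
  by rewrite in_symdiff in_skew !in_tr /= eqxx => ->.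
by rewrite in_symdiff in_skew !in_tr => /eqP ->; rewrite addbACA addbb.
Qed.

Definition par A := xsum (fun k => k \notin A).

Lemma par_fl A i : par (fl A i) = ~~ par A.
Proof.
rewrite /par -addTb -(xsum1 i xpredT) xsumD; apply: eq_xsum => k.
by rewrite in_fl andbT; case: (k == i); case: (k \in A).
Qed.

Lemma tr_par A s : (tr A \in transversals_par n s) = (par A == s).
Proof.
rewrite inE tr_transversal odd_card_ground; congr (_ == s); apply: eq_xsum => k.
by rewrite !inE /=; rewrite ?andbF ?andbT.
Qed.

Lemma transversal_parP s T : T \in transversals_par n s -> exists2 A, T = tr A & par A = s.
Proof.
move=> hT; have := hT; rewrite inE => /andP[/transversal_tr[A e] _].
by exists A => //; apply/eqP; rewrite -tr_par -e.
Qed.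

Definition dset A B : {set 'I_n} := [set i | (i \in A) (+) (i \in B)].

Lemma orthogonal_matroidP (Bs : {set {set ground n}}) :
  orthogonal_matroid Bs <->
  Bs \subset transversals n /\ even_delta (fun A => tr A \in Bs).
Proof.
split=> [[/set0Pn[B0 bB0] sB ex]|[sB [[A bA] ex]]].
  split=> //; split.
    by have [A e] := transversal_tr (subsetP sB _ bB0); exists A; rewrite -e.
  move=> A B i bA bB iAB; have := ex _ _ i bA bB; rewrite skew_sub_symdiff.
  move=> /(_ iAB)[j [/subsetP sj]].
  have ji : j != i.
    by have := sj (j, false); rewrite in_setD !in_skew eqxx => /(_ isT)/andP[].
  rewrite !symdiff_tr2 1?eq_sym // => h1 h2; exists j; split=> //.
  by rewrite -skew_sub_symdiff; apply/subsetP => x /sj; rewrite in_setD => /andP[].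
split=> //; first by apply/set0Pn; exists (tr A).
move=> B1 B2 i b1 b2.
have [C1 e1] := transversal_tr (subsetP sB _ b1);
  have [C2 e2] := transversal_tr (subsetP sB _ b2).
rewrite e1 e2 in b1 b2 *; rewrite skew_sub_symdiff => /(ex _ _ _ b1 b2)[j [ji jC h1 h2]].
exists j; rewrite !symdiff_tr2 1?eq_sym //; split=> //.
rewrite -skew_sub_symdiff in jC; apply/subsetP => x xj;
  rewrite in_setD (subsetP jC) // andbT.
by move: xj; rewrite !in_skew => /eqP ->.
Qed.

Section TractSums.
Variable F : tract.

Lemma tnull_image (I J : finType) (P : {pred J}) (f : J -> F) (h : I -> J) (D : {set I}) :
    {in D &, injective h} -> (forall u, u \in D -> h u \in P) ->
    (forall v, v \in P -> (forall u, u \in D -> v != h u) -> f v = tzero) ->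
  tnull [seq f v | v in P] <-> tnull [seq f (h u) | u in D].
Proof.
move=> hI hP f0; rewrite {2}/image_mem (map_comp f h); apply: tnull_zeros.
- by rewrite map_inj_in_uniq ?enum_uniq // => u v; rewrite !mem_enum; apply: hI.
- by move=> v /mapP[u]; rewrite mem_enum => uD ->; apply: hP.
- move=> v vP vn; apply: f0 => // u uD; apply: contraNneq vn => ->.
  by apply: map_f; rewrite mem_enum.
Qed.

(** The sign has to count the elements of the symmetric difference below [i]; modulo 2 this is the
    sum of the counts in [A] and in [B]. *)
Definition wick_term (w : {set 'I_n} -> F) A B i :=
  sg F (sigma A i (+) sigma B i) ⋅ (w (fl A i) ⋅ w (fl B i)).

Definition wick_rel (w : {set 'I_n} -> F) A B :=
  tnull [seq wick_term w A B i | i in dset A B].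

Definition wk (psi : wickfun F n) A : F := val_at psi (tr A).

Lemma val_atE (D : {set {set ground n}}) (f : domfun F D) (S : {set ground n}) (h : S \in
  D) :
  val_at f S = f (exist _ S h).
Proof.
rewrite /val_at; case: insubP => [u hu e|]; last by rewrite h.
rewrite /=; congr f; exact: val_inj.
Qed.

Lemma domfun_eq (D : {set {set ground n}}) (f g : domfun F D) :
  (forall S, S \in D -> val_at f S = val_at g S) -> f = g.
Proof.
by move=> e; apply: funext => -[S h]; rewrite -!val_atE e.
Qed.

Lemma val_at_scale (D : {set {set ground n}}) (f : domfun F D) c S :
  val_at (scale c f : domfun F D) S = c ⋅ val_at f S.
Proof. by rewrite /val_at; case: insub => //=; rewrite tmulr0. Qed.

Lemma in_fsupport_tr (psi : wickfun F n) A : (tr A \in fsupport psi) = (wk psi A != tzero).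
Proof. by rewrite inE tr_transversal. Qed.

Lemma sigma_dset A B i : sigma (dset A B) i = sigma A i (+) sigma B i.
Proof.
rewrite /sigma xsumD; apply: eq_xsum => k; rewrite inE.
by case: (k \in A); case: (k \in B); case: (k < i).
Qed.

Lemma nlt_unstarred A i :
  odd (nlt [set x in unstarred | x.1 \in A] (i, false)) = sigma A i.
Proof.
rewrite odd_card_ground; apply: eq_xsum => k; rewrite !inE /ground_lt /=.
by rewrite ltnn !andbF orbF addbF.
Qed.

Lemma weak_wickP (psi : wickfun F n) :
  weak_wick psi <-> even_delta (fun A => wk psi A != tzero) /\
    forall A B, dist A B = 4 -> wick_rel (wk psi) A B.
Proof.
rewrite /weak_wick orthogonal_matroidP.
have -> : (fun A => tr A \in fsupport psi) = (fun A => wk psi A != tzero).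
  by apply: funext => A; rewrite in_fsupport_tr.
have sub : fsupport psi \subset transversals n.
  by apply/subsetP => S; rewrite inE => /andP[].
have DE A B : symdiff (tr A) (tr B) :&: unstarred = [set x in unstarred | x.1 \in dset A B].
  by apply/setP => x; rewrite in_setI in_symdiff !in_tr andbC !inE; case: x.2.
have DEi A B : symdiff (tr A) (tr B) :&: unstarred = [set (i, false) | i in dset A B].
  rewrite DE; apply/setP => -[k b]; rewrite !inE /=;
    apply/andP/imsetP => [[nb h]|[i h [-> ->]]].
    by exists k; rewrite ?inE //; case: b nb.
  by rewrite !inE in h *.
have card A B : #|symdiff (tr A) (tr B) :&: unstarred| = dist A B.
  by rewrite DEi card_imset // => i j [].
have relE A B : tnull [seq sgn (nlt (symdiff (tr A) (tr B) :&: unstarred) x)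
     ⋅ (val_at psi (symdiff (tr A) [set x; star x]) ⋅ val_at psi (symdiff (tr B) [set x;
       star x]))
     | x in symdiff (tr A) (tr B) :&: unstarred] <-> wick_rel (wk psi) A B.
  rewrite (@tnull_image _ _ _ _ (fun i => (i, false)) (dset A B)).
  - rewrite /wick_rel (@eq_image _ _ _ (mem (dset A B)) _ (wick_term (wk psi) A B)) // => i.
    by rewrite sgnE DE nlt_unstarred sigma_dset !symdiff_tr.
  - by move=> i j _ _ [].
  - by move=> i iD; rewrite DEi; apply/imsetP; exists i.
  - by move=> x; rewrite DEi => /imsetP[i iD ->] /(_ _ iD); rewrite eqxx.
split=> [[[_ ed] h]|[ed h]]; split=> //.
  by move=> A B dAB; apply/relE/h; rewrite ?tr_transversal ?card.
move=> T T' /transversal_tr[A ->] /transversal_tr[B ->] /=; rewrite card => dAB.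
by apply/relE/h.
Qed.

End TractSums.
End Transversals.

(** * Grassmann-Plücker functions *)

Section AlmostTransversals.
Variable n : nat.
Implicit Types (A B : {set 'I_n}) (i j k p q : 'I_n) (x y : ground n) (S : {set ground n}).

Definition aset A i j : {set ground n} := (tr A :\: skew_pair i) :|: skew_pair j.
Definition hyper A p : {set ground n} := tr A :|: skew_pair p.
Definition hypo A q : {set ground n} := tr A :\: skew_pair q.

Lemma in_aset A i j x : (x \in aset A i j) = (x \in tr A) && (x.1 != i) || (x.1 == j).
Proof. by rewrite in_setU in_setD !in_skew andbC. Qed.

Lemma in_hyper A p x : (x \in hyper A p) = (x \in tr A) || (x.1 == p).
Proof. by rewrite in_setU in_skew. Qed.

Lemma in_hypo A q x : (x \in hypo A q) = (x \in tr A) && (x.1 != q).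
Proof. by rewrite in_setD in_skew andbC. Qed.

Lemma in_tr_fl A i x : (x \in tr (fl A i)) = (x \in tr A) (+) (x.1 == i).
Proof. by rewrite !in_tr in_fl addbA. Qed.

Lemma hyper_fl A p : hyper (fl A p) p = hyper A p.
Proof.
by apply/setP => x; rewrite !in_hyper in_tr_fl; case: (x.1 == p); rewrite ?orbT ?addbF.
Qed.

Lemma hypo_fl A q : hypo (fl A q) q = hypo A q.
Proof.
by apply/setP => x; rewrite !in_hypo in_tr_fl; case: (x.1 == q); rewrite ?andbF ?addbF.
Qed.

Lemma aset_fli A i j : aset (fl A i) i j = aset A i j.
Proof.
by apply/setP => x; rewrite !in_aset in_tr_fl; case: (x.1 == i); rewrite ?andbF ?addbF.
Qed.

Lemma aset_flj A i j : aset (fl A j) i j = aset A i j.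
Proof.
by apply/setP => x; rewrite !in_aset in_tr_fl; case: (x.1 == j); rewrite ?orbT ?addbF.
Qed.

Lemma asetC A i j : i != j -> (tr A :|: skew_pair i) :\: skew_pair j = aset A j i.
Proof.
move=> ij; apply/setP => x; rewrite in_aset in_setD in_setU !in_skew.
by case: (x.1 =P i) => [->|_]; rewrite ?ij ?orbT ?orbF // andbC.
Qed.

Lemma par_case s A p : exists2 B, par B = s & B = A \/ B = fl A p.
Proof.
have [e|e] := eqVneq (par A) s; first by exists A => //; left.
by exists (fl A p); [rewrite par_fl; case: (par A) s e => [] [] | right].
Qed.

Lemma eq_el A i x : x \in tr A -> (x == el A i) = (x.1 == i).
Proof.
by move=> xA; rewrite {1}(trE xA) /el xpair_eqE; have [->|] := eqVneq x.1; rewrite ?eqxx.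
Qed.

(** A hyper-transversal contains two transversals, which differ by the flip of [p] and so have
    opposite parities. The free choice of [s] later allows a representative where [gp] vanishes. *)
Lemma hyperP s S : hyper_transversal S -> exists A p, par A = s /\ S = hyper A p.
Proof.
case/existsP => T /andP[/transversal_tr[A0 ->] /existsP[x /andP[xA0 /eqP ->]]].
have -> : x |: tr A0 = hyper A0 x.1.
  apply/setP => y; rewrite in_hyper in_setU1; have [->|yx] := eqVneq y x;
    first by rewrite eqxx orbT.
  have [e|_] := eqVneq y.1 x.1; rewrite ?orbF // orbT /=.
  by move: xA0 yx; rewrite !in_tr e; case: x y e => [i b] [j c] /= ->;
    rewrite xpair_eqE eqxx /=;
    case: b; case: c; case: (_ \in _).
have [A pA e] := par_case s A0 x.1; exists A, x.1; split => //.
by case: e => ->; rewrite ?hyper_fl.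
Qed.

Lemma hypoP s S : hypo_transversal S -> exists A q, par A = s /\ S = hypo A q.
Proof.
case/existsP => T /andP[/transversal_tr[A0 ->] /existsP[x /andP[xA0 /eqP ->]]].
have -> : tr A0 :\ x = hypo A0 x.1.
  apply/setP => y; rewrite in_hypo in_setD1 andbC; have [yA|//] := boolP (y \in tr A0).
  by rewrite (trE xA0) (trE yA) /el xpair_eqE /=; have [->|] := eqVneq y.1; rewrite ?eqxx.
have [A pA e] := par_case s A0 x.1; exists A, x.1; split => //.
by case: e => ->; rewrite ?hypo_fl.
Qed.

Lemma in_tr_star A p y : y \notin tr A -> (y == star (el A p)) = (y.1 == p).
Proof.
move=> yA; have : y \in tr (fl A y.1) by rewrite in_tr_fl (negbTE yA) eqxx.
move/trE => ->; rewrite star_el /=; apply/eqP/eqP => [[]//|->//].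
Qed.

Lemma hyper_hyper A p : hyper_transversal (hyper A p).
Proof.
apply/existsP; exists (tr A); rewrite tr_transversal; apply/existsP.
exists (star (el A p)); rewrite star_tr el_tr /=; apply/eqP/setP => y.
rewrite in_hyper in_setU1; have [yA|yA] := boolP (y \in tr A); rewrite ?orbT ?orbF //=.
by rewrite in_tr_star.
Qed.

Lemma hypo_hypo A q : hypo_transversal (hypo A q).
Proof.
apply/existsP; exists (tr A); rewrite tr_transversal; apply/existsP.
exists (el A q); rewrite el_tr /=; apply/eqP/setP => y.
rewrite in_hypo in_setD1 andbC; have [yA|_] := boolP (y \in tr A); last by rewrite !andbF.
by rewrite eq_el.
Qed.

Lemma card_ground_sum S :
  #|S| = \sum_i (((i, false) \in S) + ((i, true) \in S))%N.
Proof.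
rewrite -sum1_card big_mkcond /=.
rewrite (eq_bigr (fun x : ground n => ((x.1, x.2) \in S) : nat)); last first.
  by case=> a b _ /=; case: ifP.
rewrite -(pair_bigA _ (fun (k : 'I_n) b => ((k, b) \in S) : nat)) /=.
by apply: eq_bigr => k _; rewrite big_bool addnC.
Qed.

Lemma skew_subE i S : (skew_pair i \subset S) = ((i, false) \in S) && ((i, true) \in S).
Proof.
apply/subsetP/andP => [h|[h1 h2] [k b]].
  by split; apply: h; rewrite in_skew.
by rewrite in_skew /= => /eqP ->; case: b.
Qed.

Lemma aset_almost A i j : i != j -> aset A i j \in almost_transversals n.
Proof.
move=> ij; rewrite inE; apply/andP; split; last first.
  apply/cards1P; exists j; apply/setP => k;
    rewrite in_set1 inE skew_subE !in_aset !in_tr /=.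
  by have [->|_] := eqVneq k j; rewrite ?orbT ?orbF //; case: (k \in A) (k == i) => [] [].
rewrite card_ground_sum (bigD1 j) //= (bigD1 i) //= !in_aset !in_tr /= eqxx !orbT eqxx
  !andbF.
rewrite (negbTE ij) /= addn0.
rewrite (eq_bigr (fun=> 1)); last first.
  by move=> k /andP[kj ki]; rewrite !in_aset !in_tr /= (negbTE kj) ki; case: (k \in A).
rewrite sum1_card; apply/eqP; transitivity #|'I_n|; last exact: card_ord.
rewrite -(cardC (pred2 j i)) card2 eq_sym ij; congr (_ + _)%N.
by apply: eq_card => k; rewrite !inE negb_or.
Qed.

(** Each index meets [S] in 0, 1 or 2 elements, [n] in total. Since exactly one index [j] is met
    twice, exactly one index [i] is missed, and flipping [i] adjusts the parity. *)
Lemma almostP s S : S \in almost_transversals n ->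
  exists A i j, [/\ par A = s, i != j & S = aset A i j].
Proof.
rewrite inE => /andP[/eqP cS /cards1P[j /setP hj]].
pose c k := (((k, false) \in S) + ((k, true) \in S))%N.
have jS : forall k, ((k, false) \in S) && ((k, true) \in S) = (k == j).
  by move=> k; have := hj k; rewrite in_set1 inE skew_subE.
have : #|[set k | c k == 0]| = 1.
  apply/eqP; rewrite -(eqn_add2l #|S|) {1}card_ground_sum cS.
  have -> : #|[set k | c k == 0]| = \sum_k (c k == 0).
    by rewrite -sum1_card big_mkcond; apply: eq_bigr => k _; rewrite inE; case: eqP.
  rewrite -big_split /=; apply/eqP; transitivity (\sum_(k < n) (1 + (k == j)))%N.
    by apply: eq_bigr => k _; rewrite -jS /c; case: (_ \in S); case: (_ \in S).
  rewrite big_split /= sum1_card card_ord; congr addn.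
  by rewrite (bigD1 j) //= eqxx big1 // => k /negbTE ->.
move/eqP/cards1P=> [i /setP hi].
have iS k : ((k, false) \notin S) && ((k, true) \notin S) = (k == i).
  by have := hi k; rewrite in_set1 inE /c addn_eq0 !eqb0.
pose A0 := [set k | (k, false) \in S].
have ij : i != j by apply/eqP => e; have := iS i; have := jS i;
  rewrite -e eqxx => /andP[->].
have [A pA e] := par_case s A0 i; exists A, i, j; split=> //.
suff -> : S = aset A0 i j by case: e => ->; rewrite ?aset_fli.
apply/setP => -[k b]; rewrite in_aset in_tr /= inE.
have := iS k; have := jS k.
case: (k =P j) => [->|_]; first by rewrite orbT => /andP[]; case: b.
case: (k =P i) => [->|_]; first by rewrite andbF => _ /andP[/negbTE h1 /negbTE h2]; case: b.
by rewrite orbF andbT; case: b => /=; case: (_ \in S); case: (_ \in S).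
Qed.

Lemma neq_el A i x : x.1 != i -> x != el A i.
Proof. by apply: contraNneq => ->. Qed.

Lemma hyperD A p i : i != p -> hyper A p :\ el A i = aset (fl A p) i p.
Proof.
move=> ip; apply/setP => x; rewrite in_setD1 in_hyper in_aset in_tr_fl.
have [xp|xp] := eqVneq x.1 p.
  by rewrite !orbT andbT neq_el // xp eq_sym.
rewrite !orbF addbF andbC; have [xA|_] := boolP (x \in tr A); last by rewrite ?andbF.
by rewrite /= eq_el.
Qed.

Lemma hyperDp A p : hyper A p :\ el A p = tr (fl A p).
Proof.
apply/setP => x; rewrite in_setD1 in_hyper in_tr_fl.
have [xA|xA] := boolP (x \in tr A).
by rewrite eq_el //= andbT.
have -> : x != el A p by apply: contraNneq xA => ->; apply: el_tr.
by [].
Qed.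

Lemma hyperDN A p x : x \in hyper A p -> x \notin tr A -> hyper A p :\ x = tr A.
Proof.
rewrite in_hyper => /orP[->//|/eqP xp xA].
apply/setP => y; rewrite in_setD1 in_hyper; have [yA|yA] := boolP (y \in tr A).
  by rewrite andbT; apply: contraNneq xA => <-.
have [e|] := eqVneq y.1 p; rewrite ?andbF //= andbT.
have := @in_tr_star A p y yA; rewrite e eqxx => /eqP ->.
by have := @in_tr_star A p x xA; rewrite xp eqxx => /eqP ->; rewrite eqxx.
Qed.

Lemma hypoU B q i : i != q -> star (el B i) |: hypo B q = aset (fl B q) q i.
Proof.
move=> iq; apply/setP => x; rewrite in_setU1 in_hypo in_aset in_tr_fl.
have [xB|xB] := boolP (x \in tr B).
  have -> : x == star (el B i) = false.
    by apply/negP => /eqP e; move: xB; rewrite e star_tr el_tr.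
  have [xi|xi] := eqVneq x.1 i; first by rewrite xi iq orbT.
  by rewrite orbF; case: (x.1 == q).
rewrite in_tr_star // orbF.
by case: (x.1 == q).
Qed.

Lemma hypoUq B q : star (el B q) |: hypo B q = tr (fl B q).
Proof.
apply/setP => x; rewrite in_setU1 in_hypo in_tr_fl.
have [xB|xB] := boolP (x \in tr B); last by rewrite in_tr_star // orbF.
have -> : x == star (el B q) = false.
  by apply/negP => /eqP e; move: xB; rewrite e star_tr el_tr.
by [].
Qed.

Lemma hypoUN B q x : x \notin hypo B q -> x \in tr B -> x |: hypo B q = tr B.
Proof.
rewrite in_hypo => + xB; rewrite xB negbK => /eqP xq.
apply/setP => y; rewrite in_setU1 in_hypo; have [yB|yB] := boolP (y \in tr B).
  by rewrite (trE xB) xq eq_el //; case: (y.1 == q).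
by rewrite orbF; apply/negP => /eqP e; rewrite e xB in yB.
Qed.

(** The parity of the number [i] itself. Complementing a set changes [sigma] by it, which is how
    starred elements are counted. *)
Definition omega i := xsum (fun k : 'I_n => k < i).

Lemma sigmaC A i : xsum (fun k => (k \notin A) && (k < i)) = omega i (+) sigma A i.
Proof.
by rewrite /omega /sigma xsumD; apply: eq_xsum => k; case: (k \in A); case: (k < i).
Qed.

Lemma odd_nlt S x : odd (nlt S x) =
  xsum (fun k => (((k, false) \in S) && ground_lt (k, false) x)
                 (+) (((k, true) \in S) && ground_lt (k, true) x)).
Proof. by rewrite odd_card_ground; apply: eq_xsum => k; rewrite !in_set. Qed.

Lemma nlt_starred A i : odd (nlt (tr A :&: starred) (i, false)) = omega i (+) sigma A i.
Proof.
rewrite -sigmaC odd_card_ground; apply: eq_xsum => k.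
by rewrite !inE /ground_lt /= !andbF !orbF ?andbT.
Qed.

(** Every index below [i] contributes one element and [p] a second one. The last term is the
    unstarred partner of a starred [el A p], which precedes it. *)
Lemma nlt_hyper A p i :
  odd (nlt (hyper A p) (el A i)) = omega i (+) (p < i) (+) ((i == p) && (i \notin A)).
Proof.
rewrite /omega -(xsum1 p (fun k => k < i)) -(xsum1 i (fun k => (k == p) && (k \notin A)))
  !xsumD.
rewrite odd_nlt; apply: eq_xsum => k.
rewrite !in_hyper !in_tr /ground_lt /= ?xpair_eqE.
case: (ltngtP k i) => [ki|ki|/val_inj ->].
- by rewrite /= !andbT (ltn_eqF ki : (k == i) = false); case: (k == p); case: (k \in A).
- by rewrite /= !andbF (gtn_eqF ki : (k == i) = false) !andbF.
- by rewrite (eqxx i); case: (i == p); case: (i \in A).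
Qed.

Lemma nlt_hypo B q i :
  odd (nlt (hypo B q) (star (el B i))) = omega i (+) (q < i) (+) ((i != q) && (i \in B)).
Proof.
rewrite /omega -(xsum1 q (fun k => k < i)) -(xsum1 i (fun k => (k != q) && (k \in B)))
  !xsumD.
rewrite odd_nlt; apply: eq_xsum => k.
rewrite !in_hypo !in_tr /ground_lt /= ?xpair_eqE.
case: (ltngtP k i) => [ki|ki|/val_inj ->].
- by rewrite /= !andbT (ltn_eqF ki : (k == i) = false); case: (k == q); case: (k \in B).
- by rewrite /= !andbF (gtn_eqF ki : (k == i) = false) !andbF.
- by rewrite (eqxx i); case: (i == q); case: (i \in B).
Qed.

End AlmostTransversals.

(** * Restricted Grassmann-Plücker relations in terms of index sets *)

Section GrassmannPlucker.
Variables (F : tract) (n : nat).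
Implicit Types (A B : {set 'I_n}) (i j k p q : 'I_n) (phi : gpfun F n) (psi : wickfun F n).

(** The exponent in [rGP_of_wick]: [omega i (+) sigma A i] counts the starred elements of [tr A]
    below [i]. *)
Definition eps A i j : bool :=
  (j \in A) (+) (omega i (+) sigma A i) (+) (omega j (+) sigma A j).

Definition gp phi A : F := val_at phi (tr A).

(* In terms of a Wick function psi this is psi(A) psi(A △ {i, j}). *)
Definition gp2 phi A i j : F := sg F (eps A i j) ⋅ val_at phi (aset A i j).

(* Both products are psi(A △ {p}) psi(A △ {i}) when phi comes from psi.  The
   first is read off hyper A p without its element of index i, the second off
   hypo A p with an element of index i added. *)
Definition gp_hyper phi A p i := if i == p then gp phi (fl A p) else gp2 phi (fl A p) i p.
Definition gp_hypo phi A p i := if i == p then gp phi (fl A p) else gp2 phi (fl A p) p i.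

Lemma rGP_of_wickP psi phi : rGP_of_wick psi phi <->
  exists s, [/\ forall A, par A = ~~ s -> wk psi A = tzero,
                forall A, gp phi A = wk psi A ⋅ wk psi A &
                forall A i j, par A = s -> i != j ->
                  gp2 phi A i j = wk psi A ⋅ wk psi (fl (fl A i) j)].
Proof.
have eqs A i j : i != j ->
    val_at phi (tr A :\: skew_pair i :|: skew_pair j) =
     sgn (((j, false) \in tr A) + nlt (tr A :&: starred) (i, false)
           + nlt (tr A :&: starred) (j, false))
     ⋅ (val_at psi (tr A) ⋅ val_at psi (symdiff (tr A) (skew_pair i :|: skew_pair j)))
   <-> gp2 phi A i j = wk psi A ⋅ wk psi (fl (fl A i) j).
  move=> ij; rewrite symdiff_tr2 // sgnE !oddD !nlt_starred in_tr /= oddb -/(eps A i j).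
  rewrite /gp2; split=> [->|<-]; first by rewrite sgMA addbb tmul1.
  by rewrite sgMA addbb tmul1.
split=> -[s [h1 h2 h3]]; exists s; split.
- by move=> A pA; apply: h1; rewrite tr_par pA.
- by move=> A; apply: h2; apply: tr_transversal.
- by move=> A i j pA ij; apply/eqs/h3 => //; rewrite tr_par pA.
- by move=> _ /transversal_parP[A -> pA]; apply: h1.
- by move=> _ /transversal_tr[A ->]; apply: h2.
- by move=> _ i j /transversal_parP[A -> pA] ij; apply/eqs/h3.
Qed.

(** Everything in the sign that depends on [i] collapses to [sigma A i], the sign of the Wick vector
    of [A]; the rest is constant and can be scaled away. *)
Lemma rGP_vector_el phi A p i :
  rGP_vector phi (hyper A p) (el A i) =
  sg F ((p \notin A) (+) omega p (+) sigma A p (+) sigma A i) ⋅ gp_hyper phi A p i.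
Proof.
rewrite /rGP_vector in_hyper el_tr /= sgnE nlt_hyper /gp_hyper.
have [->|ip] := eqVneq i p.
  rewrite hyperDp ltnn; congr (sg F _ ⋅ _).
  by case: (p \in A); case: (omega p); case: (sigma A p).
rewrite hyperD // /gp2 sgMA /eps; congr (sg F _ ⋅ _).
rewrite !sigma_fl ltnn !in_fl eqxx /=.
by case: (p \in A); case: (omega p); case: (sigma A p); case: (omega i);
  case: (sigma A i); case: (p < i).
Qed.

Lemma rGP_vectorN phi A p x : x \notin tr A -> gp phi A = tzero ->
  rGP_vector phi (hyper A p) x = tzero.
Proof.
move=> xA A0; rewrite /rGP_vector; case: ifP => // xS.
by rewrite hyperDN // [val_at _ _]A0 tmulr0.
Qed.

Lemma hypo_el phi B q i :
  sgn (nlt (hypo B q) (star (el B i))) ⋅ val_at phi (star (el B i) |: hypo B q) =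
  sg F (omega q (+) sigma B q (+) sigma B i) ⋅ gp_hypo phi B q i.
Proof.
rewrite sgnE nlt_hypo /gp_hypo.
have [->|iq] := eqVneq i q.
  by rewrite hypoUq ltnn; congr (sg F _ ⋅ _); case: (omega q); case: (sigma B q).
rewrite hypoU // /gp2 sgMA /eps; congr (sg F _ ⋅ _).
rewrite !sigma_fl ltnn !in_fl (negbTE iq) /=.
by case: (i \in B); case: (omega q); case: (sigma B q); case: (omega i);
  case: (sigma B i); case: (q < i).
Qed.

Definition gp_rel phi A B p q :=
  tnull [seq sg F (sigma A i (+) sigma B i) ⋅ (gp_hyper phi A p i ⋅ gp_hypo phi B q i)
        | i in dset A B].

Lemma odd_nlt_symdiff (S S' : {set ground n}) x :
  odd (nlt (symdiff S S') x) = odd (nlt S x) (+) odd (nlt S' x).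
Proof.
rewrite !odd_nlt xsumD; apply: eq_xsum => k; rewrite !in_symdiff.
by do 2!case: (ground_lt _ x); do 4!case: (_ \in _).
Qed.

Lemma el_dset A B i : (i \in dset A B) = (el A i == star (el B i)).
Proof. by rewrite inE /el /star xpair_eqE eqxx /=; case: (i \in A); case: (i \in B). Qed.

Lemma el_dset_in A B p q i : i \in dset A B -> el A i \in hyper A p :\: hypo B q.
Proof.
move=> iD; rewrite in_setD in_hyper el_tr andbT in_hypo.
by move: iD; rewrite el_dset => /eqP ->; rewrite star_tr el_tr.
Qed.

Lemma tr_dset A B x : x \in tr A -> x \notin tr B -> x.1 \in dset A B.
Proof. by rewrite !in_tr inE; case: x.2; case: (_ \in A); case: (_ \in B). Qed.

(** Removing from [S] an element outside [tr A] leaves [tr A], and adding to [S'] an element of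
    [tr B] gives [tr B]. Both have value zero, so only the elements of [tr A] outside [tr B] remain
    in the sum. *)
Lemma gp_relP phi A B p q : gp phi A = tzero -> gp phi B = tzero ->
  let S := hyper A p in let S' := hypo B q in
  tnull [seq sgn (nlt (symdiff S S') x) ⋅ (val_at phi (S :\ x) ⋅ val_at phi (x |: S'))
        | x in S :\: S'] <-> gp_rel phi A B p q.
Proof.
move=> A0 B0 S S'; rewrite (@tnull_image _ _ _ _ _ (el A) (dset A B)).
- rewrite -(tnull_scaleE _ (sg_neq0 F ((p \notin A) (+) omega p (+) sigma A p (+) (omega
  q (+) sigma B q)))).
  rewrite /gp_rel -map_comp.
  have e i : i \in dset A B ->
     sgn (nlt (symdiff S S') (el A i)) ⋅ (val_at phi (S :\ el A i) ⋅ val_at phi (el A i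
       |: S'))
    = sg F ((p \notin A) (+) omega p (+) sigma A p (+) (omega q (+) sigma B q)) ⋅
      (sg F (sigma A i (+) sigma B i) ⋅ (gp_hyper phi A p i ⋅ gp_hypo phi B q i)).
    rewrite el_dset => /eqP ei.
    have := rGP_vector_el phi A p i; rewrite /rGP_vector in_hyper el_tr /= => e1.
    have := hypo_el phi B q i; rewrite -ei => e2.
    rewrite sgnE odd_nlt_symdiff -sgM -!sgnE.
    transitivity ((sgn (nlt S (el A i)) ⋅ val_at phi (S :\ el A i)) ⋅
       (sgn (nlt S' (el A i)) ⋅ val_at phi (el A i |: S'))); first by tmonom.
    rewrite e1 e2 sgMA.
    set a := sg F _; set b := sg F _; set c := sg F _; have -> : c = a ⋅ b.
      rewrite /a /b /c sgM; congr sg.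
      by case: (sigma A i); case: (sigma B i); case: (omega p); case: (sigma A p);
        case: (omega q);
       case: (sigma B q); case: (_ \in A).
    by tmonom.
  rewrite /image_mem; set L := map _ _; set R := map _ _; suff -> : L = R by [].
  apply/eq_in_map => i; rewrite mem_enum /= => iD.
  by rewrite (e _ iD) sgMA addbb tmul1.
- by move=> i j _ _ [].
- by move=> i; apply: el_dset_in.
move=> x xS h; have [xA|xA] := boolP (x \in tr A); last first.
  rewrite /S hyperDN // 1?[val_at _ _]A0 ?tmul0 ?tmulr0 //.
  by move: xS; rewrite in_setD => /andP[].
have xB : x \in tr B.
  apply: contraT => xB; have := h x.1 (tr_dset xA xB).
  by rewrite -trE // eqxx.
rewrite /S' hypoUN // 1?[val_at _ (tr B)]B0 ?tmulr0 //.
by move: xS; rewrite in_setD => /andP[].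
Qed.

(** Besides the elements [el A i] with [i] in the difference, only [el B q] can occur, and it does
    not if [q] is in the difference and distinct from [p]. At distance four this is how the bound
    four is met. *)
Lemma card_hyper_hypo A B p q : p \in dset A B ->
  #|hyper A p :\: hypo B q| <= dist A B + ((q \notin dset A B) || (p == q)).
Proof.
move=> pD.
have sub : hyper A p :\: hypo B q \subset el B q |: [set el A i | i in dset A B].
  apply/subsetP => x xS; rewrite in_setU1; have [xA|xA] := boolP (x \in tr A).
    have [xB|xB] := boolP (x \in tr B); last first.
      apply/orP; right; apply/imsetP; exists x.1; rewrite -?trE //.
      exact: tr_dset xA xB.
    by move: xS; rewrite in_setD in_hypo xB /= negbK eq_el // => /andP[->].
  move: xS; rewrite in_setD in_hyper (negbTE xA) in_hypo => /andP[h /= /eqP xp].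
  have xB : x \in tr B.
    by move: pD xA; rewrite -xp inE !in_tr; case: x.2; case: (_ \in A); case: (_ \in B).
  by move: h; rewrite xB /= negbK eq_el // => ->.
have cD : #|[set el A i | i in dset A B]| = dist A B by rewrite card_imset // => i j [].
have [h|] := boolP (_ || _).
  apply: leq_trans (subset_leq_card sub) _; rewrite cardsU1 cD addnC leq_add2l.
  by case: (_ \notin _).
rewrite negb_or negbK => /andP[qD pq]; rewrite addn0 -cD.
apply: subset_leq_card; apply/subsetP => x xS.
have := subsetP sub _ xS; rewrite in_setU1 => /orP[/eqP e|//].
move: xS; rewrite e in_setD in_hyper eq_sym (negbTE pq) orbF => /andP[_].
by move: qD; rewrite inE in_tr /=; case: (_ \in A); case: (_ \in B).
Qed.

Lemma dist_hyper_hypo A B p q : dist A B <= #|hyper A p :\: hypo B q|.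
Proof.
have <- : #|[set el A i | i in dset A B]| = dist A B by rewrite card_imset // => i j [].
by apply: subset_leq_card; apply/subsetP => _ /imsetP[i iD ->]; apply: el_dset_in.
Qed.

End GrassmannPlucker.

(** * Parity and connectedness of the bases *)

Section EvenDeltaFacts.
Variable n : nat.
Implicit Types (A B : {set 'I_n}) (i j k : 'I_n) (bs : pred {set 'I_n}).

Lemma even_delta_par bs : even_delta bs -> exists s, forall A, bs A -> par A = s.
Proof.
move=> ed; have [B0 bB0] := ed.1; exists (par B0); apply: (even_delta_ind ed bB0) => //.
by move=> A i j _ _ _ _ _ <-; rewrite !par_fl negbK.
Qed.

Lemma even_delta_const bs (T : Type) (r : {set 'I_n} -> T) : even_delta bs ->
  (forall A i j, i != j -> bs A -> bs (fl (fl A i) j) -> r (fl (fl A i) j) = r A) ->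
  forall A B, bs A -> bs B -> r A = r B.
Proof.
move=> ed rE A B bA bB; move: A bA; apply: (even_delta_ind ed bB) => //.
by move=> A i j ij bA bij _ _ <-; rewrite rE.
Qed.

Lemma in_dset A B i : (i \in dset A B) = (i \in A) (+) (i \in B).
Proof. by rewrite inE. Qed.

Lemma odd_dist A B : odd (dist A B) = par A (+) par B.
Proof.
rewrite /dist -sum1_card big_mkcond odd_sum /par xsumD; apply: eq_xsum => k.
by rewrite inE; case: (k \in A); case: (k \in B).
Qed.

Lemma dset_foldl A B (r : seq 'I_n) : uniq r -> (forall i, (i \in dset A B) = (i \in r)) ->
  B = foldl (@fl n) A r.
Proof.
move=> ur h.
suff e : forall r A, uniq r -> forall i, (i \in foldl (@fl n) A r) = (i \in A) (+) (i \in
  r).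
  by apply/setP => i; rewrite e // -h in_dset addKb.
elim=> [|j r' IH] C /=; first by move=> _ i; rewrite addbF.
case/andP => jr ur' i; rewrite IH // in_fl in_cons.
by have [->|] := eqVneq i j; rewrite ?addbF //= (negbTE jr) addbF.
Qed.

End EvenDeltaFacts.

(** * Wick relations at distance at most four *)

Section WickRelations.
Variables (F : tract) (n : nat).
Implicit Types (A B : {set 'I_n}) (i j k : 'I_n) (w : {set 'I_n} -> F).

Lemma tnull_dset A B (r : seq 'I_n) (f : 'I_n -> F) :
    uniq r -> (forall i, (i \in dset A B) = (i \in r)) ->
  tnull [seq f i | i in dset A B] <-> tnull [seq f i | i <- r].
Proof.
move=> ur h; apply: tnull_zeros => // i; first by rewrite -h.
by rewrite h => ->.
Qed.

(** Both summands are the product of [w (fl A i)] and [w (fl A j)], with opposite signs. *)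
Lemma wick_rel2 w A i j : i != j -> wick_rel w A (fl (fl A i) j).
Proof.
move=> ij; apply/(@tnull_dset _ _ [:: i; j]) => [|k|].
- by rewrite /= inE ij.
- rewrite in_dset !in_fl !inE; have [->|] := eqVneq k i; rewrite ?(negbTE ij) /=;
  first by case: (_ \in _).
  by case: (k == j); case: (_ \in _).
- rewrite /= /wick_term !flJ !flK !sigma_fl !ltnn; apply: tnull_sg2; last by rewrite tmulC.
  by have := ltn_addb ij; case: (_ < _) (_ < _) (sigma _ _) (sigma _ _) => [] [] [] [].
Qed.

Lemma wick_rel_le4 w A B : (forall A B, dist A B = 4 -> wick_rel w A B) ->
  par A = par B -> dist A B <= 4 -> wick_rel w A B.
Proof.
move=> w4 pAB; have := odd_dist A B; rewrite pAB addbb.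
have [e _ _|A0] := eqVneq (dist A B) 0.
  apply/(@tnull_dset _ _ [::]) => //; last exact: tnull_nil.
  by move=> i; rewrite (cards0_eq e : dset A B = set0) inE.
have [e _ _|A2] := eqVneq (dist A B) 2.
  have /cards2P[i [j [ij /setP h]]] : #|dset A B| == 2 by apply/eqP.
  rewrite (@dset_foldl _ A B [:: i; j]) /= ?inE ?ij //; first exact: wick_rel2.
  by move=> k; rewrite h !inE.
have [e _ _|A4] := eqVneq (dist A B) 4; first exact: w4.
by case: (dist A B) A0 A2 A4 => [|[|[|[|[|m]]]]].
Qed.

Lemma in_dset4 A i j k l : uniq [:: i; j; k; l] ->
  forall x, (x \in dset A (fl (fl (fl (fl A i) j) k) l)) = (x \in [:: i; j; k; l]).
Proof.
rewrite /= !inE !negb_or => /and4P[/and3P[ij ik il] /andP[jk jl] kl _] x.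
rewrite in_dset !in_fl !inE -!addbA addKb.
have [->|_] := eqVneq x i; first by rewrite (negbTE ij) (negbTE ik) (negbTE il).
have [->|_] := eqVneq x j; first by rewrite (negbTE jk) (negbTE jl).
have [->|_] := eqVneq x k; first by rewrite (negbTE kl).
by case: (x == l).
Qed.

Lemma wick_rel4 w A i j k l : uniq [:: i; j; k; l] ->
  let B := fl (fl (fl (fl A i) j) k) l in
  wick_rel w A B <-> tnull [:: wick_term w A B i; wick_term w A B j;
                               wick_term w A B k; wick_term w A B l].
Proof. by move=> u B; apply: (@tnull_dset _ _ [:: i; j; k; l]) => //; apply: in_dset4. Qed.

End WickRelations.

(** * From Wick functions to Grassmann-Plücker functions *)

Section WickToGP.
Variables (F : tract) (n : nat).
Implicit Types (A B : {set 'I_n}) (i j k p q : 'I_n) (phi : gpfun F n) (psi : wickfun F n).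

Lemma eps_fl2 A i j : i != j -> eps (fl (fl A i) j) i j = eps A i j.
Proof.
move=> ij; rewrite /eps !in_fl !sigma_fl !ltnn eqxx eq_sym (negbTE ij).
have := ltn_addb ij.
by case: (j \in A); case: (i < j); case: (j < i); case: (omega i); case: (sigma A i);
  case: (omega j); case: (sigma A j).
Qed.

Lemma epsC A i j : eps A i j = (i \in A) (+) (j \in A) (+) eps A j i.
Proof.
rewrite /eps; case: (j \in A); case: (i \in A); case: (omega i); case: (sigma A i);
  by case: (omega j); case: (sigma A j).
Qed.

(** The index missed and the index met twice determine [i] and [j]. Away from them [A] and [B]
    agree, and equal parity leaves the choice of flipping both or none. *)
Lemma aset_eq A B i j i' j' : i != j -> i' != j' -> par A = par B ->
  aset A i j = aset B i' j' -> [/\ i = i', j = j' & B = A \/ B = fl (fl A i) j].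
Proof.
move=> ij ij' pAB /setP e.
have h k b : (b (+) (k \in A)) && (k != i) || (k == j) = (b (+) (k \in B)) && (k != i')
  || (k == j').
  by have := e (k, b); rewrite !in_aset !in_tr.
have ei : i = i'.
  have := h i true; have := h i false; rewrite eqxx !andbF (negbTE ij) /=.
  by have [//|] := eqVneq i i'; case: (i \in B); rewrite //= andbT.
have ej : j = j'.
  have := h j true; have := h j false; rewrite eqxx !orbT.
  by have [//|] := eqVneq j j'; rewrite !orbF; case: (j \in B).
split=> //; subst i' j'.
have hk k : k != i -> k != j -> (k \in B) = (k \in A).
  by move=> ki kj; have := h k false; rewrite ki (negbTE kj) !andbT !orbF.
have [eqi|neqi] := boolP ((i \in A) (+) (i \in B));
  have [eqj|neqj] := boolP ((j \in A) (+) (j \in B)).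
- right; apply/setP => k; rewrite !in_fl.
  have [->|ki] := eqVneq k i; first by rewrite (negbTE ij);
    case: (i \in A) (i \in B) eqi => [] [].
  have [->|kj] := eqVneq k j; first by case: (j \in A) (j \in B) eqj => [] [].
  by rewrite hk // !addbF.
- have eB : B = fl A i.
    apply/setP => k; rewrite !in_fl; have [->|ki] := eqVneq k i.
      by case: (i \in A) (i \in B) eqi => [] [].
    have [->|kj] := eqVneq k j; first by case: (j \in A) (j \in B) neqj => [] [].
    by rewrite hk // addbF.
  by move: pAB; rewrite eB par_fl; case: (par A).
- have eB : B = fl A j.
    apply/setP => k; rewrite !in_fl; have [->|kj] := eqVneq k j.
      by case: (j \in A) (j \in B) eqj => [] [].
    have [->|ki] := eqVneq k i; first by case: (i \in A) (i \in B) neqi => [] [].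
    by rewrite hk // addbF.
  by move: pAB; rewrite eB par_fl; case: (par A).
- left; apply/setP => k.
  have [->|ki] := eqVneq k i; first by case: (i \in A) (i \in B) neqi => [] [].
  have [->|kj] := eqVneq k j; first by case: (j \in A) (j \in B) neqj => [] [].
  by rewrite hk.
Qed.

Lemma tr_neq_aset A B i j : tr A != aset B i j.
Proof.
apply/eqP => /setP e; have := e (j, true); have := e (j, false).
by rewrite !in_aset !in_tr /= eqxx !orbT => ->.
Qed.

Definition mkwick (w : {set 'I_n} -> F) : wickfun F n :=
  fun S => w [set k | (k, false) \in sval S].

Lemma wk_mkwick w A : wk (mkwick w) A = w A.
Proof.
rewrite /wk (val_atE _ (tr_transversal A)) /mkwick /=; congr w.
by apply/setP => k; rewrite inE in_tr.
Qed.

Lemma wk_inj psi1 psi2 : (forall A, wk psi1 A = wk psi2 A) -> psi1 = psi2.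
Proof. by move=> e; apply: domfun_eq => S /transversal_tr[A ->]; apply: e. Qed.

Lemma gp_dom A : tr A \in transversals n :|: almost_transversals n.
Proof. by rewrite in_setU tr_transversal. Qed.

Lemma gp2_dom A i j : i != j -> aset A i j \in transversals n :|: almost_transversals n.
Proof. by move=> ij; rewrite in_setU aset_almost // orbT. Qed.

Lemma gp_inj s phi1 phi2 : (forall A, gp phi1 A = gp phi2 A) ->
  (forall A i j, par A = s -> i != j -> gp2 phi1 A i j = gp2 phi2 A i j) -> phi1 = phi2.
Proof.
move=> e1 e2; apply: domfun_eq => S; rewrite in_setU => /orP[/transversal_tr[A ->]|];
  first exact: e1.
by case/(almostP s) => A [i [j [pA ij ->]]]; apply: (tmulI (sg_neq0 F (eps A i j)));
  apply: e2.
Qed.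

(** An almost-transversal has just two presentations [aset A i j] with [par A = s], related by
    flipping [i] and [j]. Invariance of [h] under this flip, together with [eps_fl2], makes the
    values well defined. *)
Lemma gp_exists s (w : {set 'I_n} -> F) (h : {set 'I_n} -> 'I_n -> 'I_n -> F) :
    (forall A i j, par A = s -> i != j -> h (fl (fl A i) j) i j = h A i j) ->
  exists phi, (forall A, gp phi A = w A) /\
    (forall A i j, par A = s -> i != j -> gp2 phi A i j = h A i j).
Proof.
move=> hfl.
(* Every set of the domain has one of the two forms, so the final zero is never reached. *)
pose phi : gpfun F n := fun S =>
  if [pick A | sval S == tr A] is Some A then w A
  else if [pick t : {set 'I_n} * ('I_n * 'I_n) |
      [&& par t.1 == s, t.2.1 != t.2.2 & sval S == aset t.1 t.2.1 t.2.2]] is Some t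
  then sg F (eps t.1 t.2.1 t.2.2) ⋅ h t.1 t.2.1 t.2.2 else tzero.
exists phi; split=> [A|A i j pA ij].
  rewrite /gp (val_atE _ (gp_dom A)) /phi /=; case: pickP => [B /eqP/tr_inj -> //|/(_ A)].
  by rewrite eqxx.
rewrite /gp2 (val_atE _ (gp2_dom A ij)) /phi /=; case: pickP => [B|_].
  by rewrite eq_sym (negbTE (tr_neq_aset _ _ _ _)).
case: pickP => [[B [k l]] /= /and3P[/eqP pB kl /eqP e]|/(_ (A, (i, j)))]; last first.
  by rewrite /= pA ij !eqxx.
rewrite -pB in pA; have [ek el [eB|eB]] := aset_eq ij kl pA e; rewrite -?ek -?el eB.
  by rewrite sgMA addbb tmul1.
by rewrite eps_fl2 // hfl // ?sgMA ?addbb ?tmul1 // pA.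
Qed.

Lemma wick_parity psi : weak_wick psi ->
  exists s, (forall A, wk psi A != tzero -> par A = s) /\ exists2 A, wk psi A != tzero &
    par A = s.
Proof.
move=> /weak_wickP[ed _]; have [s hs] := even_delta_par ed; exists s; split=> //.
by have [A bA] := ed.1; exists A => //; apply: hs.
Qed.

Lemma rGP_of_wick_exists psi : weak_wick psi -> exists phi, rGP_of_wick psi phi.
Proof.
case/wick_parity => s [hs _].
have [|phi [e1 e2]] := @gp_exists s (fun A => wk psi A ⋅ wk psi A)
  (fun A i j => wk psi A ⋅ wk psi (fl (fl A i) j)).
  by move=> A i j _ _; rewrite flJ flK tmulC.
exists phi; apply/rGP_of_wickP; exists s; split=> // A pA; apply/eqP.
by apply: contraT => /hs e; move: pA; rewrite e; case: (s).
Qed.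

(** The parity in [rGP_of_wick] is existential, but any basis of [psi] pins it down. *)
Lemma rGP_of_wick_parity psi phi : weak_wick psi -> rGP_of_wick psi phi ->
  forall s, (forall A, wk psi A != tzero -> par A = s) ->
  [/\ forall A, par A = ~~ s -> wk psi A = tzero,
      forall A, gp phi A = wk psi A ⋅ wk psi A &
      forall A i j, par A = s -> i != j -> gp2 phi A i j = wk psi A ⋅ wk psi (fl (fl A i)
        j)].
Proof.
move=> wpsi /rGP_of_wickP[s' [h1 h2 h3]] s hs.
have [A bA] := (iffLR (weak_wickP psi) wpsi).1.1.
have -> : s = s'; last by [].
rewrite -(hs _ bA); apply/eqP; apply: contraNT bA => ne.
by apply/eqP/h1; case: (par A) (s') ne => [] [].
Qed.

Lemma rGP_of_wick_unique psi phi1 phi2 :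
  weak_wick psi -> rGP_of_wick psi phi1 -> rGP_of_wick psi phi2 -> phi1 = phi2.
Proof.
move=> wpsi r1 r2; have [s [hs _]] := wick_parity wpsi.
have [_ a1 b1] := rGP_of_wick_parity wpsi r1 hs.
have [_ a2 b2] := rGP_of_wick_parity wpsi r2 hs.
apply: (@gp_inj s) => [A|A i j pA ij]; first by rewrite a1 a2.
by rewrite b1 // b2.
Qed.

Lemma wk_scale c psi A : wk (scale c psi : wickfun F n) A = c ⋅ wk psi A.
Proof. exact: val_at_scale. Qed.

Lemma gp_scale c phi A : gp (scale c phi : gpfun F n) A = c ⋅ gp phi A.
Proof. exact: val_at_scale. Qed.

Lemma gp2_scale c phi A i j : gp2 (scale c phi : gpfun F n) A i j = c ⋅ gp2 phi A i j.
Proof. by rewrite /gp2 val_at_scale tmulCA. Qed.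

Lemma rGP_of_wick_scale c psi phi : rGP_of_wick psi phi ->
  rGP_of_wick (scale c psi : wickfun F n) (scale (c ⋅ c) phi : gpfun F n).
Proof.
move=> /rGP_of_wickP[s [h1 h2 h3]]; apply/rGP_of_wickP; exists s; split.
- by move=> A pA; rewrite wk_scale h1 // tmulr0.
- by move=> A; rewrite gp_scale wk_scale h2; tmonom.
- by move=> A i j pA ij; rewrite gp2_scale !wk_scale h3 //; tmonom.
Qed.

Lemma in_fsupport (D : {set {set ground n}}) (f : domfun F D) S :
  (S \in fsupport f) = (S \in D) && (val_at f S != tzero).
Proof. exact: in_set. Qed.

Lemma hyper_supp phi A p i :
  (hyper A p :\ el A i \in fsupport phi) = (gp_hyper phi A p i != tzero).
Proof.
rewrite in_fsupport /gp_hyper; have [->|ip] := eqVneq i p; first by rewrite hyperDp gp_dom.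
by rewrite hyperD // gp2_dom // /gp2 tmul_neq0 sg_neq0.
Qed.

Lemma hypo_supp phi B q i :
  (star (el B i) |: hypo B q \in fsupport phi) = (gp_hypo phi B q i != tzero).
Proof.
rewrite in_fsupport /gp_hypo; have [->|iq] := eqVneq i q; first by rewrite hypoUq gp_dom.
have qi : q != i by rewrite eq_sym.
by rewrite hypoU // gp2_dom // /gp2 tmul_neq0 sg_neq0.
Qed.

(** A valid choice outside [tr A], or inside [tr B], would put [tr A] or [tr B] into the support,
    where [gp] is nonzero. *)
Lemma card_exchange phi A B p q : gp phi A = tzero -> gp phi B = tzero ->
  let S := hyper A p in let S' := hypo B q in
  #|[set x in S :\: S' | (S :\ x \in fsupport phi) && (x |: S' \in fsupport phi)]| =
  #|[set i in dset A B | (gp_hyper phi A p i != tzero) && (gp_hypo phi B q i != tzero)]|.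
Proof.
move=> A0 B0 S S'; rewrite -(card_imset _ (fun i j (e : el A i = el A j) => congr1 fst e)).
apply: eq_card => x; rewrite in_set; apply/idP/imsetP => [/and3P[xS h1 h2]|[i]].
  have xA : x \in tr A.
    move: h1; apply: contraLR => xA; rewrite /S hyperDN //;
      first by rewrite in_fsupport gp_dom [val_at _ _]A0 eqxx.
    by move: xS; rewrite in_setD => /andP[].
  have xB : x \notin tr B.
    apply/negP => xB; move: h2; rewrite /S' hypoUN //;
      first by rewrite in_fsupport gp_dom [val_at _ _]B0 eqxx.
    by move: xS; rewrite in_setD => /andP[].
  have iD := tr_dset xA xB; exists x.1; last exact: trE.
  rewrite inE iD -hyper_supp -hypo_supp; move: (iD); rewrite el_dset => /eqP <-.
  by rewrite -trE // h1.
rewrite inE -hyper_supp -hypo_supp => /and3P[iD h1 h2] ->.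
rewrite el_dset_in //= -/S h1 /=.
by move: iD; rewrite el_dset => /eqP ->.
Qed.

Lemma gp_hyperE psi phi s A p i :
    (forall A, gp phi A = wk psi A ⋅ wk psi A) ->
    (forall A i j, par A = s -> i != j -> gp2 phi A i j = wk psi A ⋅ wk psi (fl (fl A i)
      j)) ->
    par A = ~~ s -> gp_hyper phi A p i = wk psi (fl A p) ⋅ wk psi (fl A i).
Proof.
move=> h2 h3 pA; rewrite /gp_hyper; have [->|ip] := eqVneq i p; first exact: h2.
by rewrite h3 ?par_fl ?pA ?negbK // flJ.
Qed.

Lemma gp_hypoE psi phi s A p i :
    (forall A, gp phi A = wk psi A ⋅ wk psi A) ->
    (forall A i j, par A = s -> i != j -> gp2 phi A i j = wk psi A ⋅ wk psi (fl (fl A i)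
      j)) ->
    par A = ~~ s -> gp_hypo phi A p i = wk psi (fl A p) ⋅ wk psi (fl A i).
Proof.
move=> h2 h3 pA; rewrite /gp_hypo; have [->|ip] := eqVneq i p; first exact: h2.
by rewrite h3 ?par_fl ?pA ?negbK // 1?eq_sym // flK.
Qed.

Lemma rGP4P phi A i j : i != j ->
  val_at phi (tr A :\: skew_pair i :|: skew_pair j) =
    sgn (((i, false) \in tr A) + ((j, false) \in tr A))
      ⋅ val_at phi ((tr A :|: skew_pair i) :\: skew_pair j) <->
  gp2 phi A i j = gp2 phi A j i.
Proof.
move=> ij; rewrite asetC // -/(aset A i j) sgnE oddD !in_tr /= !oddb /gp2 epsC.
split=> [->|/(congr1 (tmul (sg F ((i \in A) (+) (j \in A) (+) eps A j i))))].
  by rewrite sgMA addbAC addbb.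
by rewrite !sgMA addbb tmul1 -addbA addbb addbF => ->.
Qed.

Lemma weak_rGP_of_wick psi phi : weak_wick psi -> rGP_of_wick psi phi -> weak_rGP phi.
Proof.
move=> wpsi r; have [s [hs [A0 bA0 pA0]]] := wick_parity wpsi.
have [h1 h2 h3] := rGP_of_wick_parity wpsi r hs.
have /weak_wickP[ed w4] := wpsi.
have z A : par A = ~~ s -> gp phi A = tzero by move=> /h1 e; rewrite h2 e tmul0.
have gpC A i j : par A = s -> i != j -> gp2 phi A i j = gp2 phi A j i.
  by move=> pA ij; rewrite !h3 // 1?eq_sym // flC.
split.
- split; last first.
    exists s; apply/subsetP => S; rewrite in_setI in_fsupport => /andP[/andP[_ S0]
      /transversal_tr[A e]].
    move: S0; rewrite e tr_par [val_at _ _]h2 => A1; apply/eqP/hs.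
    by move: A1; rewrite tmul_neq0 => /andP[].
  split.
  + by apply/set0Pn; exists (tr A0); rewrite in_fsupport gp_dom [val_at _ _]h2 tmul_neq0
    bA0.
  + by apply/subsetP => S; rewrite in_fsupport => /andP[].
  + move=> S S' /(hyperP (~~ s))[A [p [pA ->]]] /(hypoP (~~ s))[B [q [pB ->]]].
    rewrite card_exchange ?z //; move/eqP/cards1P => [i /setP hi].
    have := hi i; rewrite !inE eqxx (gp_hyperE _ _ h2 h3) // (gp_hypoE _ _ h2 h3) //.
    rewrite !tmul_neq0 => /and3P[iAB /andP[bAp bAi] /andP[bBq bBi]].
    (* A valid choice [i] cannot be alone: exchanging [i] between [fl A i] and [fl B i] gives a
       partner [j], which is a second valid choice. *)
    have [] := ed.2 _ _ i bAi bBi; first by rewrite !in_fl eqxx addbACA addbb addbF.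
    move=> j [ji]; rewrite !flK !in_fl (negbTE ji) !addbF => jAB bAj bBj.
    have := hi j; rewrite !inE (negbTE ji) (gp_hyperE _ _ h2 h3) // (gp_hypoE _ _ h2 h3) //.
    by rewrite !tmul_neq0 jAB bAp bAj bBq bBj.
  + move=> _ i j /transversal_tr[A ->] ij; rewrite asetC // -/(aset A i j).
    (* Flipping [i] changes neither almost-transversal, so the symmetry of [gp2] at parity [s]
       applies. *)
    have [B pB eB] := par_case s A i.
    have -> : aset A i j = aset B i j by case: eB => ->; rewrite ?aset_fli.
    have -> : aset A j i = aset B j i by case: eB => ->; rewrite ?aset_flj.
    have ji : j != i by rewrite eq_sym.
    rewrite !in_fsupport !gp2_dom //=.
    have := gpC _ _ _ pB ij; rewrite /gp2 => /(congr1 (fun x => x != tzero)).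
    by rewrite !tmul_neq0 !sg_neq0.
- move=> S S' /(hyperP (~~ s))[A [p [pA ->]]] /(hypoP (~~ s))[B [q [pB ->]]] cS.
  apply/gp_relP; rewrite ?z //.
  have wr : wick_rel (wk psi) A B.
    apply: wick_rel_le4; rewrite ?pA ?pB //.
    exact: leq_trans (dist_hyper_hypo _ _ _ _) cS.
  rewrite /gp_rel; pose c := wk psi (fl A p) ⋅ wk psi (fl B q).
  have e i : sg F (sigma A i (+) sigma B i) ⋅ (gp_hyper phi A p i ⋅ gp_hypo phi B q i) =
      c ⋅ wick_term (wk psi) A B i.
    by rewrite (gp_hyperE _ _ h2 h3) // (gp_hypoE _ _ h2 h3) // /c /wick_term; tmonom.
  rewrite /image_mem (eq_map e) (map_comp (tmul c)).
  (* Null sums may be scaled by units only; a vanishing factor is treated apart, all summands being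
     zero. *)
  have [->|c0] := eqVneq c tzero; last by apply/tnull_scaleE.
  rewrite (eq_map (g := fun=> tzero)); last by move=> x /=; rewrite tmul0.
  set u := [seq wick_term _ _ _ _ | _ <- _].
  have -> : [seq tzero | _ <- u] = nseq (size u) (tzero : F) ++ [::].
    by rewrite cats0; elim: (u) => //= _ v ->.
  by apply/tnull_nseq0/tnull_nil.
- exists s; split=> [_ /transversal_parP[A -> pA]|_ i j /transversal_parP[A -> pA] ij];
  first exact: z.
  by apply/rGP4P => //; apply: gpC.
Qed.

(** The quotient of the two functions is unchanged along every edge, and the basis graph is
    connected. *)
Lemma wick_ratio (psi1 psi2 : {set 'I_n} -> F) :
    even_delta (fun A => psi1 A != tzero) ->
    (forall A, (psi1 A == tzero) = (psi2 A == tzero)) ->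
    (forall A i j, i != j -> psi1 A != tzero -> psi1 (fl (fl A i) j) != tzero ->
       psi1 (fl (fl A i) j) ⋅ psi2 A = psi1 A ⋅ psi2 (fl (fl A i) j)) ->
  exists2 c, c != tzero & forall A, psi1 A = c ⋅ psi2 A.
Proof.
move=> ed e0 ee; have [A0 bA0] := ed.1.
pose r A := psi1 A ⋅ tinv (psi2 A).
have bA2 A : psi1 A != tzero -> psi2 A != tzero by rewrite e0.
exists (r A0); first by rewrite tmul_neq0 bA0 tinv_neq0 // bA2.
move=> A; have [bA|] := boolP (psi1 A != tzero); last first.
  by rewrite negbK => /eqP z; move: (e0 A); rewrite z eqxx => /esym/eqP ->; rewrite tmulr0.
have -> : r A0 = r A; last by rewrite /r tdivK // bA2.
apply: (even_delta_const ed) => // B i j ij bB bij; rewrite /r.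
apply: (tmulI (bA2 _ bB)); apply: (tmulI (bA2 _ bij)).
transitivity ((psi1 (fl (fl B i) j) ⋅ psi2 B) ⋅ (tinv (psi2 (fl (fl B i) j)) ⋅ psi2 (fl
  (fl B i) j))).
  by tmonom.
rewrite tmulVl ?bA2 // tmulr1 ee //.
transitivity ((psi1 B ⋅ psi2 (fl (fl B i) j)) ⋅ (tinv (psi2 B) ⋅ psi2 B)); last by tmonom.
by rewrite tmulVl ?bA2 // tmulr1.
Qed.

(** Dividing [gp2] by [gp] gives the edge ratios of a Wick function, and there the unit [c] cancels.
    Equal edge ratios determine the function up to a unit. *)
Lemma rGP_of_wick_inj psi1 psi2 phi1 phi2 c :
    weak_wick psi1 -> weak_wick psi2 -> rGP_of_wick psi1 phi1 -> rGP_of_wick psi2 phi2 ->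
    c != tzero -> phi1 = scale c phi2 ->
  exists2 d, d != tzero & psi1 = scale d psi2.
Proof.
move=> w1 w2 r1 r2 c0 e12.
have [s [hs _]] := wick_parity w1; have [_ a1 b1] := rGP_of_wick_parity w1 r1 hs.
have e0 A : (wk psi1 A == tzero) = (wk psi2 A == tzero).
  have := a1 A; rewrite e12 gp_scale.
  have [t [ht _]] := wick_parity w2; have [_ -> _] := rGP_of_wick_parity w2 r2 ht.
  move/(congr1 (fun x => x == tzero)); by rewrite !tmul_eq0 !orbb (negbTE c0) /= => ->.
have hs2 A : wk psi2 A != tzero -> par A = s by rewrite -e0; apply: hs.
have [_ a2 b2] := rGP_of_wick_parity w2 r2 hs2.
have /weak_wickP[ed _] := w1.
have [|d d0 hd] := @wick_ratio (wk psi1) (wk psi2) ed e0; last first.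
  by exists d => //; apply: wk_inj => A; rewrite wk_scale.
move=> A i j ij bA bij.
have ea := a1 A; have eb := b1 A i j (hs _ bA) ij.
rewrite e12 gp_scale a2 in ea; rewrite e12 gp2_scale b2 ?hs // in eb.
have bA2 : wk psi2 A != tzero by rewrite -e0.
apply: (tmulI bA2); apply: (tmulI bA); apply: (tmulI c0).
transitivity (c ⋅ (wk psi2 A ⋅ wk psi2 A) ⋅ (wk psi1 A ⋅ wk psi1 (fl (fl A i) j)));
  first by tmonom.
by rewrite ea -eb; tmonom.
Qed.

End WickToGP.

(** * From Grassmann-Plücker functions to Wick functions *)

Section GPToWick.
Variables (F : tract) (n : nat) (phi : gpfun F n) (wphi : weak_rGP phi).
Implicit Types (A B : {set 'I_n}) (i j k l p q : 'I_n).

Lemma gp2_fl2 A i j : i != j -> gp2 phi (fl (fl A i) j) i j = gp2 phi A i j.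
Proof. by move=> ij; rewrite /gp2 eps_fl2 // aset_flj aset_fli. Qed.

Variables (s : bool) (gp0 : forall A, par A = ~~ s -> gp phi A = tzero).
Hypothesis gp2C : forall A i j, par A = s -> i != j -> gp2 phi A i j = gp2 phi A j i.

Let rel A B p q : par A = ~~ s -> par B = ~~ s -> p \in dset A B ->
  dist A B + ((q \notin dset A B) || (p == q)) <= 4 -> gp_rel phi A B p q.
Proof.
move=> pA pB pD le4; apply/gp_relP; rewrite ?gp0 //; have [_ h _] := wphi.
apply: h; rewrite ?hyper_hyper ?hypo_hypo //.
exact: leq_trans (card_hyper_hypo _ pD) le4.
Qed.

Lemma dset2 A i j : i != j -> forall k, (k \in dset A (fl (fl A i) j)) = (k \in [:: i; j]).
Proof.
move=> ij k; rewrite in_dset !in_fl !inE -addbA addKb.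
by have [->|_] := eqVneq k i; rewrite ?(negbTE ij).
Qed.

(** At distance two the relation has two terms of opposite sign, hence is an equality of products.
    The bound four leaves room for an arbitrary [q]. *)
Let rel2 A i j p q : par A = ~~ s -> i != j -> p \in [:: i; j] ->
  let B := fl (fl A i) j in
  gp_hyper phi A p i ⋅ gp_hypo phi B q i = gp_hyper phi A p j ⋅ gp_hypo phi B q j.
Proof.
move=> pA ij pij B; have D := @dset2 A i j ij.
have dAB : dist A B = 2.
  by rewrite /dist (eq_card (D : dset A B =i _)) (card_uniqP _) //= inE ij.
have := @rel A B p q pA; rewrite !par_fl negbK pA D pij => /(_ erefl isT).
rewrite dAB => h; have {h} : gp_rel phi A B p q by apply: h; case: (_ || _).
rewrite /gp_rel (@tnull_dset _ _ _ _ [:: i; j]) //=; last by rewrite inE ij.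
apply: tnull_sg2_inv; rewrite !sigma_fl !ltnn.
by have := ltn_addb ij; case: (_ < _) (_ < _) (sigma _ _) (sigma _ _) => [] [] [] [].
Qed.

(** The two-term relation for [fl A j] and [fl A i], with [p] and [q] both [j]. It makes an
    almost-transversal lie in the support exactly when both neighbouring transversals do. *)
Lemma gp2_sqr A i j : par A = s -> i != j ->
  gp2 phi A i j ⋅ gp2 phi A i j = gp phi A ⋅ gp phi (fl (fl A i) j).
Proof.
move=> pA ij; have ji : j != i by rewrite eq_sym.
have pAj : par (fl A j) = ~~ s by rewrite par_fl pA.
have := @rel2 (fl A j) i j j j pAj ij; rewrite !inE eqxx orbT => /(_ isT).
rewrite /gp_hyper /gp_hypo !eqxx (negbTE ij) !flK.
have -> : fl (fl A j) i = fl (fl A i) j by apply: flC.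
by rewrite -(gp2C _ ij) ?par_fl ?pA ?negbK // gp2_fl2.
Qed.

Let par2 A i j : par (fl (fl A i) j) = par A.
Proof. by rewrite !par_fl negbK. Qed.

Lemma gp2_supp A i j : par A = s -> i != j ->
  (gp2 phi A i j != tzero) = (gp phi A != tzero) && (gp phi (fl (fl A i) j) != tzero).
Proof. by move=> pA ij; rewrite -tmul_neq0 -gp2_sqr // tmul_neq0 andbb. Qed.

(** The two-term relation with [p] equal to [i] and [q] equal to [k], outside the difference.
    Divided by values of [gp] it is the triangle condition on edge labels. *)
Lemma gp2_triangle A i j k : par A = s -> uniq [:: i; j; k] ->
  gp phi (fl (fl A i) j) ⋅ gp2 phi A i k = gp2 phi A i j ⋅ gp2 phi (fl (fl A i) j) j k.
Proof.
move=> pA; rewrite /= !inE negb_or => /and3P[/andP[ij ik] jk _].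
have [ji ki kj] : [/\ j != i, k != i & k != j] by rewrite !(eq_sym _ i) (eq_sym k).
have pAj : par (fl A j) = ~~ s by rewrite par_fl pA.
have := @rel2 (fl A j) i j i k pAj ij; rewrite !inE eqxx => /(_ isT).
rewrite /gp_hyper /gp_hypo !eqxx (negbTE ik) (negbTE jk) (negbTE ji).
have -> : fl (fl A j) i = fl (fl A i) j by apply: flC.
have -> : fl (fl (fl (fl A i) j) j) k = fl (fl A i) k by rewrite flK.
rewrite -(gp2C _ ik) ?par2 // gp2_fl2 // => ->.
rewrite -(gp2C _ ij) ?par2 // gp2_fl2 //; congr (_ ⋅ _).
rewrite -(gp2C _ jk) ?par2 // -[LHS](gp2_fl2 _ jk); congr (gp2 _ _ _ _).
by flips.
Qed.

(** The four-term relation for [fl A i] and [B], with [p] equal to [i] and [q] equal to [j], is cut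
    to two terms: the summands at [k] and [l] contain [gp2 phi A k i] and [gp2 phi A l i], which
    vanish with the two given values of [gp]. *)
Lemma gp2_square A i j k l : par A = s -> uniq [:: i; j; k; l] ->
    gp phi (fl (fl A i) k) = tzero -> gp phi (fl (fl A i) l) = tzero ->
  let e := (k < i) (+) (l < i) (+) (k < j) (+) (l < j) in
  gp phi A ⋅ gp2 phi (fl (fl A k) l) i j = sg F e ⋅ (gp2 phi A i j ⋅ gp phi (fl (fl A k)
    l)).
Proof.
move=> pA u Aik Ail e; have := u; rewrite /= !inE !negb_or.
case/and3P => /and3P[ij ik il] /andP[jk jl] /andP[kl _].
have [ji ki li] : [/\ j != i, k != i & l != i] by rewrite !(eq_sym _ i).
have pT : par (fl A i) = ~~ s by rewrite par_fl pA.
have D := in_dset4 (fl A i) u; set B := fl (fl (fl (fl (fl A i) i) j) k) l in D.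
have dAB : dist (fl A i) B = 4.
  by rewrite /dist (eq_card (D : dset _ B =i _)) (card_uniqP _).
have := @rel (fl A i) B i j pT; rewrite /B !par_fl !negbK -/B pA !D !inE !eqxx orbT =>
  /(_ erefl isT).
rewrite dAB (negbTE ij) => /(_ isT).
rewrite /gp_rel (tnull_dset _ u) //= /gp_hyper /gp_hypo !eqxx (negbTE ji) (negbTE ki)
  (negbTE li) flK.
have zero x : x != i -> gp phi (fl (fl A i) x) = tzero -> gp2 phi A x i = tzero.
  move=> xi z; apply/eqP; apply: contraT; rewrite gp2_supp // => /andP[_].
  by rewrite flC z eqxx.
rewrite (zero k) // (zero l) // !tmul0 !tmulr0.
have -> : fl B j = fl (fl A k) l by rewrite /B; flips.
rewrite (negbTE ij) -(gp2C _ ij) ?par2 // -(gp2C _ ij) //.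
move/(@tnull_catr0 F 2 [:: _; _])/tnull2; rewrite tneg1E sgMA => E.
apply: (tmulI (sg_neq0 F (true (+) (sigma (fl A i) i (+) sigma B i)))).
rewrite -E sgMA; congr (sg F _ ⋅ _); rewrite /B /e !sigma_fl !ltnn (ltn_addb ij).
case: (i < j); case: (k < i); case: (l < i); case: (k < j); case: (l < j);
  case: (sigma A i); by case: (sigma A j).
Qed.

Hypothesis gp_base : exists A, gp phi A != tzero.

Lemma gp_par A : gp phi A != tzero -> par A = s.
Proof.
move=> bA; apply/eqP; apply: contraNT bA => ne; apply/eqP/gp0.
by case: (par A) s ne => [] [].
Qed.

(** In an antisymmetric matroid valid choices never come alone. For the hyper-transversal over [A]
    and the hypo-transversal under [B] at index [i], the choice [i] is valid since [A] and [B] are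
    bases; any other valid choice is a partner [j]. *)
Lemma gp_even_delta : even_delta (fun A => gp phi A != tzero).
Proof.
split=> // A B i bA bB iAB; have [[[_ _ ex _] _] _ _] := wphi.
have pA : par (fl A i) = ~~ s by rewrite par_fl gp_par.
have pB : par (fl B i) = ~~ s by rewrite par_fl gp_par.
have := ex _ _ (hyper_hyper (fl A i) i) (hypo_hypo (fl B i) i).
rewrite card_exchange ?gp0 //; set X := [set _ in _ | _].
have iX : i \in X.
  by rewrite inE /gp_hyper /gp_hypo eqxx !flK bA bB in_dset !in_fl eqxx addbACA addbb
    addbF iAB.
rewrite (cardsD1 i) iX => X1; have : #|X :\ i| != 0 by apply/eqP => e; apply: X1; rewrite e.
rewrite cards_eq0 => /set0Pn[j]; rewrite in_setD1 inE in_dset !in_fl => /andP[ji].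
have ij : i != j by rewrite eq_sym.
rewrite (negbTE ji) !addbF /gp_hyper /gp_hypo (negbTE ji) !flK => /and3P[jD h1 h2].
exists j; split=> //.
  by move: h1; rewrite gp2_supp ?gp_par // flC => /andP[].
by move: h2; rewrite gp2_supp ?gp_par // => /andP[].
Qed.

Lemma gp_potential : exists2 psi : wickfun F n, weak_wick psi &
  exists phi0 c, [/\ c != tzero, rGP_of_wick psi phi0 & phi = scale c phi0].
Proof.
pose g A i j := gp2 phi A i j ⋅ tinv (gp phi A).
have ed := gp_even_delta.
have supp A i j : i != j -> gp phi A != tzero -> gp phi (fl (fl A i) j) != tzero ->
    gp2 phi A i j != tzero.
  by move=> ij bA bij; rewrite gp2_supp ?gp_par // bA.
have [] := @integrate n _ ed F g.
- by move=> A i j ij bA bij; rewrite tmul_neq0 supp // tinv_neq0.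
- by move=> A i j ij bA bij; rewrite /g gp2C // gp_par.
- move=> A i j ij bA bij; rewrite /g gp2_fl2 //.
  transitivity ((gp2 phi A i j ⋅ gp2 phi A i j) ⋅ (tinv (gp phi A) ⋅ tinv (gp phi (fl (fl
    A i) j)))).
    by tmonom.
  rewrite gp2_sqr ?gp_par //.
  transitivity ((tinv (gp phi A) ⋅ gp phi A) ⋅ (tinv (gp phi (fl (fl A i) j)) ⋅ gp phi
    (fl (fl A i) j))).
    by tmonom.
  by rewrite !tmulVl // tmul1.
- move=> A i j k u bA bij bik; rewrite /g; apply: (tmulI bij).
  rewrite [RHS]tmulA gp2_triangle ?gp_par //.
  transitivity ((gp2 phi A i j ⋅ gp2 phi (fl (fl A i) j) j k ⋅ tinv (gp phi A)) ⋅
     (tinv (gp phi (fl (fl A i) j)) ⋅ gp phi (fl (fl A i) j))); first by tmonom.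
  by rewrite tmulVl // tmulr1.
- move=> A i j k l u bA bij bkl bijkl; rewrite !negbK => /eqP zik /eqP zil /eqP zjk /eqP
  zjl.
  have u' : uniq [:: k; l; i; j].
    by move: u; rewrite -[[:: i; j; k; l]]/([:: i; j] ++ [:: k; l]) uniq_catC.
  have := gp2_square (gp_par bA) u zik zil; have := @gp2_square A k l i j (gp_par bA) u'.
  rewrite (flC A k i) (flC A k j) => /(_ zik zjk) E2 E1.
  have := u; rewrite /= !inE !negb_or => /and4P[/and3P[ij ik il] /andP[jk jl] kl _].
  have gE a b c d : gp phi A != tzero -> gp phi (fl (fl A c) d) != tzero -> forall e,
     gp phi A ⋅ gp2 phi (fl (fl A c) d) a b = sg F e ⋅ (gp2 phi A a b ⋅ gp phi (fl (fl A
       c) d)) ->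
     g (fl (fl A c) d) a b = sg F e ⋅ g A a b.
    move=> b1 b2 e E; apply: (tmulI b1); apply: (tmulI b2); rewrite /g.
    transitivity ((gp phi A ⋅ gp2 phi (fl (fl A c) d) a b) ⋅ (tinv (gp phi (fl (fl A c)
      d)) ⋅ gp phi (fl (fl A c) d))).
      by tmonom.
    rewrite tmulVl // tmulr1 E.
    transitivity (sg F e ⋅ (gp2 phi A a b ⋅ gp phi (fl (fl A c) d)) ⋅ (tinv (gp phi A) ⋅
      gp phi A)).
      by rewrite tmulVl // tmulr1.
    by tmonom.
  rewrite (gE _ _ _ _ bA bkl _ E1) (gE _ _ _ _ bA bij _ E2) [RHS]tmulCA [LHS]tmulCA.
  rewrite (tmulC (g A k l)); congr (sg F _ ⋅ _).
  rewrite (ltn_addb ik) (ltn_addb il) (ltn_addb jk) (ltn_addb jl).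
  by case: (i < k); case: (i < l); case: (j < k); case: (j < l).
move=> w [w0 wE].
have w0' A : (gp phi A == tzero) = (w A == tzero) by apply: negb_inj; rewrite w0.
have wE' A i j : i != j -> gp phi A != tzero -> gp phi (fl (fl A i) j) != tzero ->
    w (fl (fl A i) j) ⋅ gp phi A = w A ⋅ gp2 phi A i j.
  by move=> ij bA bij; rewrite wE // /g tmulA tdivK.
(* By [gp2_sqr], along an edge [gp] changes by the square of the ratio by which [w] changes, so [gp]
   is the square of [w] up to one unit. *)
have [c c0 cE] : exists2 c, c != tzero & forall A, gp phi A = c ⋅ (w A ⋅ w A).
  apply: wick_ratio => // [A|A i j ij bA bij]; first by rewrite tmul_eq0 orbb.
  apply: (tmulI bA).
  transitivity ((gp phi A ⋅ gp phi (fl (fl A i) j)) ⋅ (w A ⋅ w A)); first by tmonom.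
  rewrite -gp2_sqr ?gp_par //.
  transitivity ((w A ⋅ gp2 phi A i j) ⋅ (w A ⋅ gp2 phi A i j)); first by tmonom.
  by rewrite -wE' //; tmonom.
have wk2 A i j : par A = s -> i != j -> gp2 phi A i j = c ⋅ (w A ⋅ w (fl (fl A i) j)).
  move=> pA ij; have [|] := boolP ((gp phi A != tzero) && (gp phi (fl (fl A i) j) !=
    tzero)).
    move=> /andP[bA bij]; have wA : w A != tzero by rewrite w0.
    by apply: (tmulI wA); rewrite -wE' // cE; tmonom.
  rewrite -gp2_supp // negbK => /eqP z.
  have := gp2_supp pA ij; rewrite z eqxx -!w0 -tmul_neq0 => /esym/negbFE/eqP ->.
  by rewrite tmulr0.
have [|phi0 [e1 e2]] := @gp_exists F n s (fun A => w A ⋅ w A) (fun A i j => w A ⋅ w (fl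
  (fl A i) j)).
  by move=> A i j _ _; rewrite flJ flK tmulC.
have wkE : wk (mkwick w) = w by apply: funext => A; apply: wk_mkwick.
have phiE : phi = scale c phi0.
  apply: (@gp_inj F n s) => [A|A i j pA ij]; first by rewrite gp_scale e1.
  by rewrite gp2_scale e2 // wk2.
have z A : par A = ~~ s -> w A = tzero by move=> pA; apply/eqP; rewrite -w0' gp0.
have e1' A : gp phi0 A = wk (mkwick w) A ⋅ wk (mkwick w) A by rewrite wkE.
have e2' A i j : par A = s -> i != j -> gp2 phi0 A i j = wk (mkwick w) A ⋅ wk (mkwick w)
  (fl (fl A i) j).
  by move=> *; rewrite wkE e2.
exists (mkwick w); last first.
  by exists phi0, c; split=> //; apply/rGP_of_wickP; exists s; split=> //; rewrite wkE.
apply/weak_wickP; rewrite wkE; split.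
  by have -> : (fun A => w A != tzero) = (fun A => gp phi A != tzero) by apply: funext =>
    A; rewrite w0.
move=> A B dAB; have pAB : par A = par B.
  by have := odd_dist A B; rewrite dAB; case: (par A); case: (par B).
have allz : (forall i, i \in dset A B -> wick_term w A B i = tzero) -> wick_rel w A B.
  move=> h; apply: (iffRL (@tnull_zeros _ _ _ _ [::] _ _ _)) => // [i iD _|];
    first exact: h.
  exact: tnull_nil.
(* In the first case each [fl A i] has the other parity, where [w] vanishes. *)
have [pA|pA] := boolP (par A == s).
  by apply: allz => i _; rewrite /wick_term z ?par_fl ?(eqP pA) // tmul0 tmulr0.
have {}pA : par A = ~~ s by case: (par A) s pA => [] [].
have [[i iD]|ni] := pselect (exists2 i, i \in dset A B & wick_term w A B i != tzero);
  last first.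
  by apply: allz => i iD; apply/eqP; apply: contraT => ne; case: ni; exists i.
rewrite /wick_term !tmul_neq0 sg_neq0 /= !w0 => /andP[bAi bBi].
(* With [p] and [q] both [i] the sum would run over five elements, beyond the bound. The partner [j]
   is a second index of the difference with [w (fl B j)] nonzero, which makes the factor [C] a
   unit. *)
have [] := ed.2 _ _ i bAi bBi; first by rewrite !in_fl eqxx addbACA addbb addbF -in_dset.
move=> j [ji]; rewrite !flK !in_fl (negbTE ji) !addbF -in_dset => jD _ bBj.
have ij : i != j by rewrite eq_sym.
have : gp_rel phi A B i j.
  by apply: rel; rewrite // -?pAB // dAB jD (negbTE ij).
pose C := c ⋅ c ⋅ (w (fl A i) ⋅ w (fl B j)).
have C0 : C != tzero by rewrite !tmul_neq0 c0 !w0 bAi bBj.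
have e k : sg F (sigma A k (+) sigma B k) ⋅ (gp_hyper phi A i k ⋅ gp_hypo phi B j k) =
      C ⋅ wick_term w A B k.
  have -> : gp_hyper phi A i k = c ⋅ gp_hyper phi0 A i k.
    by rewrite phiE /gp_hyper; case: ifP => _; rewrite ?gp_scale ?gp2_scale.
  have -> : gp_hypo phi B j k = c ⋅ gp_hypo phi0 B j k.
    by rewrite phiE /gp_hypo; case: ifP => _; rewrite ?gp_scale ?gp2_scale.
  rewrite (gp_hyperE _ _ e1' e2') // (gp_hypoE _ _ e1' e2') -?pAB // wkE /C /wick_term.
  by tmonom.
by rewrite /gp_rel /image_mem (eq_map e) (map_comp (tmul C)) => /(tnull_scaleE _ C0).
Qed.

End GPToWick.

Section GPSurjective.
Variables (F : tract) (n : nat).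

Lemma weak_rGP_wick (phi : gpfun F n) : weak_rGP phi ->
  exists2 psi : wickfun F n, weak_wick psi &
  exists phi0 c, [/\ c != tzero, rGP_of_wick psi phi0 & phi = scale c phi0].
Proof.
move=> wphi; have [[[ne sub ex _] _] _ [s [z1 z2]]] := wphi.
have gp0 A : par A = ~~ s -> gp phi A = tzero by move=> pA; apply: z1; rewrite tr_par pA.
have gp2C A i j : par A = s -> i != j -> gp2 phi A i j = gp2 phi A j i.
  by move=> pA ij; apply/rGP4P/z2; rewrite // tr_par pA.
apply: (gp_potential wphi gp0 gp2C).
have [S] := set0Pn _ ne; rewrite in_fsupport in_setU => /andP[/orP[/transversal_tr[A ->]|]].
  by exists A.
(* Here only an almost-transversal is known to be in the support; [gp2_supp] supplies a
   transversal. *)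
case/(almostP s) => A [i [j [pA ij ->]]] => a0.
have : gp2 phi A i j != tzero by rewrite /gp2 tmul_neq0 sg_neq0.
by rewrite (gp2_supp wphi gp0 gp2C) // => /andP[bA _]; exists A.
Qed.

End GPSurjective.

(** * Circuits *)

Section Circuits.
Variables (n : nat) (Bs : {set {set ground n}}).
Implicit Types (A B T U : {set 'I_n}) (i j k : 'I_n) (x y e : ground n) (D : {set ground
  n}).

Definition basis A := tr A \in Bs.

Definition dependent D := subtransversal D && [forall B in Bs, ~~ (D \subset B)].

(* For a transversal tr T that becomes a basis by exchanging one element, this
   is the unique circuit contained in it; otherwise it is empty. *)
Definition circ T : {set ground n} := [set x in tr T | basis (fl T x.1)].

Lemma in_circ T x : (x \in circ T) = (x \in tr T) && basis (fl T x.1).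
Proof. by rewrite inE. Qed.

Lemma el_circ T i : (el T i \in circ T) = basis (fl T i).
Proof. by rewrite in_circ el_tr. Qed.

Lemma circ_sub T : circ T \subset tr T.
Proof. by apply/subsetP => x; rewrite in_circ => /andP[]. Qed.

Lemma circ_neq0 T i : basis (fl T i) -> circ T != set0.
Proof. by move=> b; apply/set0Pn; exists (el T i); rewrite el_circ. Qed.

Lemma circ_neq0P T : circ T != set0 -> exists2 i, basis (fl T i) & el T i \in circ T.
Proof.
case/set0Pn => x xC; exists x.1; first by move: xC; rewrite in_circ => /andP[].
by rewrite -trE // (subsetP (circ_sub T)).
Qed.

Lemma subtransversalP D : reflect (exists A, D \subset tr A) (subtransversal D).
Proof.
apply: (iffP existsP) => [[T /andP[/transversal_tr[A ->]]]|[A DA]]; first by exists A.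
by exists (tr A); rewrite tr_transversal.
Qed.

Hypotheses (sB : Bs \subset transversals n) (ed : even_delta basis).

Lemma dependentP D : reflect ((exists A, D \subset tr A) /\ forall A, basis A -> ~~ (D
  \subset tr A))
  (dependent D).
Proof.
apply: (iffP andP) => [[/subtransversalP h1 /forallP h2]|[/subtransversalP h1 h2]];
  split=> //.
  by move=> A bA; have := h2 (tr A); rewrite (bA : tr A \in Bs).
apply/forallP => S; apply/implyP => SB; have [A e] := transversal_tr (subsetP sB _ SB).
by rewrite e h2 // /basis -e.
Qed.

(** Suppose a basis [B] contains the set. It agrees with [T] at an index [i] of the set, so
    exchanging [i] between [fl T i] and [B] gives an index [j] where [T] and [B] differ and [fl T j]
    is a basis. Then [el T j] is in the set but not in [tr B]. *)
Lemma circ_dependent T : circ T != set0 -> dependent (circ T).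
Proof.
case/circ_neq0P => i bi iC; apply/dependentP; split; first by exists T; apply: circ_sub.
move=> B bB; apply/negP => sub.
have iB : (i \in T) = (i \in B).
  have := subsetP sub _ iC; rewrite in_tr /el /=.
  by case: (i \in T); case: (i \in B).
have [] := ed.2 _ _ i bi bB; first by rewrite in_fl eqxx iB; case: (i \in B).
move=> j [ji]; rewrite in_fl (negbTE ji) addbF flK => jT bj _.
have : el T j \in circ T by rewrite el_circ.
by move/(subsetP sub); rewrite in_tr /el /=; case: (j \in T) (j \in B) jT => [] [].
Qed.

(** If [D] missed an element of the set, flipping its index in [T] would give a basis still
    containing [D]. *)
Lemma circ_min T D : D \subset tr T -> dependent D -> circ T \subset D.
Proof.
move=> DT /dependentP[_ dep]; apply/subsetP => y; rewrite in_circ => /andP[yT by_].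
apply: contraT => yD; move: (dep _ by_); case/negP; apply/subsetP => x xD.
have xT := subsetP DT _ xD; rewrite in_tr_fl xT /=.
apply: contraNneq yD => e; by rewrite (trE yT) -e -trE.
Qed.

Lemma circuit_dependent D : circuit Bs D -> dependent D.
Proof. by case/minsetP. Qed.

Lemma circuit_circ T : circ T != set0 -> circuit Bs (circ T).
Proof.
move=> T0; apply/minsetP; split; first exact: circ_dependent.
move=> D dD sub; apply/eqP; rewrite eqEsubset sub /=; apply: circ_min => //.
exact: subset_trans sub (circ_sub T).
Qed.

Lemma circuit_eq T D : circuit Bs D -> D \subset tr T -> circ T != set0 -> D = circ T.
Proof.
move=> /minsetP[dD minD] DT T0; apply/esym/minD; first exact: circ_dependent.
exact: circ_min.
Qed.

(** By minimality a circuit without one element [x] lies in a basis [A], which cannot contain [x].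
    The circuit thus lies in the transversal obtained from [A] by flipping the index of [x]. *)
Lemma circuitP D : circuit Bs D <-> exists2 T, circ T != set0 & D = circ T.
Proof.
split=> [cD|[T T0 ->]]; last exact: circuit_circ.
have /dependentP[[A0 DA0] dep] := circuit_dependent cD.
have [B0 bB0] := ed.1.
have /set0Pn[x xD] : D != set0.
  by apply/negP => /eqP e; have := dep _ bB0; rewrite e sub0set.
have [|ndep] := boolP (dependent (D :\ x)).
  move=> dx; have /minsetP[_ /(_ _ dx (subD1set _ _)) e] := cD.
  by move: xD; rewrite -e !inE eqxx.
have [A bA DA] : exists2 A, basis A & D :\ x \subset tr A.
  move: ndep; rewrite negb_and => /orP[|].
    by case/subtransversalP; exists A0; apply: subset_trans (subD1set _ _) DA0.
  rewrite negb_forall => /existsP[S]; rewrite negb_imply negbK => /andP[SB sS].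
  have [A e] := transversal_tr (subsetP sB _ SB); exists A; by rewrite /basis -e.
have xA : x \notin tr A.
  apply: contra (dep _ bA) => xA; apply/subsetP => y yD.
  by have [->//|yx] := eqVneq y x; apply: (subsetP DA); rewrite in_setD1 yx.
exists (fl A x.1); first by apply: (@circ_neq0 _ x.1); rewrite flK.
apply: circuit_eq => //; last by apply: (@circ_neq0 _ x.1); rewrite flK.
apply/subsetP => y yD; rewrite in_tr_fl.
have [->|yx] := eqVneq y x; first by rewrite (negbTE xA) eqxx.
rewrite (subsetP DA) ?in_setD1 ?yx //=; apply: contraNneq yx => e.
by rewrite (trE (subsetP DA0 _ yD)) e -trE // (subsetP DA0).
Qed.

Lemma fundamental_circuitP B e D :
  fundamental_circuit Bs (tr B) e D <-> [/\ basis B, e \notin tr B & D = circ (fl B e.1)].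
Proof.
have eS : (e \in star @: tr B) = (e \notin tr B).
  rewrite -star_tr; apply/imsetP/idP => [[x xB ->]|eB]; first by rewrite starK.
  by exists (star e); rewrite ?starK.
rewrite /fundamental_circuit eS symdiff_tr; split=> [[bB eB cD DB]|[bB eB ->]].
  by split=> //; apply: circuit_eq => //; apply: (@circ_neq0 _ e.1); rewrite flK.
split=> //; last exact: circ_sub.
by apply: circuit_circ; apply: (@circ_neq0 _ e.1); rewrite flK.
Qed.

(** If [fl (fl B i) j] is a basis, the circuits contain [el B j] and its star respectively;
    otherwise both lie in the transversal of that set. The kind of a modular pair is thus a question
    about one basis. *)
Lemma subtransversal_circ B i j : i != j -> basis B ->
  subtransversal (circ (fl B i) :|: circ (fl B j)) = ~~ basis (fl (fl B i) j).
Proof.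
move=> ij bB; have ji : j != i by rewrite eq_sym.
apply/subtransversalP/idP => [[A /subsetP sub]|nb].
  apply/negP => b; have := sub (el (fl B i) j); rewrite in_setU el_circ b => /(_ isT) h1.
  have := sub (el (fl B j) j); rewrite in_setU [X in _ || X]el_circ flK bB orbT => /(_ isT).
  by rewrite -star_el star_tr -(el_fl B ij) h1.
exists (fl (fl B i) j); apply/subsetP => x; rewrite in_setU in_tr_fl => /orP[].
  rewrite in_circ => /andP[-> b] /=; apply: contraNneq nb => <-; exact: b.
rewrite in_circ => /andP[xT b]; move: xT; rewrite !in_tr_fl addbAC => ->.
by apply: contraNneq nb => <-; rewrite flC.
Qed.

Lemma basisP A : reflect (forall D, circuit Bs D -> ~~ (D \subset tr A)) (basis A).
Proof.
apply: (iffP idP) => [bA D /circuit_dependent/dependentP[_]|h]; first exact.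
apply: contraT => nb; have [|D cD DA] := @minset_exists _ dependent (tr A).
  apply/dependentP; split=> [|B bB]; first by exists A.
  apply: contra nb => /subsetP sub; rewrite (_ : A = B) //.
  apply/setP => i; have := sub _ (el_tr A i); rewrite in_tr /=.
  by case: (i \in A); case: (i \in B).
by have := h _ cD; rewrite DA.
Qed.

End Circuits.

(** * Vectors attached to a Wick function *)

Section WickVectors.
Variables (F : tract) (n : nat).
Implicit Types (A B T U : {set 'I_n}) (a b c d i j k : 'I_n) (x y g : ground n)
  (w : {set 'I_n} -> F).

Definition wvec w T : vect F n :=
  fun x => if x \in tr T then sg F (sigma T x.1) ⋅ w (fl T x.1) else tzero.

Lemma wvec_el w T i : wvec w T (el T i) = sg F (sigma T i) ⋅ w (fl T i).
Proof. by rewrite /wvec el_tr. Qed.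

Lemma wvec_el_fl w T i j : i != j ->
  wvec w (fl T i) (el T j) = sg F (sigma (fl T i) j) ⋅ w (fl (fl T i) j).
Proof. by move=> ij; rewrite -(el_fl _ ij) wvec_el. Qed.

Lemma wvec_off w T x : x \notin tr T -> wvec w T x = tzero.
Proof. by rewrite /wvec => /negbTE ->. Qed.

Lemma wick_vectorE (psi : wickfun F n) T : wick_vector psi (tr T) = wvec (wk psi) T.
Proof.
apply: funext => x; rewrite /wick_vector /wvec; case: ifP => // xT.
rewrite sgnE symdiff_tr odd_nlt; congr (sg F _ ⋅ _); apply: eq_xsum => k.
rewrite !in_setI !in_tr [(k, false) \in unstarred]inE [(k, true) \in unstarred]inE /=.
rewrite andbT andbF addbF /ground_lt /=; move: xT; rewrite in_tr.
by have [->|_] := eqVneq k x.1; rewrite ?orbF //; case: x.2; case: (_ \in T);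
  rewrite //= ?ltnn ?andbF ?orbF.
Qed.

Lemma vsupport_wvec (Bs : {set {set ground n}}) w T : (forall A, (w A != tzero) = basis
  Bs A) ->
  vsupport (wvec w T) = circ Bs T.
Proof.
move=> wB; apply/setP => x; rewrite inE in_circ /wvec; case: ifP => _; last by rewrite eqxx.
by rewrite tmul_neq0 sg_neq0 wB.
Qed.

(* Scaled to have a common coordinate pattern, the vectors of the transversals
   at distance 1 from B in directions b, c, d and the one at distance 3 sum to
   zero; at a coordinate a outside {b, c, d} this is the four-term Wick relation
   for B △ {b, c, d} and B △ {a}. *)
Definition four_term w B b c d g : seq F :=
  [:: sg F ((c < b) (+) (d < b)) ⋅ (w (fl (fl B c) d) ⋅ wvec w (fl B b) g);
      sg F ((b < c) (+) (d < c)) ⋅ (w (fl (fl B b) d) ⋅ wvec w (fl B c) g);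
      sg F ((b < d) (+) (c < d)) ⋅ (w (fl (fl B b) c) ⋅ wvec w (fl B d) g);
      sg F true ⋅ (w B ⋅ wvec w (fl (fl (fl B b) c) d) g)].

Lemma four_term_swap12 w B b c d g :
  tnull (four_term w B b c d g) <-> tnull (four_term w B c b d g).
Proof.
rewrite /four_term (flC B c b) (addbC (c < d)).
by apply/tnull_perm_iff; apply/permP => P /=; rewrite addnCA.
Qed.

Lemma four_term_swap23 w B b c d g :
  tnull (four_term w B b c d g) <-> tnull (four_term w B b d c g).
Proof.
rewrite /four_term (flC B d c) (flC (fl B b) d c) (addbC (d < b)).
by apply/tnull_perm_iff; apply/permP => P /=; congr (_ + _)%N; rewrite addnCA.
Qed.

Lemma four_term_wick w B b c d a : uniq [:: b; c; d; a] ->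
  tnull (four_term w B b c d (el B a)) <-> wick_rel w (fl (fl (fl B b) c) d) (fl B a).
Proof.
move=> u; have := u; rewrite /= !inE !negb_or.
case/and3P => /and3P[bc bd ba] /andP[cd ca] /andP[da _].
set U := fl (fl (fl B b) c) d.
have e : fl B a = fl (fl (fl (fl U b) c) d) a by rewrite /U; flips.
rewrite e wick_rel4 // -e.
rewrite -(tnull_scaleE _ (sg_neq0 F (~~ sigma B a))) /four_term /= !wvec_el_fl //.
have eU : el U a = el B a by rewrite /U !el_fl.
rewrite -eU wvec_el /wick_term.
have Ub : fl U b = fl (fl B c) d by rewrite /U; flips.
have Uc : fl U c = fl (fl B b) d by rewrite /U; flips.
have Ud : fl U d = fl (fl B b) c by rewrite /U; flips.
rewrite Ub Uc Ud flK -!(flC _ a) !(tmulCA (w _)) tneg1E !sgMA (tmulC (w B)).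
suff [-> -> -> ->] : [/\
  sigma U b (+) sigma (fl B a) b = ~~ sigma B a (+) ((c < b) (+) (d < b)) (+) sigma (fl B
    b) a,
  sigma U c (+) sigma (fl B a) c = ~~ sigma B a (+) ((b < c) (+) (d < c)) (+) sigma (fl B
    c) a,
  sigma U d (+) sigma (fl B a) d = ~~ sigma B a (+) ((b < d) (+) (c < d)) (+) sigma (fl B
    d) a &
  sigma U a (+) sigma (fl B a) a = ~~ sigma B a (+) true (+) sigma U a] by [].
rewrite /U !sigma_fl !ltnn (ltn_addb ba) (ltn_addb ca) (ltn_addb da).
rewrite (ltn_addb bc) (ltn_addb bd) (ltn_addb cd).
move: (sigma B a) (sigma B b) (sigma B c) (sigma B d) (b < a) (c < a) (d < a) (b < c) (b
  < d) (c < d).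
by move=> sa sb sc sd ab ac ad bc' bd' cd'; split; case: sa; case: sb; case: sc; case: sd;
  case: ab; case: ac; case: ad; case: bc'; case: bd'; case: cd'.
Qed.


End WickVectors.

(** * The four-term relation at every coordinate *)

Section FourTerm.
Variables (F : tract) (n : nat).
Implicit Types (A B T U : {set 'I_n}) (a b c d i j k : 'I_n) (x y g : ground n)
  (w : {set 'I_n} -> F).

Lemma in_tr_flN A i x : x.1 != i -> (x \in tr (fl A i)) = (x \in tr A).
Proof. by rewrite in_tr_fl => /negbTE ->; rewrite addbF. Qed.

Lemma trNE B x : x \notin tr B -> x = el (fl B x.1) x.1.
Proof. by move=> xB; apply: trE; rewrite in_tr_fl eqxx (negbTE xB). Qed.

Lemma four_term_off w B b c d g : g.1 != b -> g.1 != c -> g.1 != d -> g \notin tr B ->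
  tnull (four_term w B b c d g).
Proof.
move=> gb gc gd gB; rewrite /four_term !wvec_off ?in_tr_flN // !tmulr0.
by rewrite !tnull_cons0; apply: tnull_nil.
Qed.

(** At such a coordinate only two of the vectors can be nonzero, and their summands are the same
    product of two values of [w] with opposite signs. *)
Let four_term1 w B b c d g : uniq [:: b; c; d] -> g.1 = b -> tnull (four_term w B b c d g).
Proof.
rewrite /= !inE !negb_or => /and3P[/andP[bc bd] cd _] gb.
have [cb db] : c != b /\ d != b by rewrite !(eq_sym _ b).
have [gB|gB] := boolP (g \in tr B).
  have -> : g = el B b by rewrite (trE gB) gb.
  have nb A : (forall x, x.1 = b -> (x \in tr A) = (x \notin tr B)) -> el B b \notin tr A.
    by move=> ->; rewrite ?negbK ?el_tr.
  rewrite /four_term (wvec_el_fl w B cb) (wvec_el_fl w B db) !wvec_off; last first.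
  - by apply: nb => x xb; rewrite in_tr_fl xb eqxx addbT.
  - by apply: nb => x xb; rewrite !in_tr_fl xb eqxx (negbTE bc) (negbTE bd) !addbF addbT.
  rewrite !tmulr0 tnull_cons0; apply/(@tnull_catr0 F 1 [:: _; _]).
  rewrite !(tmulCA (w _)) !sgMA; apply: tnull_sg2;
    last by rewrite tmulC (flC B d) (flC B c).
  rewrite !sigma_fl (ltn_addb bc) (ltn_addb bd) (ltn_addb cd).
  by case: (b < c); case: (b < d); case: (c < d); case: (sigma B b).
have gE : g = el (fl B b) b by rewrite {1}(trNE gB) gb.
have z k : b != k -> wvec w (fl B k) g = tzero by move=> bk;
  rewrite wvec_off // in_tr_flN ?gb.
rewrite /four_term (z c) // (z d) // !tmulr0 gE wvec_el flK.
have -> : el (fl B b) b = el (fl (fl (fl B b) c) d) b by rewrite (el_fl _ db) (el_fl _ cb).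
rewrite wvec_el.
have -> : fl (fl (fl (fl B b) c) d) b = fl (fl B c) d by flips.
set t1 := sg _ _ ⋅ (_ ⋅ (_ ⋅ w B)); set t2 := sg _ _ ⋅ (w B ⋅ _).
suff : tnull [:: t1; t2].
  move/(@tnull_catr0 F 2 [:: _; _]); apply: tnull_perm; apply/permP => P /=.
  by congr (_ + _)%N; rewrite !addn0 addnC -addnA.
rewrite /t1 /t2 !(tmulCA (w _)) !sgMA; apply: tnull_sg2; last exact: tmulC.
by rewrite !sigma_fl ltnn; case: (c < b); case: (d < b); case: (sigma B b).
Qed.

Lemma four_term_bcd w B b c d g : uniq [:: b; c; d] -> g.1 \in [:: b; c; d] ->
  tnull (four_term w B b c d g).
Proof.
move=> u; have := u; rewrite /= !inE !negb_or => /and3P[/andP[bc bd] cd _].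
case/or3P => /eqP e; first exact: four_term1.
  by apply/four_term_swap12; apply: four_term1 => //; uniqs.
apply/four_term_swap23/four_term_swap12; apply: four_term1 => //.
by uniqs.
Qed.

Lemma four_term_null w B b c d : uniq [:: b; c; d] ->
    (forall A A', dist A A' = 4 -> wick_rel w A A') ->
  forall g, tnull (four_term w B b c d g).
Proof.
move=> u w4 g; have [?|] := boolP (g.1 \in [:: b; c; d]); first exact: four_term_bcd.
rewrite !inE !negb_or => /and3P[gb gc gd].
have [gB|] := boolP (g \in tr B); last exact: four_term_off.
have u4 : uniq [:: b; c; d; g.1].
  have := u; rewrite /= !inE !negb_or !(eq_sym _ g.1) gb gc gd.
  by case/and3P => /andP[-> ->] ->.
rewrite (trE gB) four_term_wick //; apply: w4.
have -> : fl B g.1 = fl (fl (fl (fl (fl (fl (fl B b) c) d) b) c) d) g.1 by flips.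
by rewrite /dist (eq_card (in_dset4 _ u4 : dset _ _ =i _)) (card_uniqP u4).
Qed.

End FourTerm.

(** * Proportionality and pairing of vectors *)

Section VectorPairs.
Variables (F : tract) (n : nat).
Implicit Types (A B T U : {set 'I_n}) (a b c d i j k : 'I_n) (x y g : ground n) (X Y :
  vect F n).

Definition proportional X Y := exists2 c : F, c != tzero & X = scale c Y.

Lemma proportional_sym X Y : proportional X Y -> proportional Y X.
Proof.
case=> c c0 ->; exists (tinv c); first exact: tinv_neq0.
by apply: funext => x; rewrite /scale tmulA tmulVl // tmul1.
Qed.

Lemma proportional_trans Y X Z : proportional X Y -> proportional Y Z -> proportional X Z.
Proof.
case=> c c0 -> [d d0 ->]; exists (c ⋅ d); first by rewrite tmul_neq0 c0.
by apply: funext => x; rewrite /scale tmulA.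
Qed.

Lemma in_vsupport X x : (x \in vsupport X) = (X x != tzero).
Proof. exact: in_set. Qed.

Lemma vsupport_scale (c : F) X : c != tzero -> vsupport (scale c X) = vsupport X.
Proof. by move=> c0; apply/setP => x; rewrite !in_vsupport /scale tmul_neq0 c0. Qed.

Lemma proportional_supp X Y : proportional X Y -> vsupport X = vsupport Y.
Proof. by case=> c c0 ->; apply: vsupport_scale. Qed.

Lemma proportional_of_ratios X Y x : X x != tzero -> vsupport X = vsupport Y ->
  (forall y, y \in vsupport X -> y != x -> X x ⋅ Y y = X y ⋅ Y x) -> proportional X Y.
Proof.
move=> xX sXY r; have xY : Y x != tzero by rewrite -in_vsupport -sXY in_vsupport.
exists (X x ⋅ tinv (Y x)); first by rewrite tmul_neq0 xX tinv_neq0.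
apply: funext => y; rewrite /scale; apply: (tmulI xY).
transitivity ((X x ⋅ Y y) ⋅ (tinv (Y x) ⋅ Y x)); last by tmonom.
rewrite tmulVl // tmulr1; have [->|yx] := eqVneq y x; first exact: tmulC.
have [yX|] := boolP (y \in vsupport X); first by rewrite r // tmulC.
move=> yX; have := yX; rewrite sXY in_vsupport negbK => /eqP ->.
by move: yX; rewrite in_vsupport negbK => /eqP ->; rewrite !tmulr0.
Qed.

(** If [x] is in the first transversal and [star x] in the second, then the index of [x] is [b] or
    [c]. Orthogonality of such vectors is therefore a two-term relation. *)
Lemma tnull_pairing B b c X Y : b != c ->
    (forall x, x \notin tr (fl B b) -> X x = tzero) ->
    (forall x, x \notin tr (fl B c) -> Y x = tzero) ->
  tnull [seq X x ⋅ Y (star x) | x : ground n] <->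
  tnull [:: X (el (fl B b) b) ⋅ Y (el B b); X (el B c) ⋅ Y (el (fl B c) c)].
Proof.
move=> bc X0 Y0; have cb : c != b by rewrite eq_sym.
rewrite (@tnull_zeros _ _ _ _ [:: el (fl B b) b; el B c]) /=.
- by rewrite star_el flK star_el.
- by rewrite inE xpair_eqE (negbTE bc).
- by [].
move=> x _; rewrite !inE negb_or => /andP[xb xc].
have [xBb|/X0->] := boolP (x \in tr (fl B b)); last by rewrite tmul0.
have [sx|/Y0->] := boolP (star x \in tr (fl B c)); last by rewrite tmulr0.
move: sx; rewrite star_tr => sx.
have x1b : x.1 != b by apply: contraNneq xb => e; rewrite (trE xBb) e.
have xB : x \in tr B by rewrite in_tr_flN in xBb.
move: sx; rewrite in_tr_fl xB /= negbK => /eqP e.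
by move: xc; rewrite (trE xB) e eqxx.
Qed.

End VectorPairs.

(** * One vector per circuit, up to units *)

Section WickToCircuits.
Variables (F : tract) (n : nat) (psi : wickfun F n) (wpsi : weak_wick psi).
Implicit Types (A B T U : {set 'I_n}) (a b c d i j k : 'I_n) (x y g : ground n) (X Y :
  vect F n).

Let w := wk psi.
Let Bs := fsupport psi.
Let w4 : forall A B, dist A B = 4 -> wick_rel w A B.
Proof. by have /weak_wickP[] := wpsi. Qed.

Let wB A : (w A != tzero) = basis Bs A.
Proof. by rewrite /basis in_fsupport_tr. Qed.

Let sB : Bs \subset transversals n.
Proof. by apply/subsetP => S; rewrite in_fsupport => /andP[]. Qed.

Let ed : even_delta (basis Bs).
Proof.
have /weak_wickP[h _] := wpsi.
by rewrite (_ : basis Bs = fun A => wk psi A != tzero) //; apply: funext => A; rewrite -wB.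
Qed.

Lemma wvec_circ T : vsupport (wvec w T) = circ Bs T.
Proof. exact: vsupport_wvec. Qed.

(** Let [a] and [b] be indices of the circuit. In the four-term relation for [T] and its flip at
    [a], [b], [i], [j] the summands at [i] and [j] vanish, since [fl T i] and [fl T j] are no bases;
    the other two compare the coordinates at [a] and [b]. *)
Let adjacent T i j : i != j -> circ Bs T != set0 ->
  ~~ basis Bs (fl T i) -> ~~ basis Bs (fl T j) -> circ Bs (fl (fl T i) j) = circ Bs T ->
  proportional (wvec w T) (wvec w (fl (fl T i) j)).
Proof.
move=> ij /circ_neq0P[a ba aC] ni nj eC; set T1 := fl (fl T i) j in eC *.
have wz k : ~~ basis Bs (fl T k) -> w (fl T k) = tzero by rewrite -wB negbK => /eqP.
have nij k : basis Bs (fl T k) -> k != i /\ k != j.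
  by split; [apply: contraNneq ni => <-|apply: contraNneq nj => <-].
have elT1 k : k != i -> k != j -> el T1 k = el T k by move=> ki kj;
  rewrite /T1 !el_fl // eq_sym.
apply: (@proportional_of_ratios _ _ _ _ (el T a)).
- by rewrite -in_vsupport wvec_circ.
- by rewrite !wvec_circ eC.
move=> y; rewrite wvec_circ => yC; have yT := subsetP (circ_sub _ _) _ yC.
rewrite (trE yT); move: yC; rewrite {1}(trE yT) el_circ; set b := y.1 => bb ne.
have ab : a != b by apply: contraNneq ne => ->.
have [ai aj] := nij _ ba; have [bi bj] := nij _ bb.
rewrite -[in wvec w T1 (el T b)]elT1 // -[in wvec w T1 (el T a)]elT1 // !wvec_el.
have u : uniq [:: a; b; i; j] by uniqs.
pose T' := fl (fl (fl (fl T a) b) i) j.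
have : wick_rel w T T'.
  by apply: w4; rewrite /dist (eq_card (in_dset4 _ u : dset _ _ =i _)) (card_uniqP u).
rewrite wick_rel4 // /wick_term (wz _ ni) (wz _ nj) !tmul0 !tmulr0.
move/(@tnull_catr0 F 2 [:: _; _])/tnull2; rewrite tneg1E sgMA -/T'.
have -> : fl T' a = fl T1 b by rewrite /T' /T1; flips.
have -> : fl T' b = fl T1 a by rewrite /T' /T1; flips.
move=> E; set p := sigma T b (+) sigma T' b in E.
apply: (tmulI (sg_neq0 F (p (+) sigma T b (+) sigma T1 a))).
transitivity (sg F (p (+) sigma T b (+) sigma T1 a (+) (sigma T a (+) sigma T1 b)) ⋅
   (w (fl T a) ⋅ w (fl T1 b))).
  by rewrite -!sgM; tmonom.
transitivity (sg F p ⋅ (w (fl T b) ⋅ w (fl T1 a))); last first.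
  transitivity (sg F (p (+) sigma T b (+) sigma T1 a (+) (sigma T b (+) sigma T1 a)) ⋅
     (w (fl T b) ⋅ w (fl T1 a))); last by rewrite -!sgM; tmonom.
  congr (sg F _ ⋅ _).
  by case: (p); case: (sigma T b); case: (sigma T1 a).
rewrite E; congr (sg F _ ⋅ _); rewrite /p /T' /T1 !sigma_fl !ltnn (ltn_addb ab).
move: (sigma T a) (sigma T b) (a < b) (i < a) (i < b) (j < a) (j < b).
by do 7!case.
Qed.

(** Walk from [T] to [T2] within the transversals having this circuit. With [a] an index of the
    circuit, exchanging a differing index [i] between the bases [fl T a] and [fl T2 a] gives a
    partner [j]; flipping both in [T] approaches [T2] and keeps the circuit. *)
Lemma wvec_proportional T T2 : circ Bs T != set0 -> circ Bs T = circ Bs T2 ->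
  proportional (wvec w T) (wvec w T2).
Proof.
have [m] := ubnP (dist T T2); elim: m T => // m IH T dm T0 eC.
have [->|/dist_gt0[i iD]] := eqVneq T T2.
  by exists tone; [exact: tone_neq0 | apply: funext => x; rewrite /scale tmul1].
have [a ba aC] := circ_neq0P T0.
have eqT k : el T k \in circ Bs T -> (k \in T) = (k \in T2).
  by rewrite eC => /(subsetP (circ_sub _ _)); rewrite in_tr /el /=; case: (k \in T);
    case: (k \in T2).
have bT2 : basis Bs (fl T2 a).
  by have := aC; rewrite eC in_circ => /andP[].
have ai : a != i by apply: contraTneq iD => <-; rewrite eqT // addbb.
have ia : i != a by rewrite eq_sym.
have [] := ed.2 _ _ i ba bT2; first by rewrite !in_fl (negbTE ia) !addbF.
move=> j [ji]; rewrite !in_fl addbACA addbb addbF => jD bj _.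
have ij : i != j by rewrite eq_sym.
have nb k : (k \in T) (+) (k \in T2) -> ~~ basis Bs (fl T k).
  by apply: contraL => bk; rewrite eqT ?addbb // el_circ.
set T1 := fl (fl T i) j.
have eC1 : circ Bs T1 = circ Bs T.
  apply/esym; apply: (circuit_eq sB ed).
  - exact: circuit_circ.
  - apply/subsetP => x xC; have xT := subsetP (circ_sub _ _) _ xC.
    have := xC; rewrite {1}(trE xT) => /eqT xe.
    by rewrite !in_tr_flN //; [apply: contraTneq iD | apply: contraTneq jD] => <-;
      rewrite xe addbb.
  - apply: (@circ_neq0 _ _ _ a); rewrite (_ : fl T1 a = fl (fl (fl T a) i) j) // /T1; flips.
apply: (proportional_trans (adjacent ij T0 (nb _ iD) (nb _ jD) eC1)).
apply: IH; rewrite ?eC1 //; rewrite (dist_fl iD) in dm.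
rewrite (@dist_fl _ (fl T i) T2 j) in dm; first exact: ltnW.
by rewrite in_fl (negbTE ji) addbF.
Qed.

Definition wick_circuits : set (vect F n) :=
  [set X | vsupport X != set0 /\ exists T, proportional X (wvec w T)]%classic.

Lemma wick_to_circuitsE : wick_to_circuits (proj_class psi) = wick_circuits.
Proof.
apply/seteqP; split=> X [X0 h]; split=> //.
  case: h => psi' [S [[c /= c0 <-]]] /transversal_tr[T ->] [d /= d0 <-].
  exists T, (d ⋅ c); first by rewrite tmul_neq0 d0.
  apply: funext => x; rewrite wick_vectorE /scale /wvec; case: ifP => _;
    last by rewrite !tmulr0.
  by rewrite wk_scale; tmonom.
case: h => T [c c0 ->]; exists psi, (tr T); split.
- by exists tone; [exact: tone_neq0 | apply: funext => x; rewrite /scale tmul1].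
- exact: tr_transversal.
- by exists c => //; rewrite wick_vectorE.
Qed.

Lemma wick_circuits_supp X : wick_circuits X ->
  exists2 T, circ Bs T != set0 & vsupport X = circ Bs T.
Proof.
by case=> X0 [T XT]; exists T; rewrite -?wvec_circ -(proportional_supp XT).
Qed.

Lemma wick_circuits_circ X T : wick_circuits X -> vsupport X = circ Bs T ->
  proportional X (wvec w T).
Proof.
case=> X0 [T' XT'] eX; apply: (proportional_trans XT').
apply: wvec_proportional; rewrite -wvec_circ -(proportional_supp XT') //.
Qed.

Lemma wick_circuits_wvec (c : F) T : c != tzero -> circ Bs T != set0 ->
  wick_circuits (scale c (wvec w T)).
Proof. by move=> c0 T0; split; [rewrite vsupport_scale // wvec_circ | exists T, c]. Qed.

End WickToCircuits.

(** * Modular pairs and triples of circuits *)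

Section ModularTuples.
Variables (n : nat) (Bs : {set {set ground n}}).
Hypotheses (sB : Bs \subset transversals n) (ed : even_delta (basis Bs)).
Implicit Types (A B T : {set 'I_n}) (a b c d : 'I_n) (D : {set ground n}) (x e : ground n).

Lemma modular_atE B D1 D2 D3 e1 e2 e3 :
  modular_at Bs (tr B) [tuple e1; e2; e3] [tuple D1; D2; D3] <->
  [/\ uniq [:: e1; e2; e3], fundamental_circuit Bs (tr B) e1 D1,
      fundamental_circuit Bs (tr B) e2 D2 & fundamental_circuit Bs (tr B) e3 D3].
Proof.
split=> [[u h]|[u h1 h2 h3]]; split=> //.
- exact: h (Ordinal (isT : 0 < 3)).
- exact: h (Ordinal (isT : 1 < 3)).
- exact: h (Ordinal (isT : 2 < 3)).
- by case=> [[|[|[|m]]] im] //.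
Qed.

Lemma notin_tr_eq B e e' : e \notin tr B -> e' \notin tr B -> (e == e') = (e.1 == e'.1).
Proof.
move=> eB e'B; rewrite (trNE eB) (trNE e'B) /=.
by apply/eqP/eqP => [[]|->].
Qed.

Lemma star_notin_tr B e : e \notin tr B -> star e = el B e.1.
Proof. by move=> eB; apply: trE; rewrite star_tr. Qed.

Lemma el_flNtr B b : el (fl B b) b \notin tr B.
Proof. by rewrite -star_el star_tr el_tr. Qed.

Lemma modular2P D1 D2 : modular Bs [tuple D1; D2] <->
  exists B b c, [/\ b != c, basis Bs B, D1 = circ Bs (fl B b) & D2 = circ Bs (fl B c)].
Proof.
split=> [[S [e [SB [u h]]]]|[B [b [c [bc bB -> ->]]]]].
  have [B eS] := transversal_tr (subsetP sB _ SB); subst S.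
  have /(fundamental_circuitP sB ed)[bB e1B D1E] := h (Ordinal (isT : 0 < 2)).
  have /(fundamental_circuitP sB ed)[_ e2B D2E] := h (Ordinal (isT : 1 < 2)).
  exists B, (tnth e (Ordinal (isT : 0 < 2))).1, (tnth e (Ordinal (isT : 1 < 2))).1;
    split=> //.
  rewrite -(notin_tr_eq e1B e2B); apply/eqP => e12.
  by have /tuple_uniqP/(_ _ _ e12) := u.
exists (tr B), [tuple el (fl B b) b; el (fl B c) c]; split=> //; split.
  by rewrite /= inE andbT (notin_tr_eq (el_flNtr B b) (el_flNtr B c)).
case=> [[|[|m]] im] //; apply/(fundamental_circuitP sB ed);
  rewrite /= ?(tnth_nth set0) ?(tnth_nth (el B b)) /=;
  by split=> //; apply: el_flNtr.
Qed.

End ModularTuples.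

(** * Circuit axioms for the vectors of a Wick function *)

Section WickCircuitAxioms.
Variables (F : tract) (n : nat) (psi : wickfun F n) (wpsi : weak_wick psi).
Implicit Types (A B T : {set 'I_n}) (b c d : 'I_n) (x g : ground n) (X Y : vect F n) (r :
  F).

Let w := wk psi.
Let Bs := fsupport psi.
Let w4 : forall A B, dist A B = 4 -> wick_rel w A B.
Proof. by have /weak_wickP[] := wpsi. Qed.

Let wB A : (w A != tzero) = basis Bs A.
Proof. by rewrite /basis in_fsupport_tr. Qed.

Let sB : Bs \subset transversals n.
Proof. by apply/subsetP => S; rewrite in_fsupport => /andP[]. Qed.

Let ed : even_delta (basis Bs).
Proof.
have /weak_wickP[h _] := wpsi.
by rewrite (_ : basis Bs = fun A => wk psi A != tzero) //; apply: funext => A; rewrite -wB.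
Qed.

Lemma wick_circuits_fund X B b : wick_circuits psi X -> vsupport X = circ Bs (fl B b) ->
  exists2 r, r != tzero & X = scale r (wvec w (fl B b)).
Proof. exact: wick_circuits_circ. Qed.

(** Cancellation at the coordinate [d] is a two-term sum and fixes the ratio of [r1] and [r2]. It is
    their ratio in the four-term relation, so the multiplier [l] is shared. *)
Let coef B b c d r1 r2 l : uniq [:: b; c; d] -> basis Bs (fl (fl B c) d) ->
  r1 = l ⋅ (sg F ((c < b) (+) (d < b)) ⋅ w (fl (fl B c) d)) ->
  tnull [:: r1 ⋅ wvec w (fl B b) (el B d); r2 ⋅ wvec w (fl B c) (el B d)] ->
  r2 = l ⋅ (sg F ((b < c) (+) (d < c)) ⋅ w (fl (fl B b) d)).
Proof.
rewrite /= !inE !negb_or -wB => /and3P[/andP[bc bd] cd _] w0 ->.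
rewrite !wvec_el_fl // => /tnull2; rewrite tneg1E !sigma_fl => E.
apply: (tmulI w0); apply: (tmulI (sg_neq0 F (sigma B d (+) (c < d)))).
transitivity (r2 ⋅ (sg F (sigma B d (+) (c < d)) ⋅ w (fl (fl B c) d))); first by tmonom.
rewrite E.
transitivity (sg F (true (+) ((c < b) (+) (d < b)) (+) (sigma B d (+) (b < d))) ⋅
  (l ⋅ (w (fl (fl B c) d) ⋅ w (fl (fl B b) d)))); first by rewrite -!sgM; tmonom.
transitivity (sg F (sigma B d (+) (c < d) (+) ((b < c) (+) (d < c))) ⋅
  (l ⋅ (w (fl (fl B c) d) ⋅ w (fl (fl B b) d)))); last by rewrite -!sgM; tmonom.
congr (sg F _ ⋅ _); rewrite (ltn_addb bc) (ltn_addb bd) (ltn_addb cd).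
by case: (sigma B d); case: (b < c); case: (b < d); case: (c < d).
Qed.

Let four_scaled B b c d l g : l != tzero -> uniq [:: b; c; d] ->
  tnull [:: l ⋅ (sg F ((c < b) (+) (d < b)) ⋅ w (fl (fl B c) d)) ⋅ wvec w (fl B b) g;
            l ⋅ (sg F ((b < c) (+) (d < c)) ⋅ w (fl (fl B b) d)) ⋅ wvec w (fl B c) g;
            l ⋅ (sg F ((b < d) (+) (c < d)) ⋅ w (fl (fl B b) c)) ⋅ wvec w (fl B d) g;
            l ⋅ (sg F true ⋅ w B) ⋅ wvec w (fl (fl (fl B b) c) d) g].
Proof.
move=> l0 u; have := four_term_null B u w4 g => /(tnull_scale l0).
by rewrite /= !tmulA.
Qed.

Lemma wick_weak_circuit_set : weak_circuit_set Bs (wick_circuits psi).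
Proof.
split.
- split.
  + by move=> X [].
  + move=> r X r0 [X0 [T [r' r'0 eX]]]; split; rewrite ?eX.
      by move: X0; rewrite eX !vsupport_scale.
    exists T, (r ⋅ r'); first by rewrite tmul_neq0 r0.
    by apply: funext => x; rewrite /scale tmulA.
  + move=> D; split=> [/(circuitP sB ed)[T T0 ->]|[X /wick_circuits_supp[T T0 eX] <-]].
      exists (scale tone (wvec w T)); first by apply: wick_circuits_wvec => //;
        apply: tone_neq0.
      by rewrite vsupport_scale ?tone_neq0 // (vsupport_wvec _ wB).
    by apply/(circuitP sB ed); exists T.
- move=> X Y cX cY /(modular2P sB ed)[B [b [c [bc bB eX eY]]]] _.
  have [r1 r10 ->] := wick_circuits_fund cX eX;
    have [r2 r20 ->] := wick_circuits_fund cY eY.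
  have cb : c != b by rewrite eq_sym.
  rewrite (@tnull_pairing _ _ B b c) //; last 2 first.
  + by move=> x xB; rewrite /scale wvec_off // tmulr0.
  + by move=> x xB; rewrite /scale wvec_off // tmulr0.
  rewrite /scale !wvec_el !(wvec_el_fl _ _ cb) !(wvec_el_fl _ _ bc) !flK (flC B c b).
  set u := w B; set v := w (fl _ _).
  have t r r' p p' y y' : (r ⋅ (sg F p ⋅ y)) ⋅ (r' ⋅ (sg F p' ⋅ y')) = sg F (p (+) p') ⋅
    (r ⋅ r' ⋅ (y ⋅ y')).
    by rewrite -sgM; tmonom.
  (* Up to sign, both summands are the product of the two scalars, [w B] and [w (fl (fl B b) c)]. *)
  rewrite !t; apply: tnull_sg2; last by rewrite (tmulC u).
  rewrite !sigma_fl !ltnn (ltn_addb bc).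
  by case: (sigma B b); case: (sigma B c); case: (b < c).
- move=> X1 X2 f c1 c2 /(modular2P sB ed)[B [b [c [bc bB e1 e2]]]].
  rewrite e1 e2 /first_kind /= !andbT subtransversal_circ // => nbc;
    rewrite in_setI => /andP[f1 f2] fnull.
  have [r1 r10 E1] := wick_circuits_fund c1 e1;
    have [r2 r20 E2] := wick_circuits_fund c2 e2.
  move: f1 f2; rewrite !in_circ => /andP[f1 bf1] /andP[f2 bf2].
  (* The index of [f] serves as third direction: as [f] lies in both circuits, [fl (fl B b) d] and
     [fl (fl B c) d] are bases. *)
  set d := f.1 in bf1 bf2.
  have bd : b != d by apply: contraNneq nbc => e; move: bf2; rewrite -e flC.
  have cd : c != d by apply: contraNneq nbc => e; move: bf1; rewrite -e.
  have fE : f = el B d by rewrite (trE f1) el_fl.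
  have u : uniq [:: b; c; d] by uniqs.
  pose l := r1 ⋅ tinv (sg F ((c < b) (+) (d < b)) ⋅ w (fl (fl B c) d)).
  have y0 : sg F ((c < b) (+) (d < b)) ⋅ w (fl (fl B c) d) != tzero by rewrite tmul_neq0
    sg_neq0 wB.
  have l0 : l != tzero by rewrite tmul_neq0 r10 tinv_neq0.
  have r1E : r1 = l ⋅ (sg F ((c < b) (+) (d < b)) ⋅ w (fl (fl B c) d)) by rewrite /l tdivK.
  clearbody l.
  have r2E := coef u bf2 r1E.
  rewrite E1 E2 /scale fE in fnull; have {}r2E := r2E _ fnull.
  exists (scale (l ⋅ (sg F true ⋅ w B)) (wvec w (fl (fl (fl B b) c) d))); split.
  + apply: wick_circuits_wvec => //; first by rewrite !tmul_neq0 l0 (sg_neq0 F true) wB.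
    by apply: (@circ_neq0 _ _ _ b); rewrite (_ : fl _ b = fl (fl B c) d) //; flips.
  + rewrite /scale wvec_off ?tmulr0 // fE in_tr_fl !in_tr_flN //= 1?eq_sym // el_tr eqxx //.
  move=> g; have := four_scaled B g l0 u.
  rewrite -r1E -r2E -/(scale r1 _ g) -/(scale r2 _ g) -E1 -E2.
  (* For a pair of the first kind the vector in direction [d] has coefficient zero, which leaves
     three summands. *)
  have -> : w (fl (fl B b) c) = tzero by apply/eqP; rewrite -[_ == _]negbK wB.
  rewrite tmulr0 tmulr0 tmul0 => h; apply/tnull_cons0; move: h; apply: tnull_perm.
  by apply/permP => P /=; rewrite [RHS]addnCA; congr (_ + _)%N; rewrite [RHS]addnCA.
- move=> X1 X2 X3 S e1 e2 e3 c1 c2 c3 h.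
  have [_ /(_ ord0) [SB _ _ _]] := h; have [B eS] := transversal_tr (subsetP sB _ SB);
    subst S.
  case/modular_atE: h => ue /(fundamental_circuitP sB ed)[bB e1B s1].
  move=> /(fundamental_circuitP sB ed)[_ e2B s2] /(fundamental_circuitP sB ed)[_ e3B s3].
  rewrite /second_kind /= s1 s2 s3 !andbT !(star_notin_tr (B := B)) //.
  set b := e1.1 in s1 *; set c := e2.1 in s2 *; set d := e3.1 in s3 *.
  have u : uniq [:: b; c; d].
    by move: ue; rewrite /= !inE (notin_tr_eq e1B e2B) (notin_tr_eq e1B e3B) (notin_tr_eq
      e2B e3B).
  have := u; rewrite /= !inE !negb_or => /and3P[/andP[bc bd] cd _].
  rewrite !subtransversal_circ // !negbK => /andP[/andP[bbc bbd] bcd].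
  have [r1 r10 E1] := wick_circuits_fund c1 s1;
    have [r2 r20 E2] := wick_circuits_fund c2 s2.
  have [r3 r30 E3] := wick_circuits_fund c3 s3.
  rewrite E1 E2 E3 /scale => n1 n2 n3.
  pose l := r1 ⋅ tinv (sg F ((c < b) (+) (d < b)) ⋅ w (fl (fl B c) d)).
  have y0 : sg F ((c < b) (+) (d < b)) ⋅ w (fl (fl B c) d) != tzero by rewrite tmul_neq0
    sg_neq0 wB.
  have l0 : l != tzero by rewrite tmul_neq0 r10 tinv_neq0.
  have r1E : r1 = l ⋅ (sg F ((c < b) (+) (d < b)) ⋅ w (fl (fl B c) d)) by rewrite /l tdivK.
  clearbody l.
  have r2E := coef u bcd r1E n3.
  have r3E : r3 = l ⋅ (sg F ((b < d) (+) (c < d)) ⋅ w (fl (fl B b) c)).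
    apply: (@coef B b d c r1 r3 l); rewrite 1?flC // 1?addbC //; first by uniqs.
    exact: tnull_swap.
  exists (scale (l ⋅ (sg F true ⋅ w B)) (wvec w (fl (fl (fl B b) c) d))); split.
  + apply: wick_circuits_wvec => //; first by rewrite !tmul_neq0 l0 (sg_neq0 F true) wB.
    by apply: (@circ_neq0 _ _ _ b); rewrite (_ : fl _ b = fl (fl B c) d) //; flips.
  + have z k : k \in [:: b; c; d] -> wvec w (fl (fl (fl B b) c) d) (el B k) = tzero.
      move=> kbcd; apply: wvec_off; rewrite in_tr !in_fl /=; move: kbcd; rewrite !inE.
      case/or3P => /eqP ->; rewrite ?eqxx ?(negbTE bc) ?(negbTE bd) ?(negbTE cd) ?[c ==
        b]eq_sym
        ?[d == b]eq_sym ?[d == c]eq_sym ?(negbTE bc) ?(negbTE bd) ?(negbTE cd);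
      by case: (_ \in B).
    by split; rewrite /scale z ?tmulr0 // !inE eqxx ?orbT.
  move=> g; have := four_scaled B g l0 u.
  by rewrite -r1E -r2E -r3E.
Qed.

End WickCircuitAxioms.

(** * From circuit sets to Wick functions *)

Section CircuitsToWick.
Variables (F : tract) (n : nat) (Bs : {set {set ground n}}) (C : set (vect F n)).
Hypotheses (sB : Bs \subset transversals n) (ed : even_delta (basis Bs)).
Hypothesis wC : weak_circuit_set Bs C.
Implicit Types (A B T : {set 'I_n}) (a b c d i j k l : 'I_n) (x g : ground n) (X Y : vect
  F n).

Let C_neq0 X : C X -> vsupport X != set0.
Proof. by have [[h _ _] _ _ _] := wC; apply: h. Qed.

Let C_scale (r : F) X : r != tzero -> C X -> C (scale r X).
Proof. by have [[_ h _] _ _ _] := wC; apply: h. Qed.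

Let C_circ T : circ Bs T != set0 -> exists2 X, C X & vsupport X = circ Bs T.
Proof. by have [[_ _ h] _ _ _] := wC => /(circuit_circ sB ed)/h. Qed.

Let C_supp X : C X -> exists2 T, circ Bs T != set0 & vsupport X = circ Bs T.
Proof.
have [[_ _ h] _ _ _] := wC; move=> cX.
by apply/(circuitP sB ed)/h; exists X.
Qed.

Let circ_flN0 B b : basis Bs B -> circ Bs (fl B b) != set0.
Proof. by move=> bB; apply: (@circ_neq0 _ _ _ b); rewrite flK. Qed.

Let off X T x : vsupport X \subset tr T -> x \notin tr T -> X x = tzero.
Proof.
move=> /subsetP sub xT; apply/eqP; apply: contraT => Xx.
by rewrite sub // in_vsupport in xT.
Qed.

Let off_circ X T x : vsupport X = circ Bs T -> x \notin tr T -> X x = tzero.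
Proof. by move=> eX; apply: off; rewrite eX circ_sub. Qed.

Let orthogonal X Y B b c : C X -> C Y -> b != c -> basis Bs B -> basis Bs (fl (fl B b) c) ->
  vsupport X = circ Bs (fl B b) -> vsupport Y = circ Bs (fl B c) ->
  tnull [:: X (el (fl B b) b) ⋅ Y (el B b); X (el B c) ⋅ Y (el (fl B c) c)].
Proof.
move=> cX cY bc bB bbc eX eY.
rewrite -(@tnull_pairing _ _ B b c) //; last 2 first.
- by move=> x; apply: off_circ.
- by move=> x; apply: off_circ.
have [_ h _ _] := wC; apply: h => //.
  by apply/(modular2P sB ed); exists B, b, c.
by rewrite /second_kind /= eX eY !andbT subtransversal_circ // negbK.
Qed.

(* Orthogonality to a third vector forces the ratio of any two coordinates. *)
Lemma circuits_proportional X Y : C X -> C Y -> vsupport X = vsupport Y -> proportional X Y.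
Proof.
move=> cX cY eXY; have [T T0 eX] := C_supp cX.
have [a ba aT] := circ_neq0P T0.
apply: (@proportional_of_ratios _ _ _ _ (el T a)) => //.
  by rewrite -in_vsupport eX.
move=> y; rewrite eX => yC; have yT := subsetP (circ_sub _ _) _ yC.
rewrite (trE yT); move: yC; rewrite {1}(trE yT) el_circ; set b := y.1 => bb ne.
have ab : a != b by apply: contraNneq ne => ->.
have ba' : b != a by rewrite eq_sym.
set B := fl T a in ba.
have [Z cZ eZ] := C_circ (circ_flN0 b ba).
have bab : basis Bs (fl (fl B a) b) by rewrite /B flK.
have BT : fl B a = T by rewrite /B flK.
have elb : el B b = el T b by rewrite /B el_fl.
have ortho V : C V -> vsupport V = circ Bs T -> V (el T a) ⋅ Z (el B a) = tneg1 ⋅ (V (el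
  T b) ⋅ Z (el (fl B b) b)).
  move=> cV eV; have := @orthogonal V Z B a b cV cZ ab ba bab.
  by rewrite BT elb => /(_ eV eZ)/tnull_swap/tnull2.
have Za : Z (el B a) != tzero.
  by rewrite -in_vsupport eZ -(el_fl B ba') el_circ flC BT.
have Zb : Z (el (fl B b) b) != tzero by rewrite -in_vsupport eZ el_circ flK.
have EX := ortho X cX eX; have EY := ortho Y cY; rewrite -eXY in EY; have {}EY := EY eX.
apply: (tmulI Za); apply: (tmulI Zb); apply: (tmulI (tneg1_neq0 F)).
transitivity ((X (el T a) ⋅ Z (el B a)) ⋅ (tneg1 ⋅ (Y (el T b) ⋅ Z (el (fl B b) b))));
  first by tmonom.
by rewrite EX -EY; tmonom.
Qed.

Let rep_ex T : exists X, circ Bs T != set0 -> C X /\ vsupport X = circ Bs T.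
Proof.
have [/C_circ[X cX eX]|T0] := boolP (circ Bs T != set0); first by exists X.
by exists (fun=> tzero).
Qed.

Let rep T := sval (cid (rep_ex T)).

Let repP T : circ Bs T != set0 -> C (rep T) /\ vsupport (rep T) = circ Bs T.
Proof. exact: svalP (cid (rep_ex T)). Qed.

Let rep_el T i : basis Bs (fl T i) -> rep T (el T i) != tzero.
Proof. by move=> b; rewrite -in_vsupport (repP (circ_neq0 b)).2 el_circ. Qed.

(** If [rep T] is a multiple of [wvec w T], this is the ratio of [w (fl T j)] to [w (fl T i)];
    rescaling [rep T] does not change it. *)
Let slope T i j : F := sg F (sigma T i (+) sigma T j) ⋅ (rep T (el T j) ⋅ tinv (rep T (el
  T i))).

Let slope_comp T i j k : basis Bs (fl T j) -> slope T i j ⋅ slope T j k = slope T i k.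
Proof.
move=> bj; rewrite /slope.
transitivity (sg F ((sigma T i (+) sigma T j) (+) (sigma T j (+) sigma T k)) ⋅
  (rep T (el T k) ⋅ tinv (rep T (el T i)) ⋅ (tinv (rep T (el T j)) ⋅ rep T (el T j)))).
  by rewrite -[in RHS]sgM; tmonom.
rewrite tmulVl ?rep_el // tmulr1; congr (sg F _ ⋅ _).
by case: (sigma T j); case: (sigma T i); case: (sigma T k).
Qed.

Let slope_id T i : basis Bs (fl T i) -> slope T i i = tone.
Proof. by move=> bi; rewrite /slope addbb tmul1 tmulVr // rep_el. Qed.

(** The label of the edge from [A] to [fl (fl A i) j] can be read off the vector of [fl A i] or of
    [fl A j]. Orthogonality of these two vectors says that the readings agree. *)
Let slope_sym A i j : i != j -> basis Bs A -> basis Bs (fl (fl A i) j) ->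
  slope (fl A i) i j = slope (fl A j) j i.
Proof.
move=> ij bA bij; have ji : j != i by rewrite eq_sym.
have [c1 s1] := repP (circ_flN0 i bA); have [c2 s2] := repP (circ_flN0 j bA).
have := orthogonal c1 c2 ij bA bij s1 s2;
  rewrite /slope (el_fl A ij) (el_fl A ji) => /tnull2 E.
have n1 : rep (fl A i) (el (fl A i) i) != tzero by rewrite rep_el // flK.
have n2 : rep (fl A j) (el (fl A j) j) != tzero by rewrite rep_el // flK.
apply: (tmulI n1); apply: (tmulI n2).
set s := sg _ _; set t := sg _ _.
transitivity (s ⋅ (rep (fl A i) (el A j) ⋅ rep (fl A j) (el (fl A j) j)) ⋅
   (tinv (rep (fl A i) (el (fl A i) i)) ⋅ rep (fl A i) (el (fl A i) i))); first by tmonom.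
rewrite tmulVl // tmulr1 E.
transitivity (t ⋅ (rep (fl A i) (el (fl A i) i) ⋅ rep (fl A j) (el A i)) ⋅
   (tinv (rep (fl A j) (el (fl A j) j)) ⋅ rep (fl A j) (el (fl A j) j))); last by tmonom.
rewrite tmulVl // tmulr1 tneg1E tmulA /s sgM; congr (sg F _ ⋅ _).
rewrite !sigma_fl !ltnn (ltn_addb ij).
by case: (sigma A i); case: (sigma A j); case: (i < j).
Qed.

(* A circuit avoiding the indices k and l is also the circuit of the transversal
   flipped at k and l. *)
Let slope_flip A i j k l : uniq [:: i; j; k; l] -> basis Bs A -> basis Bs (fl (fl A i) j) ->
  basis Bs (fl (fl A k) l) ->
  ~~ basis Bs (fl (fl A i) k) -> ~~ basis Bs (fl (fl A i) l) ->
  slope (fl (fl (fl A k) l) i) i j =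
  sg F ((k < i) (+) (l < i) (+) (k < j) (+) (l < j)) ⋅ slope (fl A i) i j.
Proof.
move=> u bA bij bkl nik nil.
have := u; rewrite /= !inE !negb_or => /and4P[/and3P[ij ik il] /andP[jk jl] kl _].
set T := fl A i; set T2 := fl (fl (fl A k) l) i.
have [c1 s1] := repP (circ_flN0 i bA); have [c2 s2] := repP (circ_flN0 i bkl).
have T2E : T2 = fl (fl T k) l by rewrite /T2 /T; flips.
have eC : circ Bs T = circ Bs T2.
  apply: (circuit_eq sB ed); [apply: circuit_circ => //;
    exact: circ_flN0| |exact: circ_flN0].
  apply/subsetP => x xC; have xT := subsetP (circ_sub _ _) _ xC.
  move: xC; rewrite in_circ => /andP[_ bx].
  have xk : x.1 != k by apply: contraNneq nik => <-.
  have xl : x.1 != l by apply: contraNneq nil => <-.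
  by rewrite T2E in_tr_flN // in_tr_flN.
have [r r0 E] := circuits_proportional c1 c2 (etrans s1 (etrans eC (esym s2))).
have e2 x : rep T2 x = tinv r ⋅ rep T x by rewrite E /scale tmulA tmulVl // tmul1.
have eli : el T2 i = el T i by rewrite T2E el_fl 1?eq_sym // el_fl 1?eq_sym.
have elj : el T2 j = el T j by rewrite T2E el_fl 1?eq_sym // el_fl 1?eq_sym.
have ni : rep T (el T i) != tzero by rewrite rep_el // /T flK.
rewrite /slope eli elj sgMA !e2.
transitivity (sg F (sigma T2 i (+) sigma T2 j) ⋅ (rep T (el T j) ⋅ tinv (rep T (el T i)))).
  congr (_ ⋅ _); have ni2 : tinv r ⋅ rep T (el T i) != tzero by rewrite tmul_neq0 tinv_neq0.
  apply: (tmulI ni2); apply: (tmulI ni).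
  transitivity (tinv r ⋅ rep T (el T j) ⋅ rep T (el T i) ⋅
    (tinv (tinv r ⋅ rep T (el T i)) ⋅ (tinv r ⋅ rep T (el T i)))); first by tmonom.
  rewrite tmulVl //.
  transitivity (tinv r ⋅ rep T (el T j) ⋅ rep T (el T i) ⋅
    (tinv (rep T (el T i)) ⋅ (rep T (el T i)))); last by tmonom.
  by rewrite tmulVl.
congr (sg F _ ⋅ _); rewrite /T2 /T !sigma_fl.
move: (sigma A i) (sigma A j) (k < i) (l < i) (k < j) (l < j) (i < i) (i < j).
by do 8!case.
Qed.

Lemma circuits_wick_function : exists2 w : {set 'I_n} -> F,
  forall A, (w A != tzero) = basis Bs A &
  forall T, circ Bs T != set0 -> proportional (rep T) (wvec w T).
Proof.
have [] := @integrate n _ ed F (fun A i j => slope (fl A i) i j).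
- move=> A i j ij bA bij; rewrite /slope !tmul_neq0 sg_neq0 rep_el //= tinv_neq0 //
  rep_el //.
  by rewrite flK.
- exact: slope_sym.
- move=> A i j ij bA bij; have ji : j != i by rewrite eq_sym.
  rewrite (slope_sym (A := fl (fl A i) j)) ?flJ ?flK // slope_comp // slope_id //.
  by rewrite flK.
(* All three bases are flips of the one transversal [fl A i], so the triangle condition is the
   multiplicativity of its coordinate ratios. *)
- by move=> A i j k _ bA bij bik; rewrite flK slope_comp.
- move=> A i j k l u bA bij bkl bijkl nik nil njk njl.
  have u' : uniq [:: k; l; i; j].
    by move: u; rewrite -[[:: i; j; k; l]]/([:: i; j] ++ [:: k; l]) uniq_catC.
  have := u; rewrite /= !inE !negb_or => /and4P[/and3P[ij ik il] /andP[jk jl] kl _].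
  rewrite (@slope_flip A i j k l) // (@slope_flip A k l i j) // 1?(flC A k i) 1?(flC A k
    j) //.
  rewrite tmulCA [RHS]tmulCA (tmulC (slope (fl A k) k l)); congr (sg F _ ⋅ _).
  rewrite (ltn_addb ik) (ltn_addb il) (ltn_addb jk) (ltn_addb jl).
  by case: (i < k); case: (i < l); case: (j < k); case: (j < l).
move=> w [w0 wE]; exists w => // T T0; have [cT sT] := repP T0.
have [a ba aT] := circ_neq0P T0.
apply: (@proportional_of_ratios _ _ _ _ (el T a)); first exact: rep_el.
  by rewrite sT (vsupport_wvec _ w0).
move=> y; rewrite sT => yC; have yT := subsetP (circ_sub _ _) _ yC.
rewrite (trE yT); move: yC; rewrite {1}(trE yT) el_circ; set b := y.1 => bb ne.
have ab : a != b by apply: contraNneq ne => ->.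
rewrite !wvec_el; have := wE (fl T a) a b ab ba; rewrite flK => /(_ bb) ->; rewrite /slope.
transitivity ((sg F (sigma T b (+) (sigma T a (+) sigma T b))) ⋅ (w (fl T a) ⋅ rep T (el
  T b)) ⋅
   (tinv (rep T (el T a)) ⋅ rep T (el T a))); first by rewrite -[in RHS]sgM; tmonom.
rewrite tmulVl ?rep_el // tmulr1 [RHS]tmulCA (tmulC (w _)); congr (sg F _ ⋅ _).
by case: (sigma T a); case: (sigma T b).
Qed.

(** * Four-term Wick relations from the elimination axioms *)

Section WickRelation.
Variable w : {set 'I_n} -> F.
Hypothesis w0 : forall A, (w A != tzero) = basis Bs A.
Hypothesis repw : forall T, circ Bs T != set0 -> proportional (rep T) (wvec w T).

Lemma circuits_wvec T X : circ Bs T != set0 -> C X -> vsupport X = circ Bs T ->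
  proportional X (wvec w T).
Proof.
move=> T0 cX eX; have [cT sT] := repP T0.
apply: proportional_trans (repw T0); apply: circuits_proportional => //.
by rewrite eX sT.
Qed.

Let C_wvec (r : F) T : r != tzero -> circ Bs T != set0 -> C (scale r (wvec w T)).
Proof.
move=> r0 T0; apply: C_scale => //.
by have [s s0 ->] := proportional_sym (repw T0); apply: C_scale => //; have [] := repP T0.
Qed.

Let wz A : ~~ basis Bs A -> w A = tzero.
Proof. by rewrite -w0 negbK => /eqP. Qed.

Let X1 B b c d := scale (sg F ((c < b) (+) (d < b)) ⋅ w (fl (fl B c) d)) (wvec w (fl B b)).
Let X2 B b c d := scale (sg F ((b < c) (+) (d < c)) ⋅ w (fl (fl B b) d)) (wvec w (fl B c)).
Let X3 B b c d := scale (sg F ((b < d) (+) (c < d)) ⋅ w (fl (fl B b) c)) (wvec w (fl B d)).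

Let four_termE B b c d g : four_term w B b c d g =
  [:: X1 B b c d g; X2 B b c d g; X3 B b c d g;
      scale (sg F true ⋅ w B) (wvec w (fl (fl (fl B b) c) d)) g].
Proof. by rewrite /four_term /X1 /X2 /X3 /scale -!tmulA. Qed.

Let uniq3 b c d : uniq [:: b; c; d] -> [/\ b != c, b != d & c != d].
Proof. by rewrite /= !inE !negb_or => /and3P[/andP[]]. Qed.

(* The fourth vector comes from (L-ii') if B △ {b,c} and B △ {b,d} are bases, from
   (L-i') if only the latter is, and is - X1 if neither is: then X2 = X3 = 0. *)
Let fourth_vector B b c d : uniq [:: b; c; d] -> basis Bs B -> basis Bs (fl (fl B c) d) ->
    basis Bs (fl (fl B b) d) || ~~ basis Bs (fl (fl B b) c) ->
  exists X4, [/\ C X4, vsupport X4 \subset tr (fl (fl (fl B b) c) d) &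
    forall g, tnull [:: X1 B b c d g; X2 B b c d g; X3 B b c d g; X4 g]].
Proof.
move=> u bB bcd; have [bc bd cd] := uniq3 u.
have coef0 p y : w y != tzero -> sg F p ⋅ w y != tzero by rewrite tmul_neq0 sg_neq0.
have four := fun g => four_term_bcd w B u (g := g).
have scirc (r : F) T : r != tzero -> vsupport (scale r (wvec w T)) = circ Bs T.
  by move=> r0; rewrite vsupport_scale // (vsupport_wvec _ w0).
set U := fl (fl (fl B b) c) d in four *.
have offU k : k \in [:: b; c; d] -> el B k \notin tr U.
  move=> kbcd; rewrite in_tr !in_fl /=; move: kbcd; rewrite !inE.
  case/or3P => /eqP ->; rewrite ?eqxx ?(negbTE bc) ?(negbTE bd) ?(negbTE cd) ?[c == b]eq_sym
    ?[d == b]eq_sym ?[d == c]eq_sym ?(negbTE bc) ?(negbTE bd) ?(negbTE cd);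
  by case: (_ \in B).
have inU g : g \notin tr U -> g.1 \in [:: b; c; d] -> g = el B g.1.
  move=> gU gk; apply: trE; apply: contraT => gB; move: (offU _ gk).
  have -> : el B g.1 = star g by apply/esym/trE; rewrite star_tr.
  by rewrite star_tr (negbTE gU).
have X1off g : g.1 \notin [:: b; c; d] -> g \notin tr U ->
    [/\ X1 B b c d g = tzero, X2 B b c d g = tzero & X3 B b c d g = tzero].
  move=> + gU; rewrite !inE !negb_or => /and3P[gb gc gd].
  have gB : g \notin tr B by move: gU; rewrite /U !in_tr_flN.
  by split; rewrite /X1 /X2 /X3 /scale wvec_off ?in_tr_flN ?tmulr0.
have z1 : X1 B b c d (el B b) = tzero by rewrite /X1 /scale wvec_off ?tmulr0 // in_tr_fl
  el_tr /= eqxx.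
have z2 : X2 B b c d (el B c) = tzero by rewrite /X2 /scale wvec_off ?tmulr0 // in_tr_fl
  el_tr /= eqxx.
have z3 : X3 B b c d (el B d) = tzero by rewrite /X3 /scale wvec_off ?tmulr0 // in_tr_fl
  el_tr /= eqxx.
have z4 k : k \in [:: b; c; d] -> scale (sg F true ⋅ w B) (wvec w U) (el B k) = tzero.
  by move=> kk; rewrite /scale wvec_off ?tmulr0 // offU.
have c1 : C (X1 B b c d) by apply: C_wvec; rewrite ?coef0 ?w0 ?circ_flN0.
have [bbd|nbd] := boolP (basis Bs (fl (fl B b) d)) => /=; last first.
  move=> nbc; exists (scale tneg1 (X1 B b c d)); split.
  - by apply: C_scale => //; apply: tneg1_neq0.
  - rewrite vsupport_scale ?tneg1_neq0 // scirc ?coef0 ?w0 //.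
    apply/subsetP => x; rewrite in_circ => /andP[xT bx].
    have xc : x.1 != c by apply: contraNneq nbc => <-.
    have xd : x.1 != d by apply: contraNneq nbd => <-.
    by rewrite /U (in_tr_flN _ xd) (in_tr_flN _ xc).
  - move=> g; rewrite /X2 /X3 /scale !wz // !tmulr0 !tmul0.
    have := iffRL (tnull2 (X1 B b c d g) _) erefl => /(@tnull_catr0 F 2 [:: _; _]).
    by apply: tnull_perm; apply/permP => P /=; congr (_ + _)%N; rewrite !addn0 addnC -addnA.
have c2 : C (X2 B b c d) by apply: C_wvec; rewrite ?coef0 ?w0 ?circ_flN0.
have bd0 : basis Bs (fl (fl B d) b) by rewrite flC.
have [bbc _|nbc _] := boolP (basis Bs (fl (fl B b) c)).
  have c3 : C (X3 B b c d) by apply: C_wvec; rewrite ?coef0 ?w0 ?circ_flN0.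
  have [_ _ _ ax] := wC.
  have [] := ax _ _ _ (tr B) (el (fl B b) b) (el (fl B c) c) (el (fl B d) d) c1 c2 c3.
  - apply/modular_atE; rewrite !scirc ?coef0 ?w0 //; split; last 3 first.
    + by apply/(fundamental_circuitP sB ed); split=> //; apply: el_flNtr.
    + by apply/(fundamental_circuitP sB ed); split=> //; apply: el_flNtr.
    + by apply/(fundamental_circuitP sB ed); split=> //; apply: el_flNtr.
    by rewrite /= !inE !xpair_eqE (negbTE bc) (negbTE bd) (negbTE cd).
  - rewrite /second_kind /= !scirc ?coef0 ?w0 // !subtransversal_circ //.
    by rewrite !negbK bbc bbd bcd.
  - rewrite star_el flK; have := four (el B b); rewrite mem_head => /(_ isT).
    by rewrite four_termE z1 z4 ?mem_head // tnull_cons0 => /(@tnull_catr0 F 1 [:: _; _]).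
  - rewrite star_el flK; have := four (el B c); rewrite inE mem_head orbT => /(_ isT).
    rewrite four_termE z2 z4 ?inE ?eqxx ?orbT // => h; apply: tnull_swap.
    apply/(@tnull_catr0 F 2 [:: _; _]); move: h; apply: tnull_perm.
    by apply/permP => P /=; congr (_ + _)%N; rewrite addnCA.
  - rewrite star_el flK; have := four (el B d); rewrite !inE eqxx !orbT => /(_ isT).
    by rewrite four_termE z3 z4 ?inE ?eqxx ?orbT // => /(@tnull_catr0 F 2 [:: _; _]).
  move=> X4 [c4 [v1 v2 v3] h]; exists X4; split=> //.
  apply/subsetP => g; rewrite in_vsupport; apply: contraTT => gU.
  have [gk|gk] := boolP (g.1 \in [:: b; c; d]).
    rewrite (inU g gU gk); move: gk; rewrite !inE negbK.
    by rewrite !star_el !flK in v1 v2 v3; case/or3P => /eqP->; rewrite ?v1 ?v2 ?v3.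
  have [e1 e2 e3] := X1off g gk gU; have := h g; rewrite e1 e2 e3 !tnull_cons0 tnull1.
  by move=> ->; rewrite eqxx.
have [_ _ ax _] := wC.
have [] := ax _ _ (el B d) c1 c2.
- apply/(modular2P sB ed); exists B, b, c; rewrite !scirc ?coef0 ?w0 //.
- by rewrite /first_kind /= !scirc ?coef0 ?w0 // subtransversal_circ // nbc.
- rewrite in_setI !scirc ?coef0 ?w0 // -{1}(el_fl B bd) -(el_fl B cd) !el_circ bbd //.
- have := four (el B d); rewrite !inE eqxx !orbT => /(_ isT).
  by rewrite four_termE z3 z4 ?inE ?eqxx ?orbT // => /(@tnull_catr0 F 2 [:: _; _]).
have wbc : w (fl (fl B b) c) = tzero by apply: wz.
have z g : X3 B b c d g = tzero by rewrite /X3 /scale wz // tmulr0 tmul0.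
move=> X4 [c4 v3 h]; exists X4; split=> // [|g]; last first.
  rewrite z; have /tnull_cons0 := h g; apply: tnull_perm; apply/permP => P /=.
  by rewrite addnCA; congr (_ + _)%N; rewrite addnCA.
apply/subsetP => g; rewrite in_vsupport; apply: contraTT => gU; rewrite negbK.
have [gk|gk] := boolP (g.1 \in [:: b; c; d]); last first.
  by have [e1 e2 _] := X1off g gk gU; have := h g; rewrite e1 e2 !tnull_cons0 tnull1 => ->.
(* (L-i') gives vanishing at [el B d] only. At [el B b] and [el B c] the sum of the known vectors is
   a multiple of [w (fl (fl B b) c)], which is zero. *)
rewrite (inU g gU gk); move: gk; rewrite !inE; case/or3P => /eqP->; last by rewrite v3.
  have cb : c != b by rewrite eq_sym.
  have := h (el B b); rewrite z1 tnull_cons0 /X2 /scale (wvec_el_fl w B cb) (flC B c b)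
    wbc !tmulr0.
  by rewrite tnull_cons0 tnull1 => ->.
have := h (el B c); rewrite z2 /X1 /scale (wvec_el_fl w B bc) wbc !tmulr0.
by rewrite !tnull_cons0 tnull1 => ->.
Qed.

(** The fourth vector is a multiple of [wvec w U]. At the coordinate [el U b] the second and third
    vectors vanish, and the two-term sum that remains fixes the multiple. *)
Let four_null B b c d g : uniq [:: b; c; d] -> basis Bs B -> basis Bs (fl (fl B c) d) ->
    basis Bs (fl (fl B b) d) || ~~ basis Bs (fl (fl B b) c) ->
  tnull (four_term w B b c d g).
Proof.
move=> u bB bcd h; have [bc bd cd] := uniq3 u.
have [X4 [c4 s4 r4]] := fourth_vector u bB bcd h.
set U := fl (fl (fl B b) c) d in s4.
have Ub : fl U b = fl (fl B c) d by rewrite /U; flips.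
have U0 : circ Bs U != set0 by apply: (@circ_neq0 _ _ _ b); rewrite Ub.
have [T4 T40 e4] := C_supp c4.
have eU : vsupport X4 = circ Bs U.
  by apply: (circuit_eq sB ed) => //; rewrite e4; apply: circuit_circ.
have [r r0 X4E] := circuits_wvec U0 c4 eU.
suff rE : r = sg F true ⋅ w B by rewrite four_termE -/U -rE -X4E.
have gb : (el U b).1 \in [:: b; c; d] by rewrite mem_head.
have := four_term_bcd w B u gb; rewrite four_termE -/U; have := r4 (el U b).
have elUb : el U b = el (fl B b) b by rewrite /U el_fl 1?eq_sym // el_fl 1?eq_sym.
have z2 : X2 B b c d (el U b) = tzero.
  by rewrite /X2 /scale wvec_off ?tmulr0 // in_tr_flN // elUb el_flNtr.
have z3 : X3 B b c d (el U b) = tzero.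
  by rewrite /X3 /scale wvec_off ?tmulr0 // in_tr_flN // elUb el_flNtr.
have shift (x y : F) : tnull [:: x; tzero; tzero; y] -> tnull [:: x; y].
  move=> t; apply/(@tnull_catr0 F 2 [:: _; _]); move: t; apply: tnull_perm.
  by apply/permP => P /=; congr (_ + _)%N; rewrite !addn0 [RHS]addnC -addnA.
rewrite z2 z3 => /shift/tnull2 E1 /shift/tnull2; rewrite -E1 X4E /scale.
have V0 : wvec w U (el U b) != tzero by rewrite wvec_el tmul_neq0 sg_neq0 w0 Ub.
by rewrite tmulC [in RHS]tmulC => E; apply/esym/(tmulI V0).
Qed.

(** When [fl (fl B b) c] is a basis and [fl (fl B b) d] is not, swapping the names of [c] and [d]
    leads back to a case of [four_null]. *)
Let wick_rel_base B b c d a : uniq [:: b; c; d; a] -> basis Bs B ->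
  basis Bs (fl (fl B c) d) -> wick_rel w (fl (fl (fl B b) c) d) (fl B a).
Proof.
move=> u bB bcd; have u3 : uniq [:: b; c; d].
  by move: u; rewrite /= !inE !negb_or => /and3P[/and3P[-> -> _] /andP[-> _]].
have [h|] := boolP (basis Bs (fl (fl B b) d) || ~~ basis Bs (fl (fl B b) c)).
  by apply/four_term_wick => //; apply: four_null.
rewrite negb_or negbK => /andP[_ bbc].
apply/four_term_wick => //; apply/four_term_swap23; apply: four_null.
- by have [? ? ?] := uniq3 u3; uniqs.
- by [].
- by rewrite flC.
- by rewrite bbc.
Qed.

Lemma circuits_wick_rel A A' : dist A A' = 4 -> wick_rel w A A'.
Proof.
move=> d4; have allz : (forall i, i \in dset A A' -> wick_term w A A' i = tzero) ->
  wick_rel w A A'.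
  move=> h; apply: (iffRL (@tnull_zeros _ _ _ _ [::] _ _ _)) => // [i iD _|];
    first exact: h.
  exact: tnull_nil.
have [[a aD]|na] := pselect (exists2 i, i \in dset A A' & wick_term w A A' i != tzero);
  last first.
  by apply: allz => i iD; apply/eqP; apply: contraT => ne; case: na; exists i.
rewrite /wick_term !tmul_neq0 sg_neq0 /= !w0 => /andP[bA bA'].
have c3 : #|dset A A' :\ a| = 3.
  by move: d4; rewrite /dist -/(dset A A') (cardsD1 a) aD => -[].
have [b [c [d [u hD]]]] : exists b c d, uniq [:: b; c; d; a] /\
    forall i, (i \in dset A A') = (i \in [:: b; c; d; a]).
  case e : (enum (dset A A' :\ a)) => [|b [|c [|d [|? ?]]]];
    try by move: c3; rewrite cardE e.
  exists b, c, d; split.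
    rewrite -[[:: b; c; d; a]]/([:: b; c; d] ++ [:: a]) -e cat_uniq enum_uniq /= orbF andbT.
    by rewrite mem_enum !inE eqxx.
  move=> i; rewrite -[[:: b; c; d; a]]/([:: b; c;
    d] ++ [:: a]) -e mem_cat mem_enum in_setD1 !inE.
  by have [->|_] := eqVneq i a; rewrite ?orbF // -in_dset.
pose B := fl A' a.
have AE : A = fl (fl (fl B b) c) d.
  have uA : A' = foldl (@fl n) A [:: b; c; d; a] by apply: dset_foldl.
  by rewrite /B uA /=; flips.
have A'E : A' = fl B a by rewrite /B flK.
have := u; rewrite /= !inE !negb_or => /and3P[/and3P[bc bd ba] /andP[cd ca] /andP[da _]].
have bB : basis Bs B by [].
clearbody B.
(* [wick_rel_base] wants a basis obtained from [B] by flipping two of [b], [c], [d]. An exchange of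
   [b] gives one for each partner: a partner [c] or [d] joins [b], and the partner [a] leaves [c]
   and [d]. *)
have [] := ed.2 _ _ b bB bA.
  rewrite AE !in_fl eqxx (negbTE bc) (negbTE bd) (negbTE ba) !addbF addbT.
  by case: (b \in B).
move=> x [xb]; rewrite AE !in_fl (negbTE xb) !addbF.
have [->|xc] := eqVneq x c.
  move=> _ bbc _; have -> : fl (fl (fl B b) c) d = fl (fl (fl B d) b) c by flips.
  by rewrite A'E; apply: wick_rel_base => //; uniqs.
have [->|xd] := eqVneq x d.
  move=> _ bbd _; have -> : fl (fl (fl B b) c) d = fl (fl (fl B c) b) d by flips.
  by rewrite A'E; apply: wick_rel_base => //; uniqs.
have [->|xa] := eqVneq x a; last by rewrite !addbF addbb.
move=> _ _ bcd; rewrite A'E; apply: wick_rel_base => //.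
by move: bcd; rewrite (_ : fl (fl _ b) a = fl (fl B c) d) //; flips.
Qed.

End WickRelation.

Lemma circuits_wick : exists2 psi : wickfun F n, weak_wick psi & wick_circuits psi = C.
Proof.
have [w w0 repw] := circuits_wick_function.
have wkE : wk (mkwick w) = w by apply: funext => A; apply: wk_mkwick.
have wpsi : weak_wick (mkwick w).
  apply/weak_wickP; rewrite wkE; split; last exact: circuits_wick_rel.
  by rewrite (_ : (fun A => w A != tzero) = basis Bs) //; apply: funext => A; rewrite w0.
exists (mkwick w) => //; apply/seteqP; split=> X.
  case=> X0 [T]; rewrite wkE => XT.
  have T0 : circ Bs T != set0 by rewrite -(vsupport_wvec _ w0) -(proportional_supp XT).
  have [r r0 ->] := proportional_trans XT (proportional_sym (repw T T0)).
  by apply: C_scale => //; have [] := repP T0.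
move=> cX; split; first exact: C_neq0.
have [T T0 eX] := C_supp cX; exists T; rewrite wkE.
exact: circuits_wvec.
Qed.

End CircuitsToWick.

(** * The bijections *)

Section Classes.
Variables (F : tract) (n : nat).
Implicit Types (psi : wickfun F n) (phi : gpfun F n).

Lemma proj_class_scale (I : Type) (c : F) (f : I -> F) : c != tzero ->
  proj_class (scale c f) = proj_class f.
Proof.
move=> c0; apply/seteqP; split=> _ [d /= d0 <-].
  exists (d ⋅ c); first by rewrite /= tmul_neq0 d0.
  by apply: funext => x; rewrite /scale tmulA.
exists (d ⋅ tinv c); first by rewrite /= tmul_neq0 d0 tinv_neq0.
by apply: funext => x; rewrite /scale tmulA tdivK.
Qed.

Lemma proj_class_refl (I : Type) (f : I -> F) : proj_class f f.
Proof.
exists tone; first exact: tone_neq0.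
by apply: funext => x; rewrite /scale tmul1.
Qed.

Lemma weak_wick_scale (c : F) psi : c != tzero -> weak_wick psi ->
  weak_wick (scale c psi : wickfun F n).
Proof.
move=> c0 /weak_wickP[ed w4]; apply/weak_wickP; split.
  rewrite (_ : (fun A => _) = (fun A => wk psi A != tzero)) //.
  by apply: funext => A; rewrite wk_scale tmul_neq0 c0.
move=> A B /w4; have cc0 : c ⋅ c != tzero by rewrite tmul_neq0 c0.
move/(tnull_scale cc0); rewrite /wick_rel /image_mem -map_comp.
rewrite (eq_map (g := wick_term (wk (scale c psi : wickfun F n)) A B)) // => i /=.
by rewrite /wick_term !wk_scale; tmonom.
Qed.

Lemma wick_to_rGP_class psi phi : weak_wick psi -> rGP_of_wick psi phi ->
  wick_to_rGP (proj_class psi) = proj_class phi.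
Proof.
move=> wpsi r; apply/seteqP; split=> [X [psi' [c /= c0 <-]] [phi0 r0]|X cX].
  have -> : phi0 = scale (c ⋅ c) phi.
    apply: rGP_of_wick_unique r0 _; first exact: weak_wick_scale.
    exact: rGP_of_wick_scale.
  by rewrite proj_class_scale // tmul_neq0 c0.
by exists psi; [exact: proj_class_refl | exists phi].
Qed.

Lemma wick_to_rGP_bij :
  set_bij (weak_orthogonal_matroids F n) (weak_rGP_classes F n) wick_to_rGP.
Proof.
split.
- move=> _ [psi /= wpsi <-]; have [phi r] := rGP_of_wick_exists wpsi.
  rewrite (wick_to_rGP_class wpsi r); exists phi => //.
  exact: weak_rGP_of_wick r.
- move=> K1 K2 /set_mem[psi1 /= w1 <-] /set_mem[psi2 /= w2 <-].
  have [phi1 r1] := rGP_of_wick_exists w1; have [phi2 r2] := rGP_of_wick_exists w2.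
  rewrite (wick_to_rGP_class w1 r1) (wick_to_rGP_class w2 r2) => e.
  have [c /= c0 ec] : proj_class phi2 phi1 by rewrite -e; apply: proj_class_refl.
  have [d d0 ->] := rGP_of_wick_inj w1 w2 r1 r2 c0 (esym ec).
  exact: proj_class_scale.
- move=> _ [phi /= wphi <-]; have [psi wpsi [phi0 [c [c0 r ->]]]] := weak_rGP_wick wphi.
  exists (proj_class psi); first by exists psi.
  by rewrite (wick_to_rGP_class wpsi r) proj_class_scale.
Qed.

Lemma basis_fsupport psi A : basis (fsupport psi) A = (wk psi A != tzero).
Proof. by rewrite /basis in_fsupport_tr. Qed.

Lemma fsupport_sub psi : fsupport psi \subset transversals n.
Proof. by apply/subsetP => S; rewrite in_fsupport => /andP[]. Qed.

Lemma weak_wick_even_delta psi : weak_wick psi -> even_delta (basis (fsupport psi)).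
Proof. by case=> /orthogonal_matroidP[]. Qed.

(** Equal circuits give equal bases, and the edge ratio from [A] to [fl (fl A i) j] is a ratio of
    two coordinates of the vector of [fl A i], the same for both functions. *)
Lemma wick_circuits_inj psi1 psi2 : weak_wick psi1 -> weak_wick psi2 ->
  wick_circuits psi1 = wick_circuits psi2 -> exists2 d : F, d != tzero & psi1 = scale d
    psi2.
Proof.
move=> w1 w2 e12.
have ed1 := weak_wick_even_delta w1; have ed2 := weak_wick_even_delta w2.
have cE D : circuit (fsupport psi1) D <-> circuit (fsupport psi2) D.
  have [[_ _ h1] _ _ _] := wick_weak_circuit_set w1.
  have [[_ _ h2] _ _ _] := wick_weak_circuit_set w2.
  by rewrite h1 h2 e12.
have bE A : basis (fsupport psi1) A = basis (fsupport psi2) A.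
  apply/(basisP (fsupport_sub psi1))/(basisP (fsupport_sub psi2)) => h D /cE; exact: h.
have circE T : circ (fsupport psi1) T = circ (fsupport psi2) T.
  by apply/setP => x; rewrite !in_circ bE.
have [|A|A i j ij bA bij|d d0 hd] := @wick_ratio F n (wk psi1) (wk psi2).
- have /weak_wickP[ed _] := w1; exact: ed.
- by apply: negb_inj; rewrite -!basis_fsupport bE.
- rewrite -!basis_fsupport in bA bij.
  have T0 : circ (fsupport psi1) (fl A i) != set0 by apply: (@circ_neq0 _ _ _ i);
    rewrite flK.
  have : wick_circuits psi2 (scale tone (wvec (wk psi1) (fl A i))).
    by rewrite -e12; apply: wick_circuits_wvec => //; apply: tone_neq0.
  move/(wick_circuits_circ w2 (T := fl A i)).
  rewrite vsupport_scale ?tone_neq0 // wvec_circ circE => /(_ erefl)[r r0 E].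
  have e k : wk psi1 (fl (fl A i) k) = r ⋅ wk psi2 (fl (fl A i) k).
    have := congr1 (fun V => V (el (fl A i) k)) E.
    by rewrite /scale !wvec_el tmul1 tmulCA => /(tmulI (sg_neq0 F _)).
  have := e i; have := e j; rewrite flK => -> ->; tmonom.
- by exists d => //; apply: wk_inj => A; rewrite wk_scale.
Qed.

Lemma wick_to_circuits_bij :
  set_bij (weak_orthogonal_matroids F n) (weak_circuit_sets F n) wick_to_circuits.
Proof.
split.
- move=> _ [psi /= wpsi <-]; rewrite wick_to_circuitsE //.
  by exists (fsupport psi); [case: wpsi | apply: wick_weak_circuit_set].
- move=> K1 K2 /set_mem[psi1 /= w1 <-] /set_mem[psi2 /= w2 <-].
  rewrite !wick_to_circuitsE // => /(wick_circuits_inj w1 w2)[d d0 ->].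
  exact: proj_class_scale.
- move=> C [Bs /orthogonal_matroidP[sB ed] wC].
  have [psi wpsi eC] := circuits_wick sB ed wC.
  by exists (proj_class psi); [exists psi | rewrite wick_to_circuitsE].
Qed.

Lemma rGP_vector_scale (c : F) phi S :
  rGP_vector (scale c phi : gpfun F n) S = scale c (rGP_vector phi S).
Proof.
apply: funext => x; rewrite /scale /rGP_vector; case: ifP => _; last by rewrite tmulr0.
by rewrite val_at_scale tmulCA.
Qed.

(** As [psi] vanishes at [A], so do the coordinates outside [tr A]; in the others [psi (fl A p)] is
    a common factor. *)
Lemma rGP_vector_wick psi phi s A p :
    (forall B, par B = ~~ s -> wk psi B = tzero) ->
    (forall B, gp phi B = wk psi B ⋅ wk psi B) ->
    (forall B i j, par B = s -> i != j -> gp2 phi B i j = wk psi B ⋅ wk psi (fl (fl B i)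
      j)) ->
    par A = ~~ s ->
  rGP_vector phi (hyper A p) =
  scale (sg F ((p \notin A) (+) omega p (+) sigma A p) ⋅ wk psi (fl A p)) (wvec (wk psi) A).
Proof.
move=> h1 h2 h3 pA; apply: funext => x; have [xA|xA] := boolP (x \in tr A).
  rewrite (trE xA) rGP_vector_el (gp_hyperE _ _ h2 h3) // /scale wvec_el -[in LHS]sgM.
  by tmonom.
rewrite /scale wvec_off // tmulr0; apply: rGP_vectorN => //.
by rewrite h2 h1 // tmul0.
Qed.

Lemma rGP_to_circuits_wick K : weak_orthogonal_matroids F n K ->
  rGP_to_circuits (wick_to_rGP K) = wick_to_circuits K.
Proof.
case=> psi /= wpsi <-; have [phi r] := rGP_of_wick_exists wpsi.
rewrite (wick_to_rGP_class wpsi r) wick_to_circuitsE //.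
have [s [hs _]] := wick_parity wpsi.
have [h1 h2 h3] := rGP_of_wick_parity wpsi r hs.
have supp0 (c : F) (X : vect F n) : vsupport (scale c X) != set0 -> c != tzero.
  case/set0Pn => x; rewrite in_vsupport /scale tmul_neq0; by case/andP.
apply/seteqP; split=> X [X0 h]; split=> //.
  case: h => _ [S [[c /= c0 <-] /(hyperP (~~ s))[A [p [pA eS]]] [d /= d0 eX]]].
  exists A; move: X0; rewrite -eX eS rGP_vector_scale (rGP_vector_wick _ h1 h2 h3) //.
  set r0 := sg _ _ ⋅ _; have -> : scale d (scale c (scale r0 (wvec (wk psi) A))) =
    scale (d ⋅ c ⋅ r0) (wvec (wk psi) A) by apply: funext => x; rewrite /scale; tmonom.
  by move=> X0; exists (d ⋅ c ⋅ r0) => //; apply: supp0 X0.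
case: h => A [c c0 eX].
(* Hyper-transversals over [A] give multiples of the wanted vector. An index [a] of the circuit
   makes [fl A a] a basis and the multiple nonzero. *)
have [a ba _] : exists2 a, basis (fsupport psi) (fl A a) & el A a \in circ (fsupport psi) A.
  by apply: circ_neq0P; rewrite -wvec_circ -(vsupport_scale _ c0) -eX.
rewrite basis_fsupport in ba.
have pA : par A = ~~ s by rewrite -(hs _ ba) par_fl negbK.
exists phi, (hyper A a); split; [exact: proj_class_refl | exact: hyper_hyper |].
rewrite (rGP_vector_wick _ h1 h2 h3) // proj_class_scale ?tmul_neq0 ?sg_neq0 // eX.
by exists c.
Qed.

(** The three maps form a commuting triangle in which the other two are bijections. *)
Lemma rGP_to_circuits_bij :
  set_bij (weak_rGP_classes F n) (weak_circuit_sets F n) rGP_to_circuits.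
Proof.
have [f1 i1 s1] := wick_to_rGP_bij; have [f2 i2 s2] := wick_to_circuits_bij.
split.
- by move=> G /s1[K wK <-]; rewrite rGP_to_circuits_wick //; apply: f2.
- move=> G1 G2 /set_mem/s1[K1 w1 <-] /set_mem/s1[K2 w2 <-].
  by rewrite !rGP_to_circuits_wick // => /i2 -> //; apply: mem_set.
- move=> C /s2[K wK <-]; exists (wick_to_rGP K); first exact: f1.
  exact: rGP_to_circuits_wick.
Qed.

End Classes.

Theorem theorem1p3 (F : tract) (n : nat) (n_gt0 : (0 < n)%N) :
  [/\ set_bij (weak_orthogonal_matroids F n) (weak_rGP_classes F n) wick_to_rGP,
      set_bij (weak_orthogonal_matroids F n) (weak_circuit_sets F n) wick_to_circuits,
      set_bij (weak_rGP_classes F n) (weak_circuit_sets F n) rGP_to_circuits &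
      forall K, weak_orthogonal_matroids F n K ->
        rGP_to_circuits (wick_to_rGP K) = wick_to_circuits K].
Proof.
split; [exact: wick_to_rGP_bij | exact: wick_to_circuits_bij |
        exact: rGP_to_circuits_bij | exact: rGP_to_circuits_wick].
Qed.
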